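(* Let $(K,v)$ be a tame valued field and $(K(x)|K,v)$ an extension of valued fields with $x$ transcendental over $K$. Then there exist monic irreducible polynomials $\{Q_i\}_{i\in S}$ and $\{Q_\nu\}_{\nu\in\Omega}$ over $K$, where $S$ is an initial segment of $\mathbb{N}$ and $\Omega=\emptyset$ or $\Omega=\{\nu\mid\nu<\lambda\}$ for some limit ordinal $\lambda$, having the following properties: (i) $\{Q_i\}_{i\in S}\cup\{Q_\nu\}_{\nu\in\Omega}$ forms a complete sequence of key polynomials for $(K(x)|K,v)$; (ii) $\deg Q_1=1$; (iii) there exist unique maximal roots $a_i$ of $Q_i$ ($i\in S$) and $z_\nu$ of $Q_\nu$ ($\nu\in\Omega$); (iv) $K(a_{i-1})\subsetneq K(a_i)$ and $\deg Q_{i-1}<\deg Q_i$ for $1<i\in S$; (v) $v(x-a_i)>v(x-a_{i-1})$ for $1<i\in S$; (vi) $v(x-a_i)=\max v(x-K(a_i))$ if $i\in S$ is not its last element or $\Omega=\emptyset$; (vii) $v(x-a_n)=\max v(x-\widetilde{K})$ if $S=\{1,\dots,n\}$ and $\Omega=\emptyset$; (viii) if $\Omega\neq\emptyset$, then $S$ is finite, and if $n$ is its last element, then $(z_\nu)_{\nu<\lambda}$ is a pseudo Cauchy sequence of transcendental type in $(K(a_n),v)$ and $\deg Q_n=\deg Q_\nu$ for all $\nu\in\Omega$; (ix) $\mathrm{IC}(K(x)|K,v)=K(a_i\mid i\in S)$, which is equal to $K(a_n)$ if $S=\{1,\dots,n\}$; (x) for each $k\in S$, $\{Q_i\}_{1\leq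 i\leq k}$ forms a complete sequence of key polynomials for $(K(a_k)|K,v)$. With $L:=\mathrm{IC}(K(x)|K,v)$, the extension $(L(x)|L,v)$ is weakly pure. The extension $(K(x)|K,v)$ is valuation algebraic if and only if $S=\mathbb{N}$ or $\Omega\neq\emptyset$. In both cases ($S=\mathbb N$ or $\Omega\ne\emptyset$), the extension $(L(x)|L,v)$ is immediate. In the case of $S=\mathbb{N}$, $(a_i)_{i\in\mathbb{N}}$ is a pseudo Cauchy sequence in $(L,v)$ of transcendental type with $x$ as its limit.
   Context: Valuations are Krull valuations written additively, $v(0)=\infty$. For a valued field $(L,v)$, $vL$ is the value group and $Lv$ the residue field. $\widetilde K$ is the algebraic closure of $K$. $\mathbb N=\{1,2,\dots\}$; an initial segment of $\mathbb N$ is $\mathbb N$ or $\{1,\dots,n\}$ with $n\in\mathbb N$. Given $(K(x)|K,v)$, an extension of $v$ to $\widetilde{K(x)}$ is fixed, and $\widetilde K\subseteq\widetilde{K(x)}$; all values below are taken with respect to it. For a set $M\subseteq\widetilde{K}$, $v(x-M)=\{v(x-c)\mid c\in M\}$. Tame: an algebraic extension $(L|K,v)$ is unibranched if the extension of $v$ from $K$ to $L$ is unique; it is tame if it is unibranched and every finite subextension $E|K$ satisfies: the ramification index $(vE:vK)$ is not divisible by $\mathrm{char}\,Kv$; $Ev|Kv$ is separable; and $[E:K]=(vE:vK)[Ev:Kv]$. A tame field is a henselian field $(K,v)$ such that $(\widetilde K|K,v)$ is a tame extension. Pseudo Cauchy sequences: for a limit ordinal $\lambda$, $(z_\nu)_{\nu<\lambda}$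 is a pseudo Cauchy sequence in $(K,v)$ if all $z_\nu\in K$ and $v(z_\tau-z_\sigma)>v(z_\sigma-z_\rho)$ whenever $\rho<\sigma<\tau<\lambda$; $y$ is a limit of it if $v(y-z_\nu)=v(z_{\nu+1}-z_\nu)$ for all $\nu<\lambda$; it is of transcendental type in $(K,v)$ if for every $f\in K[X]$ the value $vf(z_\nu)$ is eventually constant. $(K(x)|K,v)$ with $x$ transcendental is weakly pure (in $x$) if there is $a\in K$ with $v(x-a)=\max v(x-\widetilde K)$, or $x$ is limit of a pseudo Cauchy sequence in $(K,v)$ of transcendental type. It is valuation algebraic if $vK(x)/vK$ is a torsion group and $K(x)v|Kv$ is algebraic. An extension is immediate if value group and residue field do not change. Key polynomials (for an arbitrary simple extension $(K(x)|K,v)$, $x$ algebraic or transcendental): for nonconstant $f\in K[X]$ put $\delta(f)=\max\{v(x-a)\mid a\text{ a root of }f\}$ (and $\delta(f)=-\infty$ if $f$ has no roots). A root $a$ of $f$ with $\delta(f)=v(x-a)$ is a maximal root of $f$. A monic $Q\in K[X]$ is a key polynomial for $(K(x)|K,v)$ if for all $f\in K[X]$, $\deg f<\deg Q$ implies $\delta(f)<\delta(Q)$. A family of key polynomials $(Q_i)_{i\in I}$ is complete if for every nonconstant $f\in K[X]$ there is $i\in I$ with $\deg Q_i\leq\deg f$ and $\delta(f)\leq\delta(Q_i)$. For $(K(a_k)|K,v)$ these notions are taken with $a_k$ in place of $x$. For an extension $(F|K,v)$, the implicit constant field $\mathrm{IC}(F|K,v)$ is the relative algebraic closure of $K$ in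 a fixed henselization of $(F,v)$ (here: the henselization inside $(\widetilde{K(x)},v)$). *)

(* Defs.v *)
From HB Require Import structures.
From mathcomp Require Import all_boot all_order all_algebra.
From mathcomp Require Import ring_quotient separable.
From mathcomp Require Import boolp classical_sets wochoice.

Set Implicit Arguments.
Unset Strict Implicit.
Unset Printing Implicit Defensive.

Import Order.TTheory GRing.Theory.
Local Open Scope ring_scope.
Local Open Scope classical_set_scope.

HB.mixin Record isOrderedGroup G of Num.POrderedZmodule G := {
  ogroup_le_total : total (<=%R : rel G);
  ogroup_leD2r : forall z x y : G, x <= y -> x + z <= y + z
}.

#[short(type="orderedGroupType")]
HB.structure Definition OrderedGroup :=
  {G of isOrderedGroup G & Num.POrderedZmodule G}.

(* [NInf] is never the value of an element: it only serves as the delta of a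
   polynomial without roots. *)
Variant vext (G : Type) := NInf | Fin of G | PInf.
Arguments NInf {G}.
Arguments PInf {G}.

Section ValueOrder.
Variable G : orderedGroupType.

Let code (x : vext G) : option (option G) :=
  match x with NInf => None | Fin g => Some (Some g) | PInf => Some None end.
Let decode (c : option (option G)) : vext G :=
  match c with None => NInf | Some (Some g) => Fin g | Some None => PInf end.
Let codeK : cancel code decode. Proof. by case. Qed.

HB.instance Definition _ := Choice.copy (vext G) (can_type codeK).

Definition le_vext (x y : vext G) :=
  match x, y with
  | NInf, _ | _, PInf => true
  | Fin g, Fin h => g <= h
  | _, _ => false
  end.

Let le_vext_anti : antisymmetric le_vext.
Proof. by case=> [|g|] [|h|] //= /le_anti ->. Qed.
Let le_vext_trans : transitive le_vext.
Proof. by case=> [|g|] [|h|] [|k|] //=; apply: le_trans. Qed.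
Let le_vext_total : total le_vext.
Proof. by case=> [|g|] [|h|] //=; apply: ogroup_le_total. Qed.

HB.instance Definition _ := Order.isOrder.Build ring_display (vext G)
  (fun _ _ => erefl) (fun _ _ => erefl) (fun _ _ => erefl)
  le_vext_anti le_vext_trans le_vext_total.

Lemma le_Fin (g h : G) : (Fin g <= Fin h) = (g <= h). Proof. by []. Qed.

Definition is_max (A : set (vext G)) (m : vext G) :=
  A m /\ forall w, A w -> w <= m.

End ValueOrder.

Section Subfields.
Variable E : fieldType.
Implicit Types (K L : {pred E}) (a : E).

(* Subfields of E are elements of [divringClosed E]; plain predicates are used
   where closure is irrelevant. *)
Definition algebraic_over K a :=
  exists p : {poly E}, [/\ p \is a polyOver K, p != 0 & root p a].

Definition algclosure K : {pred E} := [pred a | `[< algebraic_over K a >]].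

Definition adjoin K (A : set E) : {pred E} :=
  [pred a | `[< forall M : divringClosed E,
    {subset K <= M} -> (forall b, A b -> b \in M) -> a \in M >]].

Fact adjoin_divring_closed K A : divring_closed (adjoin K A).
Proof.
split; first by apply/asboolP => M _ _; apply: rpred1.
  move=> a b /asboolP aP /asboolP bP; apply/asboolP => M KM AM.
  by apply: rpredB; [apply: aP | apply: bP].
move=> a b /asboolP aP /asboolP bP; apply/asboolP => M KM AM.
by apply: rpred_div; [apply: aP | apply: bP].
Qed.

HB.instance Definition _ K A :=
  GRing.isDivringClosed.Build E (adjoin K A) (adjoin_divring_closed K A).

Definition irreducible_over K (p : {poly E}) :=
  [/\ p \is a polyOver K, (1 < size p)%N &
    forall g h, g \is a polyOver K -> h \is a polyOver K ->
      p = g * h -> (size g = 1)%N \/ (size h = 1)%N].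

(* [L : K] = n, witnessed by a K-basis b of L *)
Definition has_degree L K (n : nat) :=
  exists b : 'I_n -> E, (forall i, b i \in L) /\
    forall a, a \in L -> exists! c : {ffun 'I_n -> E},
      (forall i, c i \in K) /\ a = \sum_i c i * b i.

Definition separable_ext L K :=
  forall a, a \in L -> exists p : {poly E},
    [/\ irreducible_over K p, separable_poly p & root p a].

End Subfields.

(* (A : B) = n for a subgroup B of A, witnessed by coset representatives g *)
Definition has_index (G : zmodType) (A B : set G) (n : nat) :=
  exists g : 'I_n -> G, (forall i, A (g i)) /\
    forall h, A h -> exists! i, B (h - g i).

Definition valuation_on (F : fieldType) (G : orderedGroupType) (L : {pred F})
    (w : F -> vext G) :=
  [/\ w 0 = PInf,
      forall a, a \in L -> a != 0 -> exists g, w a = Fin g,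
      forall a b g h, a \in L -> b \in L -> w a = Fin g -> w b = Fin h ->
        w (a * b) = Fin (g + h) &
      forall a b, a \in L -> b \in L -> Order.min (w a) (w b) <= w (a + b)].

Record valuation (F : fieldType) (G : orderedGroupType) := Valuation {
  valuation_fun :> F -> vext G;
  valuationP : valuation_on predT valuation_fun
}.

Section ResidueField.
Variables (F : fieldType) (G : orderedGroupType) (v : valuation F G).

Lemma val0 : v 0 = PInf. Proof. by case: (valuationP v). Qed.

Lemma val_fin a : a != 0 -> exists g, v a = Fin g.
Proof. by case: (valuationP v) => _ + _ _; apply. Qed.

Lemma valM a b g h : v a = Fin g -> v b = Fin h -> v (a * b) = Fin (g + h).
Proof. by case: (valuationP v) => _ _ + _; apply. Qed.

Lemma valD a b : Order.min (v a) (v b) <= v (a + b).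
Proof. by case: (valuationP v) => _ _ _; apply. Qed.

Lemma val1 : v 1 = Fin 0.
Proof.
have [g vg] := val_fin (oner_neq0 F).
by have := valM vg vg; rewrite mulr1 vg => -[/esym/eqP]; rewrite -subr_eq0 addrK => /eqP ->.
Qed.

Lemma ogroup_leDr (z x y : G) : (x + z <= y + z) = (x <= y).
Proof.
apply/idP/idP => [/(ogroup_leD2r (- z))|/ogroup_leD2r]; last exact.
by rewrite !addrK.
Qed.

Lemma ogroup_double_eq0 (g : G) : g + g = 0 -> g = 0.
Proof.
move=> gg; case/orP: (ogroup_le_total 0 g) => g0; apply/eqP; rewrite eq_le g0 ?andbT /=.
  by rewrite -(ogroup_leDr g) gg add0r.
by rewrite -(ogroup_leDr g) gg add0r.
Qed.

Lemma valN a : v (- a) = v a.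
Proof.
have vN1 : v (-1) = Fin 0.
  have N1 : (-1 : F) != 0 by rewrite oppr_eq0 oner_neq0.
  have [g vg] := val_fin N1.
  have := valM vg vg; rewrite mulrNN mulr1 val1 => -[/esym/ogroup_double_eq0 g0].
  by rewrite vg g0.
have [->|/val_fin[g vg]] := eqVneq a 0; first by rewrite oppr0.
by rewrite -mulN1r (valM vN1 vg) add0r vg.
Qed.

Lemma val_ge0M a b : Fin 0 <= v a -> Fin 0 <= v b -> Fin 0 <= v (a * b).
Proof.
have [->|/val_fin[g vg]] := eqVneq a 0; first by rewrite mul0r val0.
have [->|/val_fin[h vh]] := eqVneq b 0; first by rewrite mulr0 val0.
rewrite (valM vg vh) vg vh !le_Fin => g0 h0.
by apply: le_trans h0 _; rewrite -[X in X <= _]add0r ogroup_leDr.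
Qed.

Lemma val_gt0M a b : Fin 0 < v a -> Fin 0 <= v b -> Fin 0 < v (a * b).
Proof.
have [->|/val_fin[g vg]] := eqVneq a 0; first by rewrite mul0r val0.
have [->|/val_fin[h vh]] := eqVneq b 0; first by rewrite mulr0 val0.
move=> a0 b0; have := val_ge0M (ltW a0) b0; rewrite le_eqVlt => /orP[/eqP|//].
rewrite (valM vg vh) => -[gh0]; move: a0; rewrite ltNge => /negP[].
by rewrite vg le_Fin -(ogroup_leDr h) -gh0 add0r -le_Fin -vh.
Qed.

Definition valring : {pred F} := [pred a | Fin 0 <= v a].

Fact valring_subring_closed : subring_closed valring.
Proof.
split => [|a b a0 b0|a b]; rewrite ?inE ?val1 ?lexx //; last exact: val_ge0M.
by apply: le_trans (valD _ _); rewrite le_min valN; apply/andP.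
Qed.
HB.instance Definition _ :=
  GRing.isSubringClosed.Build F valring valring_subring_closed.

Record valring_type := ValringElt {
  valring_val :> F;
  _ : valring_val \in valring
}.
HB.instance Definition _ := [isSub for valring_val].
HB.instance Definition _ := [Choice of valring_type by <:].
HB.instance Definition _ := [SubChoice_isSubComNzRing of valring_type by <:].

Definition maxideal : {pred valring_type} := [pred a | Fin 0 < v (val a)].

Fact maxideal_idealr_closed : idealr_closed maxideal.
Proof.
split; rewrite ?inE /= ?val0 ?val1 ?ltxx // => a b c; rewrite !inE /= => b0 c0.
apply: lt_le_trans (valD _ _); rewrite lt_min c0 andbT mulrC.
by apply: val_gt0M => //; apply: (valP a).
Qed.
HB.instance Definition _ :=
  isIdealr.Build valring_type maxideal maxideal_idealr_closed.

Definition resfield := {ideal_quot maxideal}.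
HB.instance Definition _ := GRing.ComNzRing.on resfield.

Definition res (a : valring_type) : resfield := (\pi_resfield a)%qT.

Fact res_surj r : exists a, r = res a.
Proof. by exists (repr r); rewrite /res reprK. Qed.

Fact res_eq0 a : (res a == 0) = (Fin 0 < v (val a)).
Proof.
have -> : (0 : resfield) = res 0 by rewrite /res piE.
by rewrite /res -Quotient.idealrBE subr0 inE.
Qed.

Fact resM a b : res (a * b) = res a * res b.
Proof. by rewrite /res piE. Qed.

Fact resfield_mulVf (r : resfield) : r != 0 -> exists s, s * r = 1.
Proof.
have [a ->] := res_surj r; rewrite res_eq0 -leNgt => a_le0.
have a_ge0 : Fin 0 <= v (val a) by apply: (valP a).
have va0 : v (val a) = Fin 0 by apply/eqP; rewrite eq_le a_le0.
have a_neq0 : val a != 0 by apply: contra_eq_neq va0 => ->; rewrite val0.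
have a1_neq0 : (val a)^-1 != 0 by rewrite invr_eq0.
have [g vg] := val_fin a1_neq0.
have := valM vg va0; rewrite mulVf // val1 addr0 => -[g0].
have aV : (val a)^-1 \in valring by rewrite inE vg -g0.
exists (res (ValringElt aV)); rewrite -resM.
have -> : ValringElt aV * a = 1 by apply: val_inj; rewrite /= mulVf.
by rewrite /res piE.
Qed.

Definition resfield_inv (r : resfield) : resfield :=
  if pselect (r != 0) is left r0 then projT1 (cid (resfield_mulVf r0)) else 0.

Fact resfield_mulVr r : r != 0 -> resfield_inv r * r = 1.
Proof. by rewrite /resfield_inv; case: pselect => // r0 _; case: cid. Qed.

Fact resfield_inv0 : resfield_inv 0 = 0.
Proof.
by rewrite /resfield_inv; case: pselect => // r0; exfalso; rewrite eqxx in r0.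
Qed.

HB.instance Definition _ := GRing.ComNzRing_isField.Build resfield
  resfield_mulVr resfield_inv0.

(* Lv is realised inside the residue field of the ambient field F. *)
Definition residues (L : {pred F}) : {pred resfield} :=
  [pred r | `[< exists2 a : valring_type, val a \in L & r = res a >]].

Definition value_group (L : {pred F}) : set G :=
  [set g | exists2 a, a \in L & v a = Fin g].

End ResidueField.
Arguments residues {F G} v L.

Section ValuedExtensions.
Variables (F : fieldType) (G : orderedGroupType) (v : valuation F G).
Implicit Types (K L : {pred F}).

(* Valuations on L are compared up to equivalence: two of them coincide if they
   induce the same order relation between values. *)
Definition unibranched L K :=
  forall (G' : orderedGroupType) (w : F -> vext G'),
    valuation_on L w ->
    {in K &, forall a b, (w a <= w b) = (v a <= v b)} ->
    {in L &, forall a b, (w a <= w b) = (v a <= v b)}.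

(* Hensel's Lemma, rather than uniqueness of the extension of v to algebraic
   extensions. *)
Definition henselian K :=
  forall (f : {poly F}) b,
    f \is a polyOver [predI K & valring v] -> f \is monic ->
    b \in K -> b \in valring v ->
    Fin 0 < v f.[b] -> v f^`().[b] = Fin 0 ->
    exists a, [/\ a \in K, root f a & Fin 0 < v (a - b)].

(* The characteristic of Kv is that of the residue field of F. *)
Definition tame_ext L K :=
  [/\ {subset K <= L}, forall a, a \in L -> algebraic_over K a,
      unibranched L K &
      forall (E : divringClosed F) n,
        {subset K <= E} -> {subset E <= L} -> has_degree E K n ->
        exists e f,
          [/\ has_index (value_group v E) (value_group v K) e,
              forall p, p \in [pchar (resfield v)] -> ~~ (p %| e)%N,
              has_degree (residues v E) (residues v K) f,
              separable_ext (residues v E) (residues v K) &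
              n = (e * f)%N]].

Definition immediate L K :=
  value_group v L = value_group v K /\ residues v L =i residues v K.

Definition valuation_algebraic L K :=
  (forall g, value_group v L g ->
     exists2 m, (0 < m)%N & value_group v K (g *+ m)) /\
  (forall r, r \in residues v L -> algebraic_over (residues v K) r).

(* The smallest henselian subfield of F containing L; when F is algebraically
   closed this is the henselization of L inside F. *)
Definition henselization L : {pred F} :=
  [pred a | `[< forall M : divringClosed F,
    {subset L <= M} -> henselian M -> a \in M >]].

Fact henselization_divring_closed L : divring_closed (henselization L).
Proof.
split; first by apply/asboolP => M _ _; apply: rpred1.
  move=> a b /asboolP aP /asboolP bP; apply/asboolP => M LM hM.
  by apply: rpredB; [apply: aP | apply: bP].
move=> a b /asboolP aP /asboolP bP; apply/asboolP => M LM hM.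
by apply: rpred_div; [apply: aP | apply: bP].
Qed.
HB.instance Definition _ L := GRing.isDivringClosed.Build F (henselization L)
  (henselization_divring_closed L).

(* IC(L|K, v), the henselization of L being taken inside F *)
Definition implicit_constants L K : {pred F} :=
  [predI henselization L & algclosure K].

Section PseudoCauchy.
Context {d : Order.disp_t} {I : orderType d}.
Implicit Types (z : I -> F).

Definition pseudo_cauchy K z :=
  (forall i, z i \in K) /\
  (forall r s t : I, (r < s)%O -> (s < t)%O ->
     v (z s - z r) < v (z t - z s)).

Definition is_succ (i j : I) := (i < j)%O /\ forall k, (i < k)%O -> (j <= k)%O.

Definition pseudo_limit z y :=
  forall i j, is_succ i j -> v (y - z i) = v (z j - z i).

Definition transcendental_type K z :=
  forall f : {poly F}, f \is a polyOver K ->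
    exists i, forall j, (i <= j)%O -> v f.[z j] = v f.[z i].

End PseudoCauchy.

(* v(x - M) *)
Definition distances x (M : {pred F}) : set (vext G) :=
  [set w | exists2 c, c \in M & w = v (x - c)].

End ValuedExtensions.

(* The well-ordered sets without last element are, up to isomorphism, the
   sets {nu | nu < lambda} with lambda = 0 or lambda a limit ordinal. *)
Definition limit_order d (I : orderType d) :=
  well_order (<=%O : rel I) /\ forall i : I, exists j, (i < j)%O.

Section WeaklyPure.
Variables (F : fieldType) (G : orderedGroupType) (v : valuation F G).

Definition weakly_pure (K : {pred F}) x :=
  (exists2 a, a \in K & is_max (distances v x (algclosure K)) (v (x - a))) \/
  (exists d (I : orderType d) (z : I -> F),
     [/\ limit_order I, inhabited I, pseudo_cauchy v K z,
         transcendental_type v K z & pseudo_limit v z x]).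

End WeaklyPure.

Definition tame_field (F : closedFieldType) (G : orderedGroupType)
    (v : valuation F G) (K : {pred F}) :=
  henselian v K /\ tame_ext v (algclosure K) K.

Section KeyPolynomials.
Variables (F : closedFieldType) (G : orderedGroupType) (v : valuation F G).
Implicit Types (K : {pred F}) (x : F) (f : {poly F}).

Definition root_seq f : seq F :=
  if f == 0 then [::] else projT1 (closed_field_poly_normal f).

(* -oo on all constants, 0 included *)
Definition delta x f : vext G :=
  \big[Order.max/NInf]_(a <- root_seq f) v (x - a).

Definition maximal_root x f a := root f a /\ delta x f = v (x - a).

Definition key_polynomial K x (Q : {poly F}) :=
  [/\ Q \is a polyOver K, Q \is monic &
      forall f, f \is a polyOver K -> (size f < size Q)%N ->
        delta x f < delta x Q].

Definition complete_key_polynomials K x (P : set {poly F}) :=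
  (forall Q, P Q -> key_polynomial K x Q) /\
  (forall f, f \is a polyOver K -> (1 < size f)%N ->
     exists Q, [/\ P Q, (size Q <= size f)%N & delta x f <= delta x Q]).

End KeyPolynomials.

Definition posnat : set nat := [set i | (0 < i)%N].
Definition upto (n : nat) : set nat := [set i | (0 < i <= n)%N].
Definition initial_segment (S : set nat) :=
  S = posnat \/ exists2 n, (0 < n)%N & S = upto n.

(* Main.v *)
From HB Require Import structures.
Require Import Defs.
From mathcomp Require Import all_boot all_order all_algebra.
From mathcomp Require Import ring_quotient separable.
From mathcomp Require Import boolp classical_sets wochoice ring.

Set Implicit Arguments.
Unset Strict Implicit.
Unset Printing Implicit Defensive.

Import Order.TTheory GRing.Theory.
Local Open Scope ring_scope.
Local Open Scope classical_set_scope.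

(** Write Kt for the algebraic closure of K in F, and call the degree of an
    algebraic element its degree over K.

    The theorem rests on one property of a tame field K, [averaging]: if all
    conjugates of b over a field E between K and Kt lie in a ball around b, then
    this ball contains an element of E. To prove it, let c be the best
    approximation of b in E. It exists by [tame_max], because a finite extension
    of K has no proper finite immediate extension: its degree is determined by
    its value group and residue field. If all conjugates of h = b - c had the
    leading term of h, then extracting a root of order prime to the residue
    characteristic from a power of h would give an element of E with this
    leading term, and c could be improved.

    Say that a is of minimal degree near y if all elements of smaller degree are
    farther from y than a is. By [averaging], such an a is isolated: its other
    conjugates are farther from a than y is ([min_degree_isolated]). Two versions
    of Krasner's lemma follow. If y is algebraic, then a is in K(y) ([krasner]),
    and if y lies in a henselian field M that contains K, then a is in M
    ([krasner_hensel]). Moreover a is the unique maximal root of its minimal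
    polynomial, which is a key polynomial ([max_root_minp], [key_minp]).

    The a i are chosen successively: a 1 is a best approximation of x in K, and
    a (i+1) is a best one among the elements of the least degree that allows for
    an improvement of a i (an arbitrary one if there is no best one). They are of
    minimal degree near x, so [krasner] gives an increasing chain of fields
    K(a i). The process may go on forever. It may stop since a n is the best approximation of x in Kt. Finally, there may be no
    best approximation in the degree of a n; then K(a n) approximates x better
    than any given algebraic element ([adjoin_cofinal], again by [tame_max]), and
    a well-ordered cofinal set of distances gives the family of the z nu. In all
    cases the elements chosen approximate x as well as any algebraic element,
    without exceeding its degree ([approx_cover]), which is completeness.

    Let L' be generated by the a i. By [krasner_hensel] it is contained in the
    implicit constant field. For the converse, [immediate_henselization] provides
    a henselian immediate extension M of L'(x), and we need that M contains no
    algebraic elements outside L' ([henselization_trace]). Since L' approximates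
    x as well as Kt does, conjugations over L' preserve the distances of algebraic
    elements to x, and so they extend to isometries of Kt(x) over L'(x). An
    algebraic element of M outside L' has, up to translation by an element of
    L', the leading term of an element of L'(x), which is fixed by conjugation;
    this contradicts [averaging].

    If x has no best approximation in Kt, the elements of L' compute the leading
    terms of L'(x), so L'(x) is immediate over L' and K(x) is valuation algebraic
    over K. If a is a best approximation, then the value of x - a is not torsion,
    or x - a divided by an algebraic element has a transcendental residue
    ([best_not_valuation_algebraic]). *)

(** * Valuations and leading terms *)

Section Valuations.
Variables (F : fieldType) (G : orderedGroupType) (v : valuation F G).
Implicit Types a b c d : F.

Lemma val_lePInf (g : vext G) : g <= PInf.
Proof. by case: g. Qed.

Lemma val_eqPInf a : (v a == PInf) = (a == 0).
Proof.
have [->|/(val_fin v)[g ->]] := eqVneq a 0; first by rewrite val0.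
by apply/eqP.
Qed.

Lemma val_ltPInf a : (v a < PInf) = (a != 0).
Proof. by rewrite lt_neqAle val_eqPInf val_lePInf andbT. Qed.

Lemma val_gtNInf a : NInf < v a.
Proof.
have [->|/(val_fin v)[g ->]] := eqVneq a 0; first by rewrite val0.
by [].
Qed.

Lemma lt_neq0 (a : F) (g : vext G) : v a < g -> a != 0.
Proof. by move=> ag; rewrite -val_ltPInf (lt_le_trans ag) ?val_lePInf. Qed.

Lemma valBC a b : v (a - b) = v (b - a).
Proof. by rewrite -valN opprB. Qed.

Lemma val_leD (g : vext G) a b : g <= v a -> g <= v b -> g <= v (a + b).
Proof. by move=> ga gb; apply: le_trans (Defs.valD v a b); rewrite le_min ga. Qed.

Lemma val_ltD (g : vext G) a b : g < v a -> g < v b -> g < v (a + b).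
Proof. by move=> ga gb; apply: lt_le_trans (Defs.valD v a b); rewrite lt_min ga. Qed.

Lemma val_leB (g : vext G) a b : g <= v a -> g <= v b -> g <= v (a - b).
Proof. by move=> ga gb; apply: val_leD; rewrite ?valN. Qed.

Lemma val_ltB (g : vext G) a b : g < v a -> g < v b -> g < v (a - b).
Proof. by move=> ga gb; apply: val_ltD; rewrite ?valN. Qed.

Lemma le_dist b (g : vext G) a c : g <= v (a - b) -> g <= v (b - c) -> g <= v (a - c).
Proof. by move=> ab bc; rewrite -(subrKA b) val_leD. Qed.

Lemma lt_dist b (g : vext G) a c : g < v (a - b) -> g < v (b - c) -> g < v (a - c).
Proof. by move=> ab bc; rewrite -(subrKA b) val_ltD. Qed.

Lemma valDl a b : v a < v b -> v (a + b) = v a.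
Proof.
move=> ab; apply/eqP; rewrite eq_le val_leD ?(ltW ab) // andbT leNgt.
by apply/negP => aab; have := val_ltB aab ab; rewrite addrK ltxx.
Qed.

(** The isosceles triangle principle, oriented so that it replaces the centre
    a by a point b that is closer to a than c is. *)
Lemma dist_eq b a c : v (a - c) < v (a - b) -> v (b - c) = v (a - c).
Proof.
move=> ac; have -> : b - c = (a - c) + (b - a) by rewrite [RHS]addrC subrKA.
by rewrite valDl // [ltRHS]valBC.
Qed.

Lemma valM_le c a b : v a <= v b -> v (a * c) <= v (b * c).
Proof.
have [->|/(val_fin v)[k vc]] := eqVneq c 0; first by rewrite !mulr0.
have [->|/(val_fin v)[h vb]] := eqVneq b 0.
  by rewrite mul0r val0 !val_lePInf.
have [->|/(val_fin v)[g va]] := eqVneq a 0; first by rewrite val0 vb.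
by rewrite (Defs.valM va vc) (Defs.valM vb vc) va vb !le_Fin ogroup_leDr.
Qed.

Lemma valM_lt c a b : c != 0 -> v a < v b -> v (a * c) < v (b * c).
Proof.
move=> c0; rewrite !ltNge; apply: contra => /(valM_le c^-1).
by rewrite !mulfK.
Qed.

Lemma valM_eq a b c d : v a = v b -> v c = v d -> v (a * c) = v (b * d).
Proof.
move=> ab cd; apply: le_anti; apply/andP; split.
  apply: (@le_trans _ _ (v (b * c))); first by rewrite valM_le ?ab.
  by rewrite ![b * _]mulrC valM_le ?cd.
apply: (@le_trans _ _ (v (b * c))); last by rewrite valM_le ?ab.
by rewrite ![b * _]mulrC valM_le ?cd.
Qed.

Lemma valV_eq a b : v a = v b -> v a^-1 = v b^-1.
Proof.
move=> ab; have [a0|a0] := eqVneq a 0.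
  move/eqP: ab; rewrite a0 val0 eq_sym val_eqPInf => /eqP ->.
  by rewrite invr0.
have b0 : b != 0 by rewrite -val_eqPInf -ab val_eqPInf.
have ba : v b = v a by [].
have := valM_eq ba (erefl (v (a^-1 * b^-1))).
by rewrite mulrCA divff // mulr1 mulrA divff // mul1r.
Qed.

Lemma valX_eq a b n : v a = v b -> v (a ^+ n) = v (b ^+ n).
Proof.
by move=> ab; elim: n => [|n IH]; rewrite ?expr0 // !exprS; apply: valM_eq.
Qed.

Lemma val_ge0_X a n : Fin 0 <= v a -> Fin 0 <= v (a ^+ n).
Proof.
move=> a0; elim: n => [|n IH]; first by rewrite expr0 Defs.val1.
by rewrite exprS val_ge0M.
Qed.

(** Equality of leading terms, that is, of classes in the group of nonzero
    elements modulo principal units: a congruence for products and quotients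
    which determines the value. *)
Definition close a b := v a < v (a - b).

Lemma close_neq0 a b : close a b -> a != 0.
Proof. exact: lt_neq0. Qed.

Lemma close_refl a : a != 0 -> close a a.
Proof. by move=> a0; rewrite /close subrr val0 val_ltPInf. Qed.

Lemma close_val a b : close a b -> v a = v b.
Proof.
by rewrite /close => ab; rewrite -[b](subKr a) valDl // valN.
Qed.

Lemma close_sym a b : close a b -> close b a.
Proof. by move=> ab; rewrite /close valBC -(close_val ab). Qed.

Lemma close_neq0r a b : close a b -> b != 0.
Proof. by move/close_sym/close_neq0. Qed.

Lemma close_trans b a c : close a b -> close b c -> close a c.
Proof.
move=> ab bc; rewrite /close -(subrKA b) val_ltD //.
by rewrite (close_val ab).
Qed.

Lemma close_mul a b c d : close a b -> close c d -> close (a * c) (b * d).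
Proof.
move=> ab cd.
have -> : close (a * c) (b * d) = (v (a * c) < v ((a - b) * c + b * (c - d))).
  by rewrite /close mulrBl mulrBr addrA subrK.
apply: val_ltD; first by rewrite valM_lt // (close_neq0 cd).
rewrite (valM_eq (close_val ab) (erefl _)) ![b * _]mulrC.
by rewrite valM_lt // (close_neq0r ab).
Qed.

Lemma close_inv a b : close a b -> close a^-1 b^-1.
Proof.
move=> ab; have a0 := close_neq0 ab; have b0 := close_neq0r ab.
rewrite /close (valV_eq (close_val ab)).
have -> : a^-1 - b^-1 = (b - a) * (a^-1 * b^-1).
  by rewrite mulrBl mulrCA divff // mulr1 mulrA divff // mul1r.
have := @valM_lt (a^-1 * b^-1) a (b - a).
by rewrite mulrA divff // mul1r valBC; apply; rewrite // mulf_neq0 ?invr_eq0.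
Qed.

Lemma close_div a b c d : close a b -> close c d -> close (a / c) (b / d).
Proof. by move=> ab cd; apply: close_mul => //; apply: close_inv. Qed.

Lemma close_exp a b n : close a b -> close (a ^+ n) (b ^+ n).
Proof.
move=> ab; elim: n => [|n IH]; first by rewrite !expr0 close_refl ?oner_neq0.
by rewrite !exprS close_mul.
Qed.

Lemma close_prod (I : eqType) (r : seq I) (f g : I -> F) :
  {in r, forall i, close (f i) (g i)} ->
  close (\prod_(i <- r) f i) (\prod_(i <- r) g i).
Proof.
elim: r => [|i r IH] fg; first by rewrite !big_nil close_refl ?oner_neq0.
rewrite !big_cons close_mul ?fg ?mem_head // IH // => j jr.
by rewrite fg // in_cons jr orbT.
Qed.

End Valuations.

Section ClosedValuations.
Variables (F : closedFieldType) (G : orderedGroupType) (v : valuation F G).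

Lemma poly_splits (p : {poly F}) :
  exists r : seq F, p = lead_coef p *: \prod_(z <- r) ('X - z%:P).
Proof. by have [r pr] := closed_field_poly_normal p; exists r. Qed.

Lemma root_split (p : {poly F}) (r : seq F) : p != 0 ->
  p = lead_coef p *: \prod_(z <- r) ('X - z%:P) -> root p =i mem r.
Proof.
move=> p0 pr z; rewrite -topredE /= pr rootZ ?lead_coef_eq0 // root_prod_XsubC.
by [].
Qed.

Lemma horner_split (p : {poly F}) (r : seq F) y :
  p = lead_coef p *: \prod_(z <- r) ('X - z%:P) ->
  p.[y] = lead_coef p * \prod_(z <- r) (y - z).
Proof.
move=> pr; rewrite {1}pr hornerZ horner_prod; congr (_ * _).
by apply: eq_bigr => z _; rewrite hornerXsubC.
Qed.

(** If c approximates y better than every root z of p does, then y - z and c -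
    z have the same leading term for each of these roots. *)
Lemma close_horner (p : {poly F}) y c : p != 0 ->
  (forall z, root p z -> v (y - z) < v (y - c)) -> close v p.[y] p.[c].
Proof.
move=> p0 yc; have [r pr] := poly_splits p.
rewrite !(horner_split _ pr); apply: close_mul.
  by rewrite close_refl ?lead_coef_eq0.
apply: close_prod => z zr; rewrite /close opprB addrA subrK yc //.
by rewrite -[root _ _]/(z \in root p) (root_split p0 pr).
Qed.

Lemma val_horner_eq (p : {poly F}) y c : p != 0 ->
  (forall z, root p z -> v (y - z) = v (c - z)) -> v p.[y] = v p.[c].
Proof.
move=> p0 yc; have [r pr] := poly_splits p.
rewrite !(horner_split _ pr); apply: valM_eq => //.
have {}yc : {in r, forall z, v (y - z) = v (c - z)}.
  by move=> z zr; apply: yc; rewrite -[root _ _]/(z \in root p) (root_split p0 pr).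
elim: {pr}r yc => [|z r IH] yc; first by rewrite !big_nil.
rewrite !big_cons; apply: valM_eq; first exact: yc (mem_head _ _).
by apply: IH => t tr; rewrite yc // in_cons tr orbT.
Qed.

End ClosedValuations.

Section Best.
Variables (F : fieldType) (G : orderedGroupType) (v : valuation F G).
(** In a chain of distances the best of finitely many approximations is at
    least as good as each of them. The element e takes care of an empty list.
    *)
Lemma common_improvement (L : F -> Prop) (y e : F) (r : seq F) : L e ->
  {in r, forall z, exists2 c, L c & v (y - z) < v (y - c)} ->
  exists2 c, L c & {in r, forall z, v (y - z) < v (y - c)}.
Proof.
move=> Le; elim: r => [|z r IH] H; first by exists e.
have [|c Lc cr] := IH; first by move=> t tr; apply: H; rewrite in_cons tr orbT.
have [d Ld dz] := H z (mem_head _ _).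
have [cd|dc] := leP (v (y - c)) (v (y - d)).
  exists d => // t; rewrite in_cons => /predU1P[->//|/cr ct].
  exact: lt_le_trans ct cd.
exists c => // t; rewrite in_cons => /predU1P[->|/cr //].
exact: lt_trans dz dc.
Qed.

End Best.

(** * Subfields, minimal polynomials and adjunction *)

(** A subset of F that is described by a property becomes a bundled subfield,
    which is the form in which the universal property of adjunction can be
    used. *)
Lemma divring_of_Prop (F : fieldType) (P : F -> Prop) :
  P 1 -> (forall a b, P a -> P b -> P (a - b)) ->
  (forall a b, P a -> P b -> P (a / b)) ->
  exists M : divringClosed F, forall a, a \in M <-> P a.
Proof.
move=> P1 PB PV; pose M := [pred a : F | `[< P a >]].
have cl : divring_closed M.
  split; first exact/asboolP.
    by move=> a b /asboolP Pa /asboolP Pb; apply/asboolP/PB.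
  by move=> a b /asboolP Pa /asboolP Pb; apply/asboolP/PV.
pose MH := GRing.isDivringClosed.Build F M cl.
pose M' : divringClosed F := HB.pack (M : {pred F}) MH.
by exists M' => a; split => /asboolP.
Qed.

Section Subfields.
Variable F : fieldType.

(** The type of elements of K. Since it is a field, Euclidean division of
    polynomials with coefficients in K takes place in it and can be
    transported back to F. *)
Record subf (K : divringClosed F) := Subf { subf_val :> F; _ : subf_val \in K }.

Section Struct.
Variable K : divringClosed F.
HB.instance Definition _ := [isSub for @subf_val K].
HB.instance Definition _ := [Choice of subf K by <:].
HB.instance Definition _ := [SubChoice_isSubIntegralDomain of subf K by <:].
HB.instance Definition _ := [SubIntegralDomain_isSubField of subf K by <:].
End Struct.

Implicit Types (K L M : divringClosed F) (a b c : F) (p q : {poly F}).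

Lemma subfP K (m : subf K) : val m \in K. Proof. exact: (valP m). Qed.

Definition subf_incl K : {rmorphism subf K -> F} := val.

Lemma polyOver_subf K p : p \is a polyOver K ->
  exists q : {poly subf K}, p = map_poly (subf_incl K) q.
Proof.
move=> /polyOverP pK; exists (\poly_(i < size p) insubd 0 p`_i).
apply/polyP => i; rewrite coef_map coef_poly.
case: ltnP => pi; last exact: nth_default.
by rewrite /= insubdK.
Qed.

Lemma subf_polyOver K (q : {poly subf K}) : map_poly (subf_incl K) q \is a polyOver K.
Proof. by apply/polyOverP => i; rewrite coef_map /=; apply: (valP q`_i). Qed.

Lemma modp_over K p q : p \is a polyOver K -> q \is a polyOver K ->
  p %% q \is a polyOver K.
Proof.
move=> /polyOver_subf[p' ->] /polyOver_subf[q' ->].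
by rewrite -map_modp subf_polyOver.
Qed.

Lemma divp_over K p q : p \is a polyOver K -> q \is a polyOver K ->
  p %/ q \is a polyOver K.
Proof.
move=> /polyOver_subf[p' ->] /polyOver_subf[q' ->].
by rewrite -map_divp subf_polyOver.
Qed.

Lemma polyOver_sub (K L : {pred F}) p : {subset K <= L} ->
  p \is a polyOver K -> p \is a polyOver L.
Proof. by move=> KL /allP pK; apply/allP => a /pK/KL. Qed.

Lemma root_algebraic K p a : p \is a polyOver K -> p != 0 -> root p a ->
  a \in algclosure K.
Proof. by move=> pK p0 pa; apply/asboolP; exists p. Qed.

Lemma mem_algclosure K a : a \in K -> a \in algclosure K.
Proof.
move=> aK; apply: (@root_algebraic _ ('X - a%:P)).
- by rewrite polyOverXsubC.
- by rewrite polyXsubC_eq0.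
- by rewrite root_XsubC.
Qed.

Lemma algclosureP K a : reflect (algebraicOver (subf_incl K) a) (a \in algclosure K).
Proof.
apply: (iffP (asboolP _)) => -[p].
  case=> /polyOver_subf[q ->]; rewrite map_poly_eq0 => q0 qa; by exists q.
by move=> p0 pa; exists (map_poly (subf_incl K) p); rewrite subf_polyOver map_poly_eq0.
Qed.

Fact algclosure_divring_closed K : divring_closed (algclosure K).
Proof.
split=> [|a b /algclosureP aK /algclosureP bK|a b /algclosureP aK /algclosureP bK].
- exact/algclosureP/algebraic1.
- exact/algclosureP/algebraic_sub.
- exact/algclosureP/algebraic_div.
Qed.
HB.instance Definition _ K :=
  GRing.isDivringClosed.Build F (algclosure K) (algclosure_divring_closed K).

Lemma algclosure_sub (K L : {pred F}) : {subset K <= L} ->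
  {subset algclosure K <= algclosure L}.
Proof.
move=> KL a /asboolP[p [pK p0 pa]]; apply/asboolP; exists p; split => //.
exact: polyOver_sub pK.
Qed.

(** The coefficients of the monic multiple of p are algebraic, hence integral
    over K, and integrality is transitive. *)
Lemma algclosure_trans K (p : {poly F}) a : p \is a polyOver (algclosure K) ->
  p != 0 -> root p a -> a \in algclosure K.
Proof.
move=> pK p0 pa; apply/algclosureP/integral_algebraic.
pose q := (lead_coef p)^-1 *: p.
have lp : lead_coef p != 0 by rewrite lead_coef_eq0.
have qm : q \is monic by rewrite monicE lead_coefZ mulVf.
have qa : root q a by rewrite rootZ ?invr_eq0.
have qK : q \is a polyOver (algclosure K).
  by rewrite polyOverZ ?rpredV ?(polyOverP pK).
apply: (integral_root_monic qm qa) => c /(allP (qK)) /algclosureP.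
by move/integral_algebraic.
Qed.

Lemma minpoly_exists K a : a \in algclosure K ->
  exists p, [/\ p \is a polyOver K, p \is monic, root p a &
    forall q, q \is a polyOver K -> root q a -> p %| q].
Proof.
move=> /asboolP[p0 [p0K p0n0 p0a]].
pose P n := `[< exists p, [/\ p \is a polyOver K, p != 0, root p a & size p = n] >].
have exP : exists n, P n by exists (size p0); apply/asboolP; exists p0.
case: (ex_minnP exP) => n /asboolP[p [pK pn0 pa <-]] nmin.
have lp : lead_coef p != 0 by rewrite lead_coef_eq0.
exists ((lead_coef p)^-1 *: p); split.
- by rewrite polyOverZ ?rpredV ?(polyOverP pK).
- by rewrite monicE lead_coefZ mulVf.
- by rewrite rootZ ?invr_eq0.
move=> q qK qa; rewrite dvdpZl ?invr_eq0 //.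
rewrite /dvdp; apply: contraT => r0.
have rK := modp_over qK pK.
have ra : root (q %% p) a.
  have := qa; rewrite {1}(divp_eq q p) /root !hornerE (eqP pa) mulr0 add0r.
  by [].
have /nmin : P (size (q %% p)) by apply/asboolP; exists (q %% p); split.
by rewrite leqNgt ltn_modp pn0.
Qed.

(** The minimal polynomial; the value 1 for elements that are not algebraic is
    a junk value. *)
Definition minp K a : {poly F} :=
  if pselect (a \in algclosure K) is left aK
  then sval (cid (minpoly_exists aK)) else 1.

Definition adeg K a := (size (minp K a)).-1.

Section Minp.
Variables (K : divringClosed F) (a : F).
Hypothesis aK : a \in algclosure K.

Let minp_spec : [/\ minp K a \is a polyOver K, minp K a \is monic,
  root (minp K a) a &
    forall q, q \is a polyOver K -> root q a -> minp K a %| q].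
Proof. by rewrite /minp; case: pselect => [aK1|/(_ aK)//]; exact: (svalP (cid (minpoly_exists aK1))). Qed.

Lemma minp_over : minp K a \is a polyOver K. Proof. by case: minp_spec. Qed.
Lemma minp_monic : minp K a \is monic. Proof. by case: minp_spec. Qed.
Lemma minp_root : root (minp K a) a. Proof. by case: minp_spec. Qed.
Lemma minp_dvd q : q \is a polyOver K -> root q a -> minp K a %| q.
Proof. by case: minp_spec => _ _ _; apply. Qed.
Lemma minp_neq0 : minp K a != 0. Proof. exact: monic_neq0 minp_monic. Qed.

Lemma minp_size_gt1 : (1 < size (minp K a))%N.
Proof. exact: root_size_gt1 minp_neq0 minp_root. Qed.

Lemma minp_size_le q : q \is a polyOver K -> q != 0 -> root q a ->
  (size (minp K a) <= size q)%N.
Proof. by move=> qK q0 qa; rewrite dvdp_leq ?minp_dvd. Qed.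

Lemma size_minp : size (minp K a) = (adeg K a).+1.
Proof. by rewrite /adeg prednK // ltnW ?minp_size_gt1. Qed.

Lemma adeg_gt0 : (0 < adeg K a)%N.
Proof. by rewrite -ltnS -size_minp minp_size_gt1. Qed.

Lemma minp_irr : irreducible_over K (minp K a).
Proof.
split; [exact: minp_over|exact: minp_size_gt1|move=> g h gK hK gh].
have gh0 : g * h != 0 by rewrite -gh minp_neq0.
have [g0 h0] : g != 0 /\ h != 0.
  by move: gh0; rewrite mulf_eq0 negb_or => /andP.
have : root (g * h) a by rewrite -gh minp_root.
have sz := size_mul g0 h0; rewrite -gh in sz.
have sg : (0 < size g)%N by rewrite lt0n size_poly_eq0.
have sh : (0 < size h)%N by rewrite lt0n size_poly_eq0.
rewrite rootM => /orP[ga|ha].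
  right; have := minp_size_le gK g0 ga; rewrite sz -{2}[size g]addn0.
  case: (size h) sh => // m _; rewrite addnS /= leq_add2l leqn0 => /eqP -> //.
left; have := minp_size_le hK h0 ha; rewrite sz -{2}[size h]add0n.
case: (size g) sg => // m _; rewrite addSn /= leq_add2r leqn0 => /eqP -> //.
Qed.

Lemma minp_algroot b : root (minp K a) b -> b \in algclosure K.
Proof. by apply: root_algebraic; rewrite ?minp_over ?minp_neq0. Qed.

Lemma adeg_le_root q : q \is a polyOver K -> q != 0 -> root q a ->
  (adeg K a < size q)%N.
Proof. by move=> qK q0 qa; rewrite -size_minp minp_size_le. Qed.

End Minp.

Lemma monic_dvdp_eq p q : p \is monic -> q \is monic -> p %| q -> q %| p -> p = q.
Proof.
by move=> pm qm pq qp; apply/eqP; rewrite -eqp_monic // /eqp pq qp.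
Qed.

Lemma minp_mem K a : a \in K -> minp K a = 'X - a%:P.
Proof.
move=> aK; have aA := mem_algclosure aK.
apply: monic_dvdp_eq; rewrite ?minp_monic ?monicXsubC //.
  by rewrite minp_dvd ?polyOverXsubC // root_XsubC.
by rewrite dvdp_XsubCl minp_root.
Qed.

Lemma adeg_mem K a : a \in K -> adeg K a = 1%N.
Proof. by move=> aK; rewrite /adeg minp_mem // size_XsubC. Qed.

Lemma adeg1 K a : a \in algclosure K -> adeg K a = 1%N -> a \in K.
Proof.
move=> aA d1; have s2 : size (minp K a) = 2%N by rewrite size_minp // d1.
have p1 : (minp K a)`_1 = 1.
  by have /monicP := minp_monic aA; rewrite lead_coefE s2.
have := minp_root aA; rewrite /root horner_coef s2 big_ord_recl big_ord1 /=.
rewrite p1 expr0 mulr1 mul1r expr1 addrC addr_eq0 => /eqP ->.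
by rewrite rpredN (polyOverP (minp_over aA)).
Qed.

Lemma adjoin_subset (K : {pred F}) (A : set F) : {subset K <= adjoin K A}.
Proof. by move=> a aK; apply/asboolP => M KM _; apply: KM. Qed.

Lemma adjoin_gen (K : {pred F}) (A : set F) a : A a -> a \in adjoin K A.
Proof. by move=> Aa; apply/asboolP => M _ AM; apply: AM. Qed.

Lemma adjoin_min (K : {pred F}) (A : set F) M : {subset K <= M} ->
  (forall b, A b -> b \in M) -> {subset adjoin K A <= M}.
Proof. by move=> KM AM a /asboolP; apply. Qed.

Lemma adjoin1_min (K : {pred F}) a M : {subset K <= M} -> a \in M ->
  {subset adjoin K [set a] <= M}.
Proof. by move=> KM aM; apply: adjoin_min => // b ->. Qed.

Lemma adjoin1_gen (K : {pred F}) a : a \in adjoin K [set a].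
Proof. exact: adjoin_gen. Qed.

(** The fractions form a subfield that contains K and x. *)
Lemma adjoin1_frac K x a : a \in adjoin K [set x] ->
  exists g h, [/\ g \is a polyOver K, h \is a polyOver K, h.[x] != 0 &
    a = g.[x] / h.[x]].
Proof.
pose P b := exists g h, [/\ g \is a polyOver K, h \is a polyOver K, h.[x] != 0 &
    b = g.[x] / h.[x]].
have [|||M MP] := @divring_of_Prop F P.
- exists 1, 1; split; rewrite ?rpred1 ?hornerC ?oner_neq0 //.
  by rewrite divff ?oner_neq0.
- move=> _ _ [g [h [gK hK h0 ->]]] [g' [h' [g'K h'K h'0 ->]]].
  exists (g * h' - g' * h), (h * h'); split; rewrite ?rpredB ?rpredM //.
    by rewrite hornerM mulf_neq0.
  by rewrite !hornerE -mulNr addf_div // mulNr.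
- move=> _ _ [g [h [gK hK h0 ->]]] [g' [h' [g'K h'K h'0 ->]]].
  have [g'0|g'0] := eqVneq g'.[x] 0.
    exists 0, 1; split; rewrite ?rpred0 ?rpred1 // ?hornerC ?oner_neq0 //.
    by rewrite g'0 mul0r invr0 mulr0 mul0r.
  exists (g * h'), (h * g'); split; rewrite ?rpredM ?hornerM ?mulf_neq0 //.
  by rewrite invf_div mulf_div.
move=> /asboolP/(_ M) aM; apply/MP/aM.
  move=> b bK; apply/MP; exists b%:P, 1; split; rewrite ?polyOverC ?rpred1 //.
    by rewrite hornerC oner_neq0.
  by rewrite !hornerC divr1.
move=> _ ->; apply/MP; exists 'X, 1; split; rewrite ?polyOverX ?rpred1 //.
  by rewrite hornerC oner_neq0.
by rewrite hornerX hornerC divr1.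
Qed.

(** The denominator is coprime to the minimal polynomial, so a Bezout relation
    turns its inverse into a polynomial; reduction modulo the minimal
    polynomial bounds the degree. *)
Lemma adjoin1_poly K x a : x \in algclosure K -> a \in adjoin K [set x] ->
  exists2 q, q \is a polyOver K & (size q <= adeg K x)%N /\ a = q.[x].
Proof.
move=> xK /adjoin1_frac[g [h [gK hK h0 ->]]].
have [h' [h'K hh']] : exists h', h' \is a polyOver K /\ h'.[x] = h.[x]^-1.
  have /polyOver_subf[h1 h1E] := hK.
  have /polyOver_subf[p pE] := minp_over xK.
  have cop : coprimep p h1.
    rewrite coprimep_sym coprimep_def; apply: contraT => sg.
    have gp : gcdp h1 p %| p by rewrite dvdp_gcdr.
    have : map_poly (subf_incl K) (gcdp h1 p) %| minp K x by rewrite pE dvdp_map.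
    move=> /dvdpP[q qE].
    have [_ _ irr] := minp_irr xK.
    have qK : q \is a polyOver K.
      have g0 : map_poly (subf_incl K) (gcdp h1 p) != 0.
        by apply/eqP => g0; have := minp_neq0 xK; rewrite qE g0 mulr0 eqxx.
      have -> : q = minp K x %/ map_poly (subf_incl K) (gcdp h1 p) by rewrite qE mulpK.
      by rewrite divp_over ?minp_over ?subf_polyOver.
    have [|q1|g1] := irr _ _ qK _ qE; first by rewrite subf_polyOver.
      have : minp K x %| h.
        move/eqP/size_poly1P: q1 => [c c0 qc].
        by rewrite qE qc mul_polyC dvdpZl // h1E dvdp_map dvdp_gcdl.
      move=> /dvdpP[r rE]; move: h0; rewrite rE hornerM.
      by rewrite (eqP (minp_root xK)) mulr0 eqxx.
    by move: sg; rewrite size_map_poly in g1; rewrite g1.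
  have [[u w] /= uw] := Bezout_eq1_coprimepP _ _ cop.
  exists (map_poly (subf_incl K) w); split; first exact: subf_polyOver.
  have : (map_poly (subf_incl K) (u * p + w * h1)).[x] = 1 by rewrite uw rmorph1 hornerC.
  rewrite rmorphD !rmorphM /= -pE -h1E !hornerE (eqP (minp_root xK)) mulr0 add0r.
  by move=> wh; rewrite -[LHS](mulfK h0) wh mul1r.
exists ((g * h') %% minp K x).
  by rewrite modp_over ?rpredM ?minp_over.
split.
  by rewrite -ltnS -size_minp // ltn_modp minp_neq0.
have := congr1 (fun p => p.[x]) (divp_eq (g * h') (minp K x)).
by rewrite !hornerE (eqP (minp_root xK)) mulr0 add0r hh'.
Qed.

End Subfields.

(** * Degrees of extensions *)

Section Degrees.
Variable F : fieldType.
Implicit Types (K L M : divringClosed F).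

(** The index type is an arbitrary finite type, because products of such types
    give the tower law without a numbering of pairs. *)
Definition is_basis L K (T : finType) (b : T -> F) :=
  [/\ forall i, b i \in L,
      forall a, a \in L -> exists c : T -> F,
        (forall i, c i \in K) /\ a = \sum_i c i * b i &
      forall c : T -> F, (forall i, c i \in K) ->
        \sum_i c i * b i = 0 -> forall i, c i = 0].

Lemma has_degree_basis L K n : has_degree L K n ->
  exists b : 'I_n -> F, is_basis L K b.
Proof.
move=> [b [bL H]]; exists b; split => // [a /H[c [[cK ac] _]]|c cK c0 i].
  by exists c.
have [d [_ dU]] := H 0 (rpred0 L).
have -> : c i = [ffun j => c j] i by rewrite ffunE.
rewrite -(dU [ffun j => c j]).
  rewrite (dU [ffun => 0]) ?ffunE //; split=> [j|]; first by rewrite ffunE rpred0.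
  by rewrite big1 // => j _; rewrite ffunE mul0r.
split=> [j|]; first by rewrite ffunE.
by rewrite -[LHS]c0; apply: eq_bigr => j _; rewrite ffunE.
Qed.

Lemma basis_has_degree L K (T : finType) (b : T -> F) : is_basis L K b ->
  has_degree L K #|T|.
Proof.
move=> [bL bS bI]; exists (fun i => b (enum_val i)); split=> // a aL.
have [c [cK ac]] := bS a aL.
exists [ffun i => c (enum_val i)]; split.
  split=> [i|]; first by rewrite ffunE.
  rewrite ac (reindex _ (onW_bij _ (@enum_val_bij T))) /=.
  by apply: eq_bigr => i _; rewrite ffunE.
move=> d [dK ad]; apply/ffunP => i; rewrite ffunE; apply/eqP; rewrite -subr_eq0.
have := bI (fun t => c t - d (enum_rank t)).
rewrite -{2}(enum_valK i) => -> //; first by move=> t; rewrite rpredB.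
rewrite (reindex _ (onW_bij _ (@enum_val_bij T))) /=.
under eq_bigr => j _ do rewrite enum_valK mulrBl.
rewrite sumrB -[X in _ - X]ad ac (reindex _ (onW_bij _ (@enum_val_bij T))) /=.
by rewrite subrr.
Qed.

(** The two matrices of base change have a product equal to the identity,
    which bounds the size of one by the size of the other. *)
Lemma has_degree_le L K n m : has_degree L K n -> has_degree L K m -> (n <= m)%N.
Proof.
move=> /has_degree_basis[b [bL bS bI]] /has_degree_basis[d [dL dS dI]].
have /choice[A AP] i := bS _ (dL i).
have /choice[B BP] i := dS _ (bL i).
pose MA := \matrix_(i < m, j < n) A i j; pose MB := \matrix_(i < n, j < m) B i j.
apply: (@mulmx1_min _ _ _ MB MA); apply/matrixP => i k.
apply/eqP; rewrite -subr_eq0; apply/eqP.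
apply: (bI (fun k => (MB *m MA) i k - 1%:M i k)) => {k}.
  move=> j; rewrite rpredB //; last by rewrite mxE; case: eqP => _; rewrite ?rpred1 ?rpred0.
  rewrite mxE rpred_sum // => l _; rewrite !mxE rpredM //.
    by have [] := BP i.
  by have [] := AP l.
under eq_bigr => j _ do rewrite mulrBl.
rewrite sumrB; have -> : \sum_j 1%:M i j * b j = b i.
  rewrite (bigD1 i) //= mxE eqxx mul1r big1 ?addr0 // => j ji.
  by rewrite mxE eq_sym (negPf ji) mul0r.
have [_ bi] := BP i; rewrite [X in _ - X]bi.
apply/eqP; rewrite subr_eq0; apply/eqP.
under eq_bigr => j _ do rewrite mxE mulr_suml.
rewrite exchange_big; apply: eq_bigr => l _ /=.
have [_ ->] := AP l; rewrite mulr_sumr; apply: eq_bigr => j _.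
by rewrite !mxE mulrA.
Qed.

Lemma has_degree_inj L K n m : has_degree L K n -> has_degree L K m -> n = m.
Proof. by move=> Ln Lm; apply/eqP; rewrite eqn_leq !(@has_degree_le L K). Qed.

Lemma has_degree_tower M L K n m : {subset K <= L} -> {subset L <= M} ->
  has_degree L K n -> has_degree M L m -> has_degree M K (n * m).
Proof.
move=> KL LM /has_degree_basis[b [bL bS bI]] /has_degree_basis[d [dM dS dI]].
have -> : (n * m = #|{: 'I_n * 'I_m}|)%N by rewrite card_prod !card_ord.
apply: (@basis_has_degree M K _ (fun ij => b ij.1 * d ij.2)); split.
- by move=> [i j] /=; apply: rpredM; [apply: LM | ].
- move=> a /dS[c [cL ->]]; have /choice[e eP] j := bS _ (cL j).
  exists (fun ij => e ij.2 ij.1); split=> [[i j]|]; first by case: (eP j).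
  rewrite -(pair_big xpredT xpredT (fun i j => e j i * (b i * d j))) /=.
  rewrite exchange_big /=; apply: eq_bigr => j _.
  have [_ ->] := eP j; rewrite mulr_suml; apply: eq_bigr => i _.
  by rewrite mulrA.
move=> c cK c0 [i j]; apply: (bI (fun i => c (i, j))) => // {i}.
apply: (dI (fun j => \sum_i c (i, j) * b i)).
  by move=> {}j; apply: rpred_sum => i _; apply: rpredM => //; apply: KL.
rewrite -[RHS]c0.
transitivity (\sum_i \sum_j c (i, j) * (b i * d j)); last first.
  by rewrite pair_big /=; apply: eq_bigr => -[].
rewrite exchange_big /=; apply: eq_bigr => {}j _.
by rewrite mulr_suml; apply: eq_bigr => i _; rewrite mulrA.
Qed.

Lemma has_degree_adjoin K x : x \in algclosure K ->
  has_degree (adjoin K [set x]) K (adeg K x).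
Proof.
move=> xK; rewrite -[adeg K x]card_ord.
apply: (@basis_has_degree _ _ _ (fun i : 'I__ => x ^+ i)); split.
- by move=> i; rewrite rpredX // adjoin1_gen.
- move=> a /(adjoin1_poly xK)[q qK [sq ->]]; exists (fun i : 'I__ => q`_i); split.
    by move=> i; apply: (polyOverP qK).
  rewrite (horner_coef_wide _ sq); apply: eq_bigr => i _; by [].
move=> c cK c0 i.
pose q := \poly_(i < adeg K x) (if insub i is Some j then c j else 0).
have qE (j : 'I_(adeg K x)) : q`_j = c j by rewrite coef_poly ltn_ord valK.
have qK : q \is a polyOver K.
  apply/polyOverP => j; rewrite coef_poly; case: ifP => _; last exact: rpred0.
  by case: insubP => [u _ _|_]; [apply: cK | apply: rpred0].
have [q0|q0] := eqVneq q 0; first by rewrite -[LHS]qE q0 coef0.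
have sq : (size q <= adeg K x)%N by apply: size_poly.
have : root q x.
  apply/eqP; rewrite (horner_coef_wide _ sq) -[RHS]c0.
  by apply: eq_bigr => j _; congr (_ * _); apply: qE.
by move/(minp_size_le xK qK q0); rewrite size_minp // ltnNge sq.
Qed.

Lemma has_degree_self K : has_degree K K 1.
Proof.
rewrite -[1%N](card_ord 1); apply: (@basis_has_degree _ _ _ (fun=> 1)); split.
- by move=> _; rewrite rpred1.
- by move=> a aK; exists (fun=> a); rewrite big_ord1 mulr1.
by move=> c cK; rewrite big_ord1 mulr1 => c0 i; rewrite ord1.
Qed.

Lemma eq_has_degree (L L' K K' : {pred F}) n : L =i L' -> K =i K' ->
  has_degree L K n -> has_degree L' K' n.
Proof.
move=> LL KK [b [bL H]]; exists b; split=> [i|a]; first by rewrite -LL.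
rewrite -LL => /H[c [[cK ac] cU]]; exists c; split.
  by split => // i; rewrite -KK.
by move=> d [dK ad]; apply: cU; split => // i; rewrite KK.
Qed.

(** K(c) is also K(a)(c), so this is the tower law for K, K(a), K(c). *)
Lemma adeg_tower K a c : c \in algclosure K -> a \in adjoin K [set c] ->
  exists2 m, adeg K c = (adeg K a * m)%N & m = adeg (adjoin K [set a]) c.
Proof.
move=> cK ac.
have sub : {subset adjoin K [set c] <= algclosure K}.
  by apply: adjoin1_min => // b; apply: mem_algclosure.
have aK : a \in algclosure K by exact: sub.
have cKa : c \in algclosure (adjoin K [set a]).
  exact: algclosure_sub (@adjoin_subset _ _ _) _ cK.
exists (adeg (adjoin K [set a]) c) => //.
apply: (@has_degree_inj (adjoin K [set c]) K); first exact: has_degree_adjoin.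
apply: (@has_degree_tower _ (adjoin K [set a])).
- exact: adjoin_subset.
- by apply: adjoin1_min => //; apply: adjoin_subset.
- exact: has_degree_adjoin.
apply: eq_has_degree (has_degree_adjoin cKa) => // z.
apply/idP/idP; move: z.
  apply: adjoin1_min; last exact: adjoin1_gen.
  by apply: adjoin1_min => //; apply: adjoin_subset.
apply: adjoin1_min; last exact: adjoin1_gen.
by move=> b bK; do 2 apply: adjoin_subset.
Qed.

Lemma adeg_le K a c : c \in algclosure K -> a \in adjoin K [set c] ->
  (adeg K a <= adeg K c)%N.
Proof.
move=> cK ac; have [m cm mE] := adeg_tower cK ac.
rewrite cm leq_pmulr // mE adeg_gt0 //.
exact: algclosure_sub (@adjoin_subset _ _ _) _ cK.
Qed.

(** By the tower law c has degree 1 over K(a). *)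
Lemma adeg_eq K a c : c \in algclosure K -> a \in adjoin K [set c] ->
  (adeg K c <= adeg K a)%N -> c \in adjoin K [set a].
Proof.
move=> cK ac; have [m cm mE] := adeg_tower cK ac.
have cKa : c \in algclosure (adjoin K [set a]).
  exact: algclosure_sub (@adjoin_subset _ _ _) _ cK.
have aK : a \in algclosure K.
  by move: a ac {cm mE cKa}; apply: adjoin1_min => // b; apply: mem_algclosure.
have da := adeg_gt0 aK; have dc := adeg_gt0 cKa.
rewrite cm -{2}[adeg K a]muln1 leq_pmul2l // => m1.
by apply: adeg1 => //; apply/eqP; rewrite -mE eqn_leq m1 mE.
Qed.

(** Adjoining the elements one by one gives a field of finite degree; it is
    the least one, so it can be compared with other fields that contain the
    given elements. *)
Lemma finite_adjoin_seq K (s : seq F) : all [in algclosure K] s ->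
  exists E : divringClosed F, [/\ {subset K <= E}, {in s, forall a, a \in E},
    (exists n, has_degree E K n) &
    forall M, {subset K <= M} -> {in s, forall a, a \in M} -> {subset E <= M}].
Proof.
elim: s => [|a s IH] /=.
  by exists K; split => //; exists 1%N; apply: has_degree_self.
move=> /andP[aK /IH[E [KE sE [n En] Emin]]].
have aE : a \in algclosure E by exact: algclosure_sub aK.
pose E' : divringClosed F := adjoin E [set a].
exists E'; split.
- by move=> b /KE; apply: adjoin_subset.
- move=> b; rewrite in_cons => /predU1P[->|/sE bE]; first exact: adjoin1_gen.
  exact: adjoin_subset.
- exists (n * adeg E a)%N; apply: has_degree_tower En (has_degree_adjoin aE) => //.
  exact: adjoin_subset.
move=> M KM asM; apply: adjoin1_min; last by rewrite asM ?mem_head.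
by apply: Emin => // b bs; rewrite asM // in_cons bs orbT.
Qed.

End Degrees.

(** * Extending field homomorphisms *)

(** The property is only required to hold for unions of nonempty chains.
    Taking the union with X0 turns this into Zorn's lemma for all chains. *)
Lemma Zorn_above (T : Type) (P : set (set T)) (X0 : set T) : P X0 ->
  (forall C : set (set T), C !=set0 -> C `<=` P -> total_on C subset ->
     P (\bigcup_(X in C) X)) ->
  exists A, [/\ P A, X0 `<=` A & forall B, A `<=` B -> P B -> B `<=` A].
Proof.
move=> P0 Pch; pose Q A := P (A `|` X0).
have [C CQ Ctot|A [QA Amax]] := @Zorn_bigcup T Q.
  have [[X CX]|C0] := pselect (C !=set0); last first.
    rewrite /Q; suff -> : \bigcup_(X in C) X = set0 by rewrite set0U.
    by rewrite -subset0 => t [X CX _]; apply: C0; exists X.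
  pose C' := [set X `|` X0 | X in C].
  have : P (\bigcup_(X in C') X).
    apply: Pch; first by exists (X `|` X0), X.
      by move=> _ [Y CY <-]; apply: CQ.
    move=> _ _ [Y CY <-] [Z CZ <-].
    by have [YZ|ZY] := Ctot _ _ CY CZ; [left|right]; apply: setSU.
  congr (P _); apply/seteqP; split=> t.
    by move=> [_ [Y CY <-] [Yt|X0t]]; [left; exists Y | right].
  move=> [[Y CY Yt]|X0t]; first by exists (Y `|` X0); [exists Y | left].
  by exists (X `|` X0); [exists X | right].
exists (A `|` X0); split => // B AB PB t Bt.
have BX : B `|` X0 = B by apply/setUidPl => s Xs; apply: AB; right.
apply: contrapT => nAt; apply: (Amax B); last by rewrite /Q BX.
split; first by move=> s As; apply: AB; left.
by move=> BA; apply: nAt; left; apply: BA.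
Qed.

Section Homs.
Variable F : closedFieldType.
Implicit Types (M A : divringClosed F).

(** Partial homomorphisms are handled as their graphs, subfields of F x F,
    since the union of a chain of graphs is again a graph. Division is
    componentwise with 0 / 0 = 0. *)
Definition hom_graph (X : set (F * F)) :=
  [/\ X (1, 1),
      forall p q, X p -> X q -> X (p.1 - q.1, p.2 - q.2),
      forall p q, X p -> X q -> X (p.1 / q.1, p.2 / q.2) &
      forall y, X (0, y) -> y = 0].

Lemma hom_graph_fun X : hom_graph X ->
  exists M (phi : {rmorphism subf M -> F}),
    forall a b, X (a, b) <-> exists2 m : subf M, a = val m & b = phi m.
Proof.
move=> [X1 XB XV X0].
have Xfun a b c : X (a, b) -> X (a, c) -> b = c.
  move=> Xab Xac; apply/eqP; rewrite -subr_eq0; apply/eqP; apply: X0.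
  by have := XB _ _ Xab Xac; rewrite /= subrr.
have [|||M MP] := @divring_of_Prop F (fun a => exists b, X (a, b)).
- by exists 1.
- by move=> a b [a' Xa] [b' Xb]; exists (a' - b'); apply: (XB _ _ Xa Xb).
- by move=> a b [a' Xa] [b' Xb]; exists (a' / b'); apply: (XV _ _ Xa Xb).
have /choice[f fX] (m : subf M) : exists b, X (val m, b).
  by apply/MP; apply: subfP.
have fB : zmod_morphism f.
  move=> a b; apply: (Xfun (val (a - b))); first exact: fX.
  exact: (XB _ _ (fX a) (fX b)).
have f1 : f 1 = 1 by apply: (Xfun 1) => //; have := fX 1; rewrite [val _](rmorph1 (subf_incl M)).
have f0 : f 0 = 0 by apply: X0; have := fX 0; rewrite [val _](rmorph0 (subf_incl M)).
have fM : monoid_morphism f.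
  split=> // a b; have [->|b0] := eqVneq b 0; first by rewrite mulr0 f0 mulr0.
  apply: (Xfun (val (a * b))); first exact: fX.
  have := XV _ _ (fX a) (XV _ _ X1 (fX b)); rewrite /= !div1r !invrK.
  by [].
pose phi : {rmorphism subf M -> F} := HB.pack f
  (GRing.isZmodMorphism.Build _ _ f fB) (GRing.isMonoidMorphism.Build _ _ f fM).
exists M, phi => a b; split=> [Xab|[m -> ->]]; last exact: fX.
have aM : a \in M by apply/MP; exists b.
by exists (Subf aM) => //; apply: (Xfun a) => //; apply: (fX (Subf aM)).
Qed.

(** The values (q(y), q^phi(y')) form the graph of the extension of phi which
    sends y to y'; the hypothesis on roots says that it is well defined. *)
Lemma hom_step M (phi : {rmorphism subf M -> F}) y y' :
  y \in algclosure M ->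
  (forall q, root (map_poly (subf_incl M) q) y -> root (map_poly phi q) y') ->
  exists X, [/\ hom_graph X, X (y, y') & forall m : subf M, X (val m, phi m)].
Proof.
move=> yM yy.
pose X (ab : F * F) := exists q : {poly subf M},
  ab = ((map_poly (subf_incl M) q).[y], (map_poly phi q).[y']).
exists X; split; first split.
- by exists 1; rewrite !rmorph1 !hornerC.
- by move=> _ _ [p ->] [q ->] /=; exists (p - q); rewrite !rmorphB !hornerE.
- move=> _ _ [p ->] [q ->] /=.
  have [q0|q0] := eqVneq (map_poly (subf_incl M) q).[y] 0.
    have /eqP q'0 : root (map_poly phi q) y' by apply: yy; apply/eqP.
    by exists 0; rewrite !rmorph0 q0 q'0 !invr0 !mulr0 !horner0.
  have : (map_poly (subf_incl M) q).[y]^-1 \in adjoin M [set y].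
    rewrite rpredV; apply: rpred_horner; last exact: adjoin1_gen.
    apply: polyOver_sub (subf_polyOver q); exact: adjoin_subset.
  move=> /(adjoin1_poly yM)[r rM [_ rE]].
  have [r' r'E] := polyOver_subf rM.
  have qr : (map_poly (subf_incl M) q).[y] * (map_poly (subf_incl M) r').[y] = 1.
    by rewrite -r'E -rE divff.
  have qr' : (map_poly phi q).[y'] * (map_poly phi r').[y'] = 1.
    have : root (map_poly phi (q * r' - 1)) y'.
      by apply: yy; rewrite rmorphB rmorphM rmorph1 /root !hornerE qr subrr.
    rewrite rmorphB rmorphM rmorph1 /root !hornerE subr_eq0 => /eqP //.
  exists (p * r'); rewrite !rmorphM !hornerM /=; congr (_ * _, _ * _).
    by rewrite rE r'E.
  have q'0 : (map_poly phi q).[y'] != 0.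
    by apply: contra_eq_neq qr' => ->; rewrite mul0r eq_sym oner_neq0.
  by apply: (mulfI q'0); rewrite qr' divff.
- move=> z [q [/esym/eqP q0 ->]].
  by apply/eqP; apply: yy.
- by exists 'X; rewrite !map_polyX !hornerX.
by move=> m; exists m%:P; rewrite !map_polyC !hornerC.
Qed.

(** A maximal partial homomorphism that sends a to a' is defined everywhere:
    the image under it of a minimal polynomial has a root in F, which allows
    for one more extension step. *)
Lemma extend_conj A a a' : (forall y, y \in algclosure A) ->
  root (minp A a) a' ->
  exists s : {rmorphism F -> F}, {in A, forall b, s b = b} /\ s a = a'.
Proof.
move=> Aalg aa'; have aA := Aalg a.
have [|X0 [X0g X0a X0A]] := @hom_step A (subf_incl A) a a' aA.
  move=> q qa; have /dvdpP[r ->] := minp_dvd aA (subf_polyOver q) qa.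
  by rewrite rootM aa' orbT.
have [//||X [Xg XX0 Xmax]] := @Zorn_above _ hom_graph X0.
  move=> C [X1 CX1] Cg Ctot.
  have C2 p q : (\bigcup_(X in C) X) p -> (\bigcup_(X in C) X) q ->
      exists X, [/\ C X, X p & X q].
    move=> [X CX Xp] [Y CY Yq]; have [XY|YX] := Ctot _ _ CX CY.
      by exists Y; split => //; apply: XY.
    by exists X; split => //; apply: YX.
  split.
  - by exists X1 => //; have [] := Cg _ CX1.
  - move=> p q Cp Cq; have [X [CX Xp Xq]] := C2 p q Cp Cq.
    by exists X => //; have [_ H _ _] := Cg _ CX; apply: H.
  - move=> p q Cp Cq; have [X [CX Xp Xq]] := C2 p q Cp Cq.
    by exists X => //; have [_ _ H _] := Cg _ CX; apply: H.
  - by move=> y [X CX Xy]; have [_ _ _] := Cg _ CX; apply.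
have [M [phi MP]] := hom_graph_fun Xg.
have AM : {subset A <= M}.
  move=> b bA; have /MP[m] := XX0 _ (X0A (Subf bA)).
  by move=> /= -> _; apply: subfP.
have totM y : y \in M.
  have yM : y \in algclosure M by apply: algclosure_sub (Aalg y).
  have [p pE] := polyOver_subf (minp_over yM).
  have [y' py'] : exists y', root (map_poly phi p) y'.
    apply/closed_rootP; rewrite size_map_poly.
    have := minp_size_gt1 yM; rewrite pE size_map_poly.
    by case: (size p) => [|[|n]].
  have [|Y [Yg Yy YM]] := @hom_step M phi y y' yM.
    move=> q qy; have := minp_dvd yM (subf_polyOver q) qy.
    rewrite pE dvdp_map => /dvdpP[r ->].
    by rewrite rmorphM rootM py' orbT.
  have YX : Y `<=` X.
    by apply: Xmax => // -[u w] /MP[m -> ->].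
  by have /MP[m -> _] := YX _ Yy; apply: subfP.
pose f y := phi (Subf (totM y)).
have fB : zmod_morphism f.
  move=> u w; rewrite /f -rmorphB; congr (phi _); exact: val_inj.
have fM : monoid_morphism f.
  split=> [|u w]; rewrite /f; last by rewrite -rmorphM; congr (phi _); exact: val_inj.
  by rewrite -[RHS](rmorph1 phi); congr (phi _); exact: val_inj.
pose s : {rmorphism F -> F} := HB.pack f
  (GRing.isZmodMorphism.Build _ _ f fB) (GRing.isMonoidMorphism.Build _ _ f fM).
have sE y z : X (y, z) -> s y = z.
  move=> /MP[m -> ->]; rewrite /s /= /f; congr (phi _); exact: val_inj.
exists s; split=> [b bA|]; apply: sE; apply: XX0 => //.
exact: (X0A (Subf bA)).
Qed.

End Homs.

(** * Conjugation over a field with a transcendental element adjoined *)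

Section Transcendental.
Variables (F : closedFieldType) (K : divringClosed F) (x : F).
Hypothesis x_trans : ~ algebraic_over K x.
Implicit Types (E : divringClosed F).

(** Otherwise x would be algebraic over the algebraic closure of K, hence over
    K itself. *)
Lemma trans_poly0 (p : {poly F}) : p \is a polyOver (algclosure K) ->
  root p x -> p = 0.
Proof.
move=> pK px; apply/eqP; apply: contraT => p0; exfalso; apply: x_trans.
by apply/asboolP; apply: (algclosure_trans pK p0 px).
Qed.

(** E is algebraically closed in E(x): if h = g(x) / k(x) is algebraic, then g
    - h k vanishes at x and therefore identically, so h is a quotient of
    coefficients. *)
Lemma algebraic_adjoin_trans E h : {subset E <= algclosure K} ->
  h \in algclosure K -> h \in adjoin E [set x] -> h \in E.
Proof.
move=> EK hK /adjoin1_frac[g [k [gE kE k0 hgk]]].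
have : g - h *: k = 0.
  apply: trans_poly0; last by rewrite /root !hornerE hgk divfK // subrr.
  rewrite rpredB ?polyOverZ //; apply: polyOver_sub EK _ => //.
move=> /eqP; rewrite subr_eq0 => /eqP gk.
have lk : lead_coef k != 0.
  by rewrite lead_coef_eq0; apply: contraNneq k0 => ->; rewrite horner0.
have -> : h = g`_(size k).-1 / lead_coef k.
  by rewrite gk coefZ -lead_coefE mulfK.
by rewrite rpred_div ?(polyOverP gE) // lead_coefE (polyOverP kE).
Qed.

Lemma monic_algebraic_coefs E (p q : {poly F}) : q \is a polyOver (algclosure K) ->
  q != 0 -> p \is monic -> p %| q -> p \is a polyOver (algclosure K).
Proof.
move=> qK q0 pm pq; have [r pr] := poly_splits p.
have p0 := monic_neq0 pm.
rewrite pr (monicP pm) scale1r big_seq rpred_prod // => z zr.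
rewrite polyOverXsubC; apply: (algclosure_trans qK q0).
have pz : root p z by rewrite -[root _ _]/(z \in root p) (root_split p0 pr).
by case/dvdpP: pq => t ->; rewrite rootM pz orbT.
Qed.

(** The coefficients of the minimal polynomial over E(x) are polynomials in
    conjugates of a, hence algebraic, hence in E. *)
Lemma minp_adjoin_trans E a : {subset K <= E} -> {subset E <= algclosure K} ->
  a \in algclosure K -> minp (adjoin E [set x]) a = minp E a.
Proof.
move=> KE EK aK.
have aE : a \in algclosure E by apply: algclosure_sub aK.
have aEx : a \in algclosure (adjoin E [set x]).
  by apply: algclosure_sub aE; apply: adjoin_subset.
have dv : minp (adjoin E [set x]) a %| minp E a.
  rewrite minp_dvd ?minp_root //; apply: polyOver_sub (minp_over aE).
  exact: adjoin_subset.
apply: monic_dvdp_eq; rewrite ?minp_monic //.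
apply: minp_dvd; rewrite ?minp_root //.
have mK : minp (adjoin E [set x]) a \is a polyOver (algclosure K).
  apply: (monic_algebraic_coefs E _ _ _ dv); rewrite ?minp_monic ?minp_neq0 //.
  exact: polyOver_sub (minp_over aE).
apply/polyOverP => i; apply: algebraic_adjoin_trans => //.
  exact: (polyOverP mK).
exact: (polyOverP (minp_over aEx)).
Qed.

Hypothesis F_alg : forall y : F, algebraic_over (adjoin K [set x]) y.

(** Conjugation over E is realised by endomorphisms of F that fix x as well,
    so that they act on values of polynomials at x. *)
Lemma conj_exists E a a' : {subset K <= E} -> {subset E <= algclosure K} ->
  a \in algclosure K -> root (minp E a) a' ->
  exists s : {rmorphism F -> F}, [/\ {in E, forall b, s b = b}, s x = x & s a = a'].
Proof.
move=> KE EK aK aa'.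
have [y||s [sf sa]] := @extend_conj F (adjoin E [set x]) a a'.
- apply: (@algclosure_sub _ (adjoin K [set x])); last exact/asboolP.
  apply: adjoin1_min; last exact: adjoin1_gen.
  by move=> b /KE; apply: adjoin_subset.
- by rewrite minp_adjoin_trans.
exists s; split => //; last by rewrite sf ?adjoin1_gen.
by move=> b bE; rewrite sf ?adjoin_subset.
Qed.

End Transcendental.

Section ConjValues.
Variables (F : closedFieldType) (G : orderedGroupType) (v : valuation F G).
Variable (K : divringClosed F).

Lemma conj_root (E : divringClosed F) (s : {rmorphism F -> F}) (p : {poly F}) a :
  {in E, forall b, s b = b} -> p \is a polyOver E -> root p a -> root p (s a).
Proof.
move=> sE pE pa; have -> : p = map_poly s p.
  by apply/polyP => i; rewrite coef_map /= sE ?(polyOverP pE).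
by rewrite rmorph_root.
Qed.

Lemma iter_inj_periodic (s : F -> F) (r : seq F) a : injective s ->
  (forall i, iter i s a \in r) -> exists2 n, (0 < n)%N & iter n s a = a.
Proof.
move=> sI ar; pose t := mkseq (fun i => iter i s a) (size r).+1.
have : ~~ uniq t.
  apply/negP => ut; have := @uniq_leq_size _ t r ut.
  rewrite size_mkseq ltnn => H; suff : false by []; apply: H.
  by move=> b /mapP[i _ ->].
move=> /(uniqPn 0)[i [j [ij]]]; rewrite size_mkseq => jr.
rewrite !nth_mkseq //; last exact: ltn_trans ij jr.
rewrite -{1}(subnK (ltnW ij)) iterD => ii; exists (j - i)%N; rewrite ?subn_gt0 //.
have iI k : injective (iter k s) by elim: k => [|k IH] //= u w /sI/IH.
by apply: (iI i); rewrite -iterD addnC iterD.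
Qed.

Hypothesis K_unib : unibranched v (algclosure K) K.

(** By uniqueness of the extension of v, the map s preserves the order between
    values of algebraic elements. An element whose value is changed would have
    an orbit with strictly monotone values, but its orbit is finite. *)
Lemma conj_val (s : {rmorphism F -> F}) a : {in K, forall b, s b = b} ->
  a \in algclosure K -> v (s a) = v a.
Proof.
move=> sK aK.
have sA b : b \in algclosure K -> s b \in algclosure K.
  move=> /asboolP[p [pK p0 pb]]; apply: (root_algebraic pK p0).
  exact: (conj_root sK pK).
pose w := v \o s.
have wv : valuation_on (algclosure K) w.
  split; first by rewrite /w /= rmorph0 val0.
  - by move=> b _ b0; apply: val_fin; rewrite fmorph_eq0.
  - by move=> b c g h _ _ wb wc; rewrite /w /= rmorphM (Defs.valM wb wc).
  - by move=> b c _ _; rewrite /w /= rmorphD Defs.valD.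

have mono : {in algclosure K &, forall b c, (v (s b) <= v (s c)) = (v b <= v c)}.
  by apply: (K_unib wv) => b c bK cK; rewrite /w /= !sK.
have monolt : {in algclosure K &, forall b c, (v (s b) < v (s c)) = (v b < v c)}.
  by move=> b c bK cK; rewrite !ltNge mono.
have itA i : iter i s a \in algclosure K by elim: i => //= i IH; apply: sA.
have [r mr] := poly_splits (minp K a).
have [||[|n] // _ nE] := @iter_inj_periodic s r a; first exact: fmorph_inj.
  move=> i; rewrite -(root_split (minp_neq0 aK) mr).
  elim: i => [|i IH]; first exact: minp_root.
  by rewrite /=; apply: (conj_root sK) IH; apply: minp_over.
have [lt|gt|//] := ltgtP (v (s a)) (v a).
  suff : v (iter n.+1 s a) < v a by rewrite nE ltxx.
  elim: n {nE} => //= n IH; apply: lt_trans lt.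
  by rewrite monolt //=; apply: itA n.+1.
suff : v a < v (iter n.+1 s a) by rewrite nE ltxx.
elim: n {nE} => //= n IH; apply: (lt_trans gt).
by rewrite monolt //=; apply: itA n.+1.
Qed.

End ConjValues.

(** * Immediate extensions *)

Section Immediate.
Variables (F : closedFieldType) (G : orderedGroupType) (v : valuation F G).
Implicit Types (M E : divringClosed F).

(** Immediacy in terms of leading terms: a transitive condition, which can be
    checked on values of polynomials since leading terms are multiplicative.
    *)
Definition dense_in (M M' : {pred F}) :=
  forall h, h \in M' -> h != 0 -> exists2 m, m \in M & close v h m.

Lemma dense_in_trans (M M' M'' : {pred F}) :
  dense_in M M' -> dense_in M' M'' -> dense_in M M''.
Proof.
move=> MM' MM'' h hM h0; have [m mM' hm] := MM'' h hM h0.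
have [n nM mn] := MM' m mM' (close_neq0r hm).
by exists n => //; apply: close_trans mn.
Qed.

Lemma dense_horner M (y : F) (g : {poly F}) : g \is a polyOver M -> g != 0 ->
  (forall z, root g z -> exists2 c, c \in M & v (y - z) < v (y - c)) ->
  exists2 c, c \in M & close v g.[y] g.[c].
Proof.
move=> gM g0 H; have [r gr] := poly_splits g.
have [|z zr|c cM cr] := @common_improvement _ _ v (fun c => c \in M) y 0 r.
- exact: rpred0.
- by apply: H; rewrite -[root _ _]/(z \in root g) (root_split g0 gr).
exists c => //; apply: close_horner => // z gz; apply: cr.
by rewrite -[z \in r](root_split g0 gr).
Qed.

(** If elements of M approximate y better than every algebraic element does,
    then they compute the leading term of each value of a rational function at
    y. *)
Lemma dense_trans M y :
  (forall z, z \in algclosure M -> exists2 c, c \in M & v (y - z) < v (y - c)) ->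
  dense_in M (adjoin M [set y]).
Proof.
move=> H h /adjoin1_frac[g [k [gM kM k0 ->]]] h0.
have g0 : g != 0 by apply: contraNneq h0 => ->; rewrite horner0 mul0r.
have {}k0 : k != 0 by apply: contraNneq k0 => ->; rewrite horner0.
have algr p z : p \is a polyOver M -> p != 0 -> root p z -> z \in algclosure M.
  by move=> pM p0 pz; apply: (root_algebraic pM p0 pz).
have [r gr] := poly_splits g; have [t kt] := poly_splits k.
have [|z|c cM cr] := @common_improvement _ _ v (fun c => c \in M) y 0 (r ++ t).
- exact: rpred0.
- rewrite mem_cat -[z \in r](root_split g0 gr) -[z \in t](root_split k0 kt).
  by move=> /orP[gz|kz]; apply: H; [apply: algr gz | apply: algr kz].
exists (g.[c] / k.[c]); first by rewrite rpred_div ?rpred_horner.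
apply: close_div; apply: close_horner => // z rz; apply: cr; rewrite mem_cat.
  by rewrite -[z \in r](root_split g0 gr) [z \in _]rz.
by rewrite -[z \in t](root_split k0 kt) [X in _ || X]rz orbT.
Qed.

(** Kaplansky's construction. Elements y that are at least as close as b to
    all elements of M are limits of the approximation of b from M. For such a
    y of minimal degree, the roots of polynomials of smaller degree are not
    limits, so elements of M close to y give the leading terms of all elements
    of M(y). *)
Lemma immediate_adjoin M b : b \in algclosure M ->
  (forall c, c \in M -> exists2 c', c' \in M & v (b - c) < v (b - c')) ->
  exists y, [/\ y \in algclosure M, y \notin M & dense_in M (adjoin M [set y])].
Proof.
move=> bM nomax.
pose lim y := forall c, c \in M -> v (b - c) <= v (y - c).
pose P n := `[< exists y, [/\ y \in algclosure M, lim y & size (minp M y) = n] >].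
have exP : exists n, P n by exists (size (minp M b)); apply/asboolP; exists b; split.
case: (ex_minnP exP) => n /asboolP[y [yM ly <-]] nmin.
have ynM : y \notin M.
  apply/negP => yinM; have [c cM yc] := nomax y yinM.
  have := ly c cM; rewrite leNgt => /negP[].
  by rewrite valBC (dist_eq yc).
exists y; split => // h /(adjoin1_poly yM)[g gM [sg ->]] gy0.
have g0 : g != 0 by apply: contraNneq gy0 => ->; rewrite horner0.
have [z gz|c cM gc] := @dense_horner M y g gM g0; last first.
  by exists g.[c] => //; apply: rpred_horner.
have zM := root_algebraic gM g0 gz.
have [//|nl] := pselect (lim z).
  move=> lz; have : P (size (minp M z)) by apply/asboolP; exists z; split.
  move=> /nmin; rewrite leqNgt => /negP[].
  apply: leq_ltn_trans (minp_size_le zM gM g0 gz) _.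
  by rewrite size_minp.
have [c cM] : exists2 c, c \in M & v (z - c) < v (b - c).
  apply: contrapT => nc; apply: nl => c cM; rewrite leNgt; apply/negP => zc.
  by apply: nc; exists c.
move=> zc; exists c => //.
have zyc : v (z - c) < v (y - c) := lt_le_trans zc (ly c cM).
rewrite [ltLHS]valBC; have -> : z - y = (z - c) - (y - c) by rewrite opprB addrA subrK.
by rewrite valDl // valN.
Qed.

Lemma dense_in_value_group (M M' : {pred F}) : {subset M <= M'} ->
  dense_in M M' -> value_group v M' = value_group v M.
Proof.
move=> MM' D; apply/seteqP; split=> g [a aM ag]; last by exists a => //; apply: MM'.
have a0 : a != 0 by rewrite -(val_ltPInf v) ag.
by have [m mM am] := D a aM a0; exists m => //; rewrite -(close_val am).
Qed.

Lemma res_eq (a b : valring_type v) : Fin 0 < v (val a - val b) -> res a = res b.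
Proof.
move=> ab; apply/eqP; rewrite -subr_eq0.
have -> : res a - res b = res (a - b) by rewrite /res !piE.
by rewrite res_eq0.
Qed.

Lemma dense_in_residues M M' : {subset M <= M'} ->
  dense_in M M' -> residues v M' =i residues v M.
Proof.
move=> MM' D r; apply/asboolP/asboolP => -[a aM ->]; last first.
  by exists a => //; apply: MM'.
have [va|va] := eqVneq (v (val a)) (Fin 0).
  have a0 : val a != 0 by rewrite -(val_ltPInf v) va.
  have [m mM am] := D _ aM a0.
  have mO : m \in valring v by rewrite inE -(close_val am) va.
  exists (ValringElt mO) => //; apply: res_eq.
  by have := am; rewrite /close va.
exists 0; first exact: rpred0.
apply: res_eq; rewrite subr0 lt_neqAle eq_sym va /=.
exact: (valP a).
Qed.

Lemma dense_in_immediate M M' : {subset M <= M'} -> dense_in M M' ->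
  immediate v M' M.
Proof.
by move=> MM' D; split; [apply: dense_in_value_group | apply: dense_in_residues].
Qed.

End Immediate.

(** * Indices, residue fields and best approximations in tame fields *)

Section Index.
Variables (G : zmodType) (A B : set G).
Hypotheses (B0 : B 0) (BB : forall g h, B g -> B h -> B (g - h)).

Let BN g : B g -> B (- g). Proof. by move=> Bg; rewrite -sub0r; apply: BB. Qed.
Let BD g h : B g -> B h -> B (g + h).
Proof. by move=> Bg Bh; rewrite -[h]opprK; apply: BB => //; apply: BN. Qed.

Lemma has_index_le n m : has_index A B n -> has_index A B m -> (n <= m)%N.
Proof.
move=> [g [gA gU]] [h [hA hU]].
have /choice[f fP] i := hU _ (gA i).
have fI : injective f.
  move=> i j fij; have [k [_ kU]] := gU _ (gA i).
  rewrite -(kU i) ?subrr // -(kU j) //.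
  have [Bi _] := fP i; have [Bj _] := fP j.
  by have := BB Bi Bj; rewrite fij opprB addrA subrK.
by rewrite -[n]card_ord -[m]card_ord (leq_card _ fI).
Qed.

Lemma has_index_inj n m : has_index A B n -> has_index A B m -> n = m.
Proof. by move=> An Am; apply/eqP; rewrite eqn_leq !has_index_le. Qed.

Hypothesis AD : forall g h, A g -> A h -> A (g + h).

(** Lagrange's argument: translation by h permutes the cosets, so n h is the
    difference of two sums over all of them. *)
Lemma has_index_mul n h : has_index A B n -> A h -> B (h *+ n).
Proof.
move=> [g [gA gU]] Ah.
have /choice[f fP] i := gU _ (AD (gA i) Ah).
have fI : injective f.
  move=> i j fij; have [k [_ kU]] := gU _ (gA i).
  rewrite -(kU i) ?subrr // -(kU j) //.
  have [Bi _] := fP i; have [Bj _] := fP j.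
  have := BB Bi Bj; rewrite fij.
  by rewrite opprB addrA subrK opprD addrACA subrr addr0.
have -> : h *+ n = \sum_i (g i + h - g (f i)).
  rewrite sumrB big_split /= sumr_const card_ord.
  by rewrite [X in X + _ - _](reindex_inj fI) /= addrAC subrr add0r.
elim/big_ind: _ => [//|b c Bb Bc|i _]; last by have [] := fP i.
exact: BD.
Qed.

End Index.

Section Tame.
Variables (F : closedFieldType) (G : orderedGroupType) (v : valuation F G).
Implicit Types (E M : divringClosed F).

Lemma value_group0 E : value_group v E 0.
Proof. by exists 1; [apply: rpred1 | apply: Defs.val1]. Qed.

Lemma val_finV a g : v a = Fin g -> v a^-1 = Fin (- g).
Proof.
move=> ag; have a0 : a != 0 by rewrite -(val_ltPInf v) ag.
have aV0 : a^-1 != 0 by rewrite invr_eq0.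
have [h ah] := val_fin v aV0; have := Defs.valM ag ah.
rewrite divff // Defs.val1 ah => -[/esym/eqP]; rewrite addrC addr_eq0.
by move=> /eqP ->.
Qed.

Lemma val_finX a g n : v a = Fin g -> v (a ^+ n) = Fin (g *+ n).
Proof.
move=> ag; elim: n => [|n IH]; first by rewrite expr0 Defs.val1.
by rewrite exprS (Defs.valM ag IH) mulrS.
Qed.

Lemma value_groupD E g h : value_group v E g -> value_group v E h ->
  value_group v E (g + h).
Proof.
move=> [a aE ag] [b bE bh]; exists (a * b); first exact: rpredM.
exact: Defs.valM.
Qed.

Lemma value_groupB E g h : value_group v E g -> value_group v E h ->
  value_group v E (g - h).
Proof.
move=> [a aE ag] [b bE bh]; exists (a / b); first exact: rpred_div.
by apply: Defs.valM => //; apply: val_finV.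
Qed.

Lemma res_is_zmod_morphism : zmod_morphism (@res _ _ v).
Proof. by move=> a b; rewrite /res !piE. Qed.
Lemma res_is_monoid_morphism : monoid_morphism (@res _ _ v).
Proof. by split=> [|a b]; rewrite /res !piE. Qed.
HB.instance Definition _ := GRing.isZmodMorphism.Build _ _ (@res _ _ v) res_is_zmod_morphism.
HB.instance Definition _ := GRing.isMonoidMorphism.Build _ _ (@res _ _ v) res_is_monoid_morphism.

Lemma res_close (a b : valring_type v) : res a = res b <-> Fin 0 < v (val a - val b).
Proof.
split=> [/eqP|]; last exact: res_eq.
by rewrite -subr_eq0 -rmorphB res_eq0.
Qed.

Fact residues_divring_closed E : divring_closed (residues v E).
Proof.
split.
- by apply/asboolP; exists 1; [apply: rpred1 | rewrite rmorph1].
- move=> _ _ /asboolP[a aE ->] /asboolP[b bE ->]; apply/asboolP.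
  by exists (a - b); [apply: rpredB | rewrite rmorphB].
move=> _ _ /asboolP[a aE ->] /asboolP[b bE ->]; apply/asboolP.
have [b0|b0] := eqVneq (res b) 0.
  by exists 0; [apply: rpred0 | rewrite b0 invr0 mulr0 rmorph0].
have vb : v (val b) = Fin 0.
  apply/eqP; rewrite eq_le; move: b0; rewrite res_eq0 -leNgt => -> /=.
  exact: (valP b).
have bV : (val b)^-1 \in valring v by rewrite inE (val_finV vb) oppr0.
exists (a * ValringElt bV); first exact: rpred_div.
rewrite rmorphM; congr (_ * _).
apply: (mulfI b0); rewrite divff // -rmorphM -(rmorph1 (@res _ _ v)).
congr res; apply: val_inj => /=; rewrite divff //.
by rewrite -(val_ltPInf v) vb.
Qed.
HB.instance Definition _ E := GRing.isDivringClosed.Build (resfield v) (residues v E)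
  (residues_divring_closed E).

Lemma val_natr (n : nat) : (n%:R : resfield v) != 0 -> v n%:R = Fin 0.
Proof.
move=> n0; have nE : (n%:R : resfield v) = res (n%:R : valring_type v) by rewrite rmorph_nat.
move: n0; rewrite nE res_eq0 -leNgt => n0.
have vn : val (n%:R : valring_type v) = n%:R by rewrite (rmorph_nat val).
apply/eqP; rewrite -vn eq_le n0 /=; exact: (valP (n%:R : valring_type v)).
Qed.

Lemma natr_pchar (R : fieldType) n : (0 < n)%N ->
  (forall p, p \in [pchar R] -> ~~ (p %| n)%N) -> (n%:R : R) != 0.
Proof.
move=> n0 H; apply/negP => n0R; have [p pR] := natf0_pchar n0 n0R.
by have := H p pR; rewrite (dvdn_pcharf pR) n0R.
Qed.

Lemma prod_gt0 (I : eqType) (r : seq I) (f : I -> F) :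
  Fin 0 < v (\prod_(i <- r) f i) -> exists2 i, i \in r & Fin 0 < v (f i).
Proof.
elim: r => [|i r IH]; first by rewrite big_nil Defs.val1 ltxx.
rewrite big_cons => H; have [fi|fi] := ltP (Fin 0) (v (f i)).
  by exists i; rewrite ?mem_head.
have [|j jr fj] := IH; last by exists j; rewrite // in_cons jr orbT.
apply: lt_le_trans H _; rewrite -[X in _ <= v X]mul1r; apply: valM_le.
by rewrite Defs.val1.
Qed.

Variables (K : divringClosed F).
Hypothesis K_tame : tame_field v K.
Let K_unib : unibranched v (algclosure K) K. Proof. by case: K_tame => _ []. Qed.

Section Between.
Variable E : divringClosed F.
Hypotheses (KE : {subset K <= E}) (EK : {subset E <= algclosure K}).

Let algE a : a \in algclosure K -> a \in algclosure E.
Proof. exact: algclosure_sub. Qed.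

Let algEK a : a \in algclosure E -> a \in algclosure K.
Proof.
move=> aE; apply: (algclosure_trans _ (minp_neq0 aE) (minp_root aE)).
exact: polyOver_sub (minp_over aE).
Qed.

(** Otherwise [immediate_adjoin] gives a proper finite extension of E with the
    same value group and residue field. Its degree over K would be the same
    product of ramification index and residue degree as that of E. *)
Lemma tame_max n b : has_degree E K n -> b \in algclosure K ->
  exists2 c, c \in E & forall c', c' \in E -> v (b - c') <= v (b - c).
Proof.
move=> En bK; apply: contrapT => nomax.
have [c cE|y [yE ynE D]] := @immediate_adjoin _ _ v E b (algE bK).
  apply: contrapT => nc; apply: nomax; exists c => // c' c'E.
  by rewrite leNgt; apply/negP => lt; apply: nc; exists c'.
pose E' : divringClosed F := adjoin E [set y].
have EE' : {subset E <= E'} by apply: adjoin_subset.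
have E'n : has_degree E' K (n * adeg E y).
  exact: has_degree_tower En (has_degree_adjoin yE).
have E'K : {subset E' <= algclosure K}.
  by apply: adjoin1_min => //; apply: algEK.
have [_ [_ _ _ T]] := K_tame.
have [e [f [ie _ df _ nE]]] := T E n KE EK En.
have KE' : {subset K <= E'} by move=> a /KE/EE'.
have [e' [f' [ie' _ df' _ n'E]]] := T E' _ KE' E'K E'n.
have ee : e' = e.
  apply: has_index_inj ie; last by rewrite -(dense_in_value_group EE' D).
    exact: value_group0.
  by move=> g h; apply: value_groupB.
have ff : f' = f.
  apply: (@has_degree_inj _ (residues v E) (residues v K)) df.
  apply: eq_has_degree df' => //; exact: dense_in_residues.
have n0 : (0 < n)%N.
  rewrite nE muln_gt0; apply/andP; split.
    case: ie => g [_ /(_ 0 (value_group0 E))[i _]]; exact: leq_ltn_trans (ltn_ord i).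
  have /has_degree_basis[b' [_ S _]] := df.
  have [c' [_]] := S 1 (rpred1 _); case: {df T ff nE n'E}f b' S c' => // b' _ c'.
  by rewrite big_ord0 => /eqP; rewrite oner_eq0.
have : (n * adeg E y = n)%N by rewrite n'E ee ff nE.
rewrite -{2}[n]muln1 => /eqP; rewrite eqn_pmul2l // => /eqP/(adeg1 yE).
by move=> yinE; rewrite yinE in ynE.
Qed.

End Between.
End Tame.

(** * Reduction and roots of principal units *)

Section Residues.
Variables (F : closedFieldType) (G : orderedGroupType) (v : valuation F G).
Implicit Types (E : divringClosed F).

(** All roots have the residue of a, so the reduction is a power of a linear
    polynomial; its coefficients are residues of elements of E. *)
Lemma reduce_prod E (r : seq F) (a : valring_type v) :
  {in r, forall z, Fin 0 < v (val a - z)} ->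
  \prod_(z <- r) ('X - z%:P) \is a polyOver E ->
  ('X - (res a)%:P) ^+ size r \is a polyOver (residues v E).
Proof.
move=> rO rE.
have zO z : z \in r -> z \in valring v.
  move=> zr; rewrite inE -(subKr (val a) z) val_leB //; first exact: (valP a).
  by apply/ltW/rO.
pose W z : valring_type v := insubd 0 z.
have WE z : z \in r -> val (W z) = z by move=> zr; rewrite insubdK // zO.
pose Q := \prod_(z <- r) ('X - (W z)%:P).
pose vr : {rmorphism valring_type v -> F} := val.
have QE : map_poly vr Q = \prod_(z <- r) ('X - z%:P).
  rewrite rmorph_prod; apply: eq_big_seq => z zr.
  rewrite rmorphB [X in X - _](map_polyX vr) [X in _ - X](map_polyC vr).
  by congr ('X - _%:P); apply: WE.
have QR : map_poly (@res _ _ v) Q = ('X - (res a)%:P) ^+ size r.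
  rewrite rmorph_prod /= big_seq.
  rewrite (eq_bigr (fun=> 'X - (res a)%:P)).
    by rewrite -big_seq big_const_seq count_predT iter_mulr_1.
  move=> z zr; rewrite rmorphB /= map_polyX map_polyC /=.
  congr (_ - _%:P); apply: res_eq; rewrite WE // valBC.
  exact: rO.
rewrite -QR; apply/polyOverP => i; rewrite coef_map /=.
apply/asboolP; exists Q`_i => //.
by have := polyOverP rE i; rewrite -QE coef_map.
Qed.

Lemma separable_root_once (R : fieldType) (p : {poly R}) c :
  separable_poly p -> ~~ (('X - c%:P) ^+ 2 %| p).
Proof.
move=> ps; apply/negP => /dvdpP[t pt]; move: ps.
by rewrite pt expr2 mulrA separable_root rootM root_XsubC eqxx orbT andbF.
Qed.

Lemma root_expXsubC (R : fieldType) (c : R) n : (0 < n)%N -> root (('X - c%:P) ^+ n) c.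
Proof. by case: n => // n _; rewrite root_exp_XsubC eqxx. Qed.

(** The minimal polynomial of the residue of a over the residue field of E
    divides both a power of a linear polynomial and a separable polynomial, so
    it is linear. *)
Lemma residue_in E (r : seq F) (a : valring_type v) (p : {poly resfield v}) :
  {in r, forall z, Fin 0 < v (val a - z)} ->
  val a \in r ->
  \prod_(z <- r) ('X - z%:P) \is a polyOver E ->
  p \is a polyOver (residues v E) -> separable_poly p -> root p (res a) ->
  exists2 e, e \in E & Fin 0 < v (val a - e).
Proof.
move=> rO ar rE pE ps pa.
have qE := reduce_prod rO rE; set q := _ ^+ _ in qE.
have r0 : (0 < size r)%N by case: {+}r ar.
have qa : root q (res a) := root_expXsubC (res a) r0.
have p0 : p != 0 := separable_poly_neq0 ps.
have aA : res a \in algclosure (residues v E) by apply: (root_algebraic pE p0 pa).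
have mq := minp_dvd aA qE qa; have mp := minp_dvd aA pE pa.
have [k _ mk] : exists2 k, (k <= size r)%N & minp (residues v E) (res a) %= ('X - (res a)%:P) ^+ k.
  exact/dvdp_exp_XsubCP.
have k1 : (k < 2)%N.
  rewrite ltnNge; apply/negP => k2; have /negP := separable_root_once (res a) ps.
  apply; apply: dvdp_trans mp; rewrite (eqp_dvdr _ mk).
  by rewrite -(subnK k2) exprD dvdp_mulIr.
have ad : adeg (residues v E) (res a) = 1%N.
  have := eqp_size mk; rewrite size_minp // size_exp_XsubC => -[dk].
  by apply/eqP; rewrite eqn_leq adeg_gt0 // andbT dk -ltnS.
have /asboolP[e eE ae] := adeg1 aA ad.
by exists (val e) => //; apply/res_close.
Qed.

(** If z were different from 1, then 1 + z + ... + z^(n-1) would vanish, but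
    it is close to the unit n. *)
Lemma root_of_unity_close (n : nat) z : v n%:R = Fin 0 -> z ^+ n = 1 ->
  close v z 1 -> z = 1.
Proof.
move=> vn zn z1; apply/eqP; rewrite -subr_eq0; apply: contraT => z10.
have S0 : \sum_(i < n) z ^+ i = 0.
  by apply: (mulfI z10); rewrite -subrX1 zn subrr mulr0.
have : Fin 0 < v (\sum_(i < n) (z ^+ i - 1)).
  elim/big_ind: _ => //; first by rewrite val0.
    by move=> a b; apply: val_ltD.
  move=> i _; have := close_exp i z1; rewrite expr1n /close.
  by rewrite (close_val (_ : close v (z ^+ i) 1)) ?Defs.val1 // -(expr1n _ i) close_exp.
by rewrite sumrB S0 sumr_const card_ord sub0r valN vn ltxx.
Qed.

(** The product of the 1 - z over the n-th roots z of w is 1 - w, which has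
    positive value. *)
Lemma root_near_one (n : nat) w : (0 < n)%N -> close v w 1 ->
  exists2 z, z ^+ n = w & close v z 1.
Proof.
move=> n0 w1; pose p : {poly F} := 'X^n - w%:P.
have pm : p \is monic by rewrite monicXnsubC.
have [r pr] := poly_splits p.
have : Fin 0 < v (\prod_(z <- r) (1 - z)).
  have := horner_split 1 pr; rewrite (monicP pm) mul1r => <-.
  rewrite /p !hornerE expr1n valBC.
  by have := w1; rewrite /close (close_val w1) Defs.val1.
move=> /prod_gt0[z zr z1]; exists z.
  have : root p z by rewrite -[root _ _]/(z \in root p) (root_split (monic_neq0 pm) pr).
  by rewrite /root !hornerE subr_eq0 => /eqP.
by apply: close_sym; rewrite /close Defs.val1.
Qed.

End Residues.

(** * Averaging over conjugates *)

(** The minimal polynomial is a power of X - a and divides a polynomial with a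
    as a simple root. *)
Lemma mem_of_no_conj_separable (F : closedFieldType) (E : divringClosed F) a (p : {poly F}) :
  p \is a polyOver E -> root p a -> ~~ root p^`() a ->
  (forall z, root (minp E a) z -> z = a) -> a \in E.
Proof.
move=> pE pa p'a noconj.
have p0 : p != 0 by apply: contraNneq p'a => ->; rewrite deriv0 root0.
have aE := root_algebraic pE p0 pa.
apply: adeg1 => //; have [r mr] := poly_splits (minp E a).
have := mr; rewrite (monicP (minp_monic aE)) scale1r => {}mr'.
have ra : {in r, forall z, z = a}.
  by move=> z zr; apply: noconj; rewrite -[root _ _]/(z \in root _) (root_split (minp_neq0 aE) mr).
have sr : adeg E a = size r by rewrite /adeg mr' size_prod_XsubC.
have mE : minp E a = ('X - a%:P) ^+ size r.
  rewrite mr'; elim: {mr mr' sr} r ra => [|z r IH] ra; first by rewrite big_nil.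
  rewrite big_cons (ra z (mem_head _ _)) exprS IH // => t tr.
  by apply: ra; rewrite in_cons tr orbT.
apply/eqP; rewrite eqn_leq adeg_gt0 // andbT sr leqNgt; apply/negP => r2.
have /dvdpP[t pt] : ('X - a%:P) ^+ 2 %| p.
  apply: dvdp_trans (minp_dvd aE pE pa); rewrite mE -(subnK r2) exprD dvdp_mulIr //.
move/negP: p'a; apply; rewrite pt expr2 !derivM derivXsubC mul1r mulr1 /root.
by rewrite hornerD !hornerM [(_ - _ + _).[_]]hornerD hornerXsubC subrr !(mulr0, addr0).
Qed.

Section Averaging.
Variables (F : closedFieldType) (G : orderedGroupType) (v : valuation F G).
Variables (K : divringClosed F) (x : F).
Hypothesis K_tame : tame_field v K.
Hypothesis x_trans : ~ algebraic_over K x.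
Hypothesis F_alg : forall y : F, algebraic_over (adjoin K [set x]) y.
Let K_unib : unibranched v (algclosure K) K. Proof. by case: K_tame => _ []. Qed.

Section Between.
Variable E : divringClosed F.
Hypotheses (KE : {subset K <= E}) (EK : {subset E <= algclosure K}).

(** The ramification index of K(h) over K kills the value of h modulo the
    value group of K and is prime to the residue characteristic. *)
Lemma tame_torsion h : h \in algclosure K -> h != 0 ->
  exists n, [/\ (0 < n)%N, v n%:R = Fin 0 &
    exists d, [/\ d \in K, d != 0 & v (h ^+ n) = v d]].
Proof.
move=> hK h0; have [g vg] := val_fin v h0.
pose Kh : divringClosed F := adjoin K [set h].
have KKh : {subset K <= Kh} by apply: adjoin_subset.
have KhK : {subset Kh <= algclosure K}.
  by apply: adjoin1_min => // b; apply: mem_algclosure.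
have [_ [_ _ _ T]] := K_tame.
have [e [f [ie pe _ _ _]]] := T Kh _ KKh KhK (has_degree_adjoin hK).
have e0 : (0 < e)%N.
  by case: ie => g' [_ /(_ 0 (value_group0 v Kh))[i _]]; apply: leq_ltn_trans (ltn_ord i).
exists e; split => //; first by apply: val_natr; apply: natr_pchar.
have [||||d dK vd] := @has_index_mul _ (value_group v Kh) (value_group v K) _ _ _ _ g ie.
- exact: value_group0.
- by move=> ? ?; apply: value_groupB.
- by move=> ? ?; apply: value_groupD.
- by exists h => //; apply: adjoin1_gen.
exists d; split => //; first by rewrite -(val_ltPInf v) vd.
by rewrite vd; apply: val_finX.
Qed.

(** The conjugates of u have the residue of u, so this residue has no other
    conjugates; it is separable because K is tame. *)
Lemma tame_residue_sep u : u \in algclosure K -> v u = Fin 0 ->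
  (forall z, root (minp E u) z -> Fin 0 < v (u - z)) ->
  exists2 e, e \in E & Fin 0 < v (u - e).
Proof.
move=> uK vu uz.
pose Ku : divringClosed F := adjoin K [set u].
have KKu : {subset K <= Ku} by apply: adjoin_subset.
have KuK : {subset Ku <= algclosure K}.
  by apply: adjoin1_min => // b; apply: mem_algclosure.
have [_ [_ _ _ T]] := K_tame.
have [e [f [_ _ _ sep _]]] := T Ku _ KKu KuK (has_degree_adjoin uK).
have uO : u \in valring v by rewrite inE vu.
pose U := ValringElt uO.
have [|p [[pK _ _] ps pu]] := sep (res U).
  by apply/asboolP; exists U => //; apply: adjoin1_gen.
have uE : u \in algclosure E by apply: algclosure_sub uK.
have [r mr] := poly_splits (minp E u).
have rE z : (z \in r) = root (minp E u) z by rewrite -(root_split (minp_neq0 uE) mr).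
apply: (@residue_in _ _ v E r U p) => //.
- by move=> z; rewrite rE; apply: uz.
- by rewrite rE minp_root.
- by have := mr; rewrite (monicP (minp_monic uE)) scale1r => <-; apply: minp_over.
- apply: polyOver_sub pK => _ /asboolP[a aK ->]; apply/asboolP.
  by exists a => //; apply: KE.
Qed.

(** Let c be the best approximation of b in E and suppose that h = b - c is
    closer to its conjugates than to 0. For some m prime to the residue
    characteristic, h^m has the leading term of an element d1 of E: its value
    is in the value group of K, and its residue has no conjugates. Since m is
    prime to the residue characteristic, the principal unit h^m / d1 has an
    m-th root o that is a principal unit. Then h / o is a root of X^m - d1
    without further conjugates, hence an element of E, and it has the leading
    term of h. So c was not the best approximation. *)
Lemma averaging_finite n b (g : vext G) : has_degree E K n ->
  b \in algclosure K -> (forall z, root (minp E b) z -> g <= v (b - z)) ->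
  exists2 c, c \in E & g <= v (b - c).
Proof.
move=> En bK bz; have [c cE cmax] := tame_max K_tame KE EK En bK.
exists c => //; rewrite leNgt; apply/negP => bcg.
pose h := b - c; have hK : h \in algclosure K by rewrite rpredB // EK.
have h0 : h != 0 := lt_neq0 bcg.
have bE : b \in algclosure E by apply: algclosure_sub bK.
have conjh (s : {rmorphism F -> F}) : {in E, forall e, s e = e} -> close v (s h) h.
  move=> sE; apply: close_sym; rewrite /close.
  have -> : h - s h = b - s b by rewrite rmorphB /= (sE c cE) opprB addrA subrK.
  apply: lt_le_trans bcg _; apply: bz.
  exact: conj_root sE (minp_over bE) (minp_root bE).
(* u is the unit part of h^m; its residue descends to E. *)
have [m [m0 vm [d [dK d0 hd]]]] := tame_torsion hK h0.
pose u := h ^+ m / d.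
have vu : v u = Fin 0 by rewrite (valM_eq hd (erefl (v d^-1))) divff // Defs.val1.
have uK : u \in algclosure K by rewrite rpred_div ?rpredX // mem_algclosure.
have conjE a z : a \in algclosure K -> root (minp E a) z ->
    exists s : {rmorphism F -> F}, [/\ {in E, forall e, s e = e}, s x = x & s a = z].
  exact: conj_exists.
have [|e0 e0E ue0] := tame_residue_sep uK vu.
  move=> z /(conjE _ _ uK)[s [sE _ <-]].
  have : close v u (s u).
    rewrite /u fmorph_div rmorphXn /= (sE d (KE dK)).
    by apply: close_div (close_refl v d0); apply/close_exp/close_sym/conjh.
  by rewrite /close vu.
have ue : close v u e0 by rewrite /close vu.
pose d1 := e0 * d; have d1E : d1 \in E by rewrite rpredM // KE.
have hd1 : close v (h ^+ m) d1.
  by rewrite -[h ^+ m](divfK d0); apply: close_mul ue (close_refl v d0).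
have d10 := close_neq0r hd1.
have w1 : close v (h ^+ m / d1) 1.
  by rewrite -[1](divff d10); apply: close_div hd1 (close_refl v d10).
(* As m is prime to the residue characteristic, k = h / o has no other conjugates. *)
have [o om o1] := root_near_one m0 w1.
have o0 := close_neq0 o1.
pose k := h / o.
have km : k ^+ m = d1 by rewrite expr_div_n om invf_div mulrCA divff ?mulr1 // expf_neq0.
have k0 : k != 0 by rewrite mulf_neq0 ?invr_eq0.
pose p : {poly F} := 'X^m - d1%:P.
have pE : p \is a polyOver E by rewrite rpredB ?polyOverXn ?polyOverC.
have pk : root p k by rewrite /root !hornerE km subrr.
have p0 : p != 0 by rewrite monic_neq0 ?monicXnsubC.
have kK : k \in algclosure K.
  by apply: (algclosure_trans _ p0 pk); apply: polyOver_sub pE.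
have oK : o \in algclosure K.
  have -> : o = h / k by rewrite /k invf_div mulrCA divff // mulr1.
  by rewrite rpred_div.
have kE : k \in E.
  apply: (mem_of_no_conj_separable pE pk).
    rewrite /p derivB derivXn derivC subr0 /root hornerMn hornerXn.
    rewrite -mulr_natl mulf_neq0 ?expf_neq0 //.
    by rewrite -(val_ltPInf v) vm.
  move=> z /(conjE _ _ kK)[s [sE _ <-]].
  have so : close v (s o) o.
    apply: (close_trans (_ : close v (s o) 1)); last exact: close_sym.
    apply: close_sym; rewrite /close Defs.val1.
    have -> : 1 - s o = s (1 - o) by rewrite rmorphB rmorph1.
    rewrite (conj_val K_unib) ?rpredB ?rpred1 //; last by move=> e eK; rewrite sE ?KE.
    by have := close_sym o1; rewrite /close Defs.val1.
  have sk1 : close v (s k / k) 1.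
    rewrite -[1](divff k0); apply: close_div (close_refl v k0).
    by rewrite /k fmorph_div; apply: close_div so; apply: conjh.
  have skm : (s k / k) ^+ m = 1 by rewrite expr_div_n -rmorphXn /= km (sE d1 d1E) divff.
  have sk := root_of_unity_close vm skm sk1.
  by rewrite -[LHS](divfK k0) sk mul1r.
have hk : close v h k.
  rewrite -[h in close v h]divr1; apply: close_div; first exact: close_refl.
  exact: close_sym.
(* c + k is a better approximation than c. *)
have := cmax (c + k) (rpredD cE kE); rewrite leNgt => /negP; apply.
by rewrite opprD addrA.
Qed.

End Between.

(** This replaces the usual use of a trace of value 0 in a tame extension:
    conjugates of b within a ball around b give an element of E in that ball.
    The minimal polynomial of b over E is defined over a subfield of finite
    degree over K. *)
Lemma averaging (E : divringClosed F) b (g : vext G) : {subset K <= E} -> {subset E <= algclosure K} ->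
  b \in algclosure K -> (forall z, root (minp E b) z -> g <= v (b - z)) ->
  exists2 c, c \in E & g <= v (b - c).
Proof.
move=> KE EK bK bz.
have bE : b \in algclosure E by apply: algclosure_sub bK.
have [|E0 [KE0 mE0 [n E0n] E0min]] := @finite_adjoin_seq _ K (minp E b).
  by apply/allP => c /(allP (minp_over bE)) /EK.
have E0E : {subset E0 <= E} by apply: E0min => // a /(allP (minp_over bE)).
have bE0 : b \in algclosure E0 by apply: algclosure_sub bK.
have [|z bz0|c cE0 bc] := @averaging_finite E0 KE0 _ n b g E0n bK.
- by move=> a /E0E/EK.
- apply: bz; have /dvdpP[q ->] : minp E0 b %| minp E b; last by rewrite rootM bz0 orbT.
  by apply: minp_dvd; rewrite ?minp_root //; apply/allP.
by exists c => //; apply: E0E.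
Qed.

(** The case of an infinite radius in [averaging]; in particular tame fields
    are perfect. *)
Lemma mem_of_no_conj (E : divringClosed F) b : {subset K <= E} -> {subset E <= algclosure K} ->
  b \in algclosure K -> (forall z, root (minp E b) z -> z = b) -> b \in E.
Proof.
move=> KE EK bK bz; have [z /bz ->|c cE] := @averaging E b PInf KE EK bK.
  by rewrite subrr val0.
by rewrite leNgt val_ltPInf negbK subr_eq0 => /eqP ->.
Qed.

End Averaging.

(** * Elements of minimal degree and Krasner's lemma *)

Section Krasner.
Variables (F : closedFieldType) (G : orderedGroupType) (v : valuation F G).
Variables (K : divringClosed F) (x : F).
Hypothesis K_tame : tame_field v K.
Hypothesis x_trans : ~ algebraic_over K x.
Hypothesis F_alg : forall y : F, algebraic_over (adjoin K [set x]) y.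
Let K_unib : unibranched v (algclosure K) K. Proof. by case: K_tame => _ []. Qed.
Implicit Types (E M : divringClosed F) (s : {rmorphism F -> F}).

Lemma fixed_poly E (p : {poly F}) : {subset K <= E} -> {subset E <= algclosure K} ->
  p \is a polyOver (algclosure K) ->
  (forall s, {in E, forall e, s e = e} -> map_poly s p = p) -> p \is a polyOver E.
Proof.
move=> KE EK pK ps; apply/polyOverP => i.
apply: (mem_of_no_conj K_tame x_trans F_alg KE EK); first exact: (polyOverP pK).
move=> z /(conj_exists x_trans F_alg KE EK (polyOverP pK i))[s [sE _ <-]].
by rewrite -[in RHS](ps s sE) coef_map.
Qed.

Lemma map_prod_perm s (r : seq F) : uniq r -> {in r, forall z, s z \in r} ->
  map_poly s (\prod_(z <- r) ('X - z%:P)) = \prod_(z <- r) ('X - z%:P).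
Proof.
move=> ur sr; rewrite rmorph_prod /=.
rewrite (eq_bigr (fun z => 'X - (s z)%:P)); last first.
  by move=> z _; rewrite rmorphB /= map_polyX map_polyC.
rewrite -(big_map s xpredT (fun z => 'X - z%:P)); apply: perm_big.
have us : uniq (map s r) by rewrite map_inj_uniq //; apply: fmorph_inj.
have ss : {subset map s r <= r} by move=> _ /mapP[z zr ->]; apply: sr.
by apply: uniq_perm => //; have [] := uniq_min_size us ss; rewrite ?size_map.
Qed.

(** The product over the distinct roots is invariant under conjugation, so it
    has coefficients in K and equals the minimal polynomial. *)
Lemma minp_split a : a \in algclosure K ->
  exists2 r : seq F, uniq r & minp K a = \prod_(z <- r) ('X - z%:P).
Proof.
move=> aK; have [r mr] := poly_splits (minp K a).
have rE z : (z \in undup r) = root (minp K a) z.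
  by rewrite mem_undup -(root_split (minp_neq0 aK) mr).
exists (undup r); first exact: undup_uniq.
set h := \prod_(_ <- _) _.
have hm : h \is monic by apply: monic_prod_XsubC.
have hK : h \is a polyOver K.
  apply: fixed_poly => //; first exact: mem_algclosure.
    rewrite /h big_seq rpred_prod // => z; rewrite rE => /(minp_algroot aK) zK.
    by rewrite polyOverXsubC.
  move=> s sK; apply: map_prod_perm; first exact: undup_uniq.
  by move=> z; rewrite !rE; apply: conj_root (minp_over aK).
apply: monic_dvdp_eq => //; first exact: minp_monic.
  apply: minp_dvd => //; rewrite root_prod_XsubC rE; exact: minp_root.
have := mr; rewrite (monicP (minp_monic aK)) scale1r => ->.
rewrite /h uniq_roots_dvdp //; last by rewrite uniq_rootsE undup_uniq.
by apply/allP => z; rewrite mem_undup root_prod_XsubC.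
Qed.

Lemma fixed_field s : exists M, forall a, a \in M <-> s a = a.
Proof.
apply: divring_of_Prop; first exact: rmorph1.
  by move=> a b sa sb; rewrite rmorphB /= sa sb.
by move=> a b sa sb; rewrite fmorph_div sa sb.
Qed.

(** The first component of a minimal pair that describes y up to the precision
    v(y - a); y may be algebraic or transcendental. *)
Definition min_degree_near (y a : F) := a \in algclosure K /\
  forall c, c \in algclosure K -> (adeg K c < adeg K a)%N -> v (y - c) < v (y - a).

(** Let h be the product of the X - z over the conjugates z of a in the ball
    of radius v(y - a), and let E be generated by the coefficients of h. All
    conjugates of a over E lie in the ball, so [averaging] gives an element of
    E in it. By minimality of the degree and as E is contained in K(a), it
    generates K(a), so a is in E. A conjugation that moves a within the ball
    preserves h, hence fixes E and a. *)
Lemma min_degree_isolated y a : min_degree_near y a ->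
  forall z, root (minp K a) z -> z != a -> v (a - z) < v (y - a).
Proof.
move=> [aK H] a' aa' a'a; rewrite ltNge; apply/negP => ga'.
set g := v (y - a) in ga'.
have [r ur mr] := minp_split aK.
pose B := [seq z <- r | g <= v (a - z)].
have BE z : (z \in B) = (g <= v (a - z)) && root (minp K a) z.
  by rewrite mem_filter mr root_prod_XsubC.
have uB : uniq B by apply: filter_uniq.
pose h := \prod_(z <- B) ('X - z%:P).
have hK : h \is a polyOver (algclosure K).
  rewrite /h big_seq rpred_prod // => z; rewrite BE => /andP[_ /(minp_algroot aK) zK].
  by rewrite polyOverXsubC.
have KK : {subset K <= K} by [].
have KKa : {subset K <= algclosure K} by apply: mem_algclosure.
pose Ka : divringClosed F := adjoin K [set a].
have KKa' : {subset K <= Ka} by apply: adjoin_subset.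
have KaK : {subset Ka <= algclosure K} by apply: adjoin1_min.
(* A conjugation that keeps a in the ball permutes the conjugates in the ball. *)
have stab s : {in K, forall e, s e = e} -> g <= v (a - s a) -> map_poly s h = h.
  move=> sK gs; apply: map_prod_perm => // z; rewrite !BE => /andP[gz za].
  rewrite (conj_root sK (minp_over aK) za) andbT.
  apply: (le_dist gs); rewrite -rmorphB (conj_val K_unib) // rpredB //.
  exact: minp_algroot za.
have hKa : h \is a polyOver Ka.
  apply: fixed_poly => // s sKa; apply: stab => [e eK|]; first by rewrite sKa ?KKa'.
  by rewrite (sKa a) ?adjoin1_gen // subrr val0 val_lePInf.
have [|E [KE hE [n En] Emin]] := @finite_adjoin_seq _ K h.
  by apply/allP => c /(allP hK).
have EKa : {subset E <= Ka} by apply: Emin => // c /(allP hKa).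
have EK : {subset E <= algclosure K} by move=> e /EKa/KaK.
have aE : a \in algclosure E by apply: algclosure_sub aK.
have [z za|c cE ac] := @averaging _ _ v K x K_tame x_trans F_alg E a g KE EK aK.
  have : root h z.
    have /dvdpP[q ->] : minp E a %| h; last by rewrite rootM za orbT.
    apply: minp_dvd => //; first exact/allP.
    rewrite root_prod_XsubC BE subrr val0 val_lePInf; exact: minp_root.
  by rewrite root_prod_XsubC BE => /andP[].
have cK := EK _ cE.
have dca : (adeg K a <= adeg K c)%N.
  rewrite leqNgt; apply/negP => /(H c cK); rewrite ltNge => /negP; apply.
  exact: le_dist ac.
have ainE : a \in E.
  have : a \in adjoin K [set c] by apply: adeg_eq => //; apply: EKa.
  by apply: adjoin1_min.
(* The fixed field of s contains E, hence a, although s moves a. *)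
have [s [sK _ sa]] := conj_exists x_trans F_alg KK KKa aK aa'.
have [M MP] := fixed_field s.
have /MP : a \in M.
  apply: Emin ainE; first by move=> b bK; apply/MP/sK.
  have : map_poly s h = h by apply: stab; rewrite ?sa.
  move=> sh b /(nthP 0)[i _ <-]; apply/MP.
  by rewrite -[in RHS]sh coef_map.
by rewrite sa => ea; rewrite ea eqxx in a'a.
Qed.

(** A conjugate of a over K(b) has the same distance to b as a has, so it is a
    itself. *)
Lemma krasner b a : b \in algclosure K -> min_degree_near b a ->
  a \in adjoin K [set b].
Proof.
move=> bK Hba; have [aK _] := Hba.
pose Kb : divringClosed F := adjoin K [set b].
have KKb : {subset K <= Kb} by apply: adjoin_subset.
have KbK : {subset Kb <= algclosure K}.
  by apply: adjoin1_min => //; apply: mem_algclosure.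
apply: (mem_of_no_conj K_tame x_trans F_alg KKb KbK aK) => z za.
have [s [sb _ sa]] := conj_exists x_trans F_alg KKb KbK aK za.
have sK : {in K, forall e, s e = e} by move=> e /KKb/sb.
apply/eqP; apply: contraT => zna.
have rz : root (minp K a) z by rewrite -sa; apply: conj_root sK (minp_over aK) (minp_root aK).
have := min_degree_isolated Hba rz zna.
rewrite ltNge => /negP[]; apply: (@le_dist _ _ v b); first by rewrite [leRHS]valBC.
rewrite -sa -{2}(sb b) ?adjoin1_gen // -rmorphB (conj_val K_unib) //.
exact: rpredB.
Qed.

(** The logarithmic derivative at y of a product of X - z is the sum of the 1
    / (y - z), and d / (y - z) has positive value for all these z. *)
Lemma deriv_prod_small y d (B : seq F) : {in B, forall z, v (y - z) < v d} ->
  v (\prod_(z <- B) ('X - z%:P)).[y] < v (d * (\prod_(z <- B) ('X - z%:P))^`().[y]).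
Proof.
elim: B => [|z B IH] Bd.
  by rewrite big_nil derivC !hornerC mulr0 val0 Defs.val1.
have {}IH : v (\prod_(z <- B) ('X - z%:P)).[y] < v (d * (\prod_(z <- B) ('X - z%:P))^`().[y]).
  by apply: IH => t tB; apply: Bd; rewrite in_cons tB orbT.
have yzd := Bd z (mem_head _ _).
rewrite big_cons; set h := \prod_(_ <- _) _ in IH *.
rewrite derivM derivXsubC mul1r hornerD !hornerM hornerXsubC mulrDr.
have h0 := lt_neq0 IH.
apply: val_ltD; first exact: valM_lt.
by rewrite mulrCA ![(y - z) * _]mulrC valM_lt // (lt_neq0 yzd).
Qed.

(** Up to a scalar this is the polynomial X^n g(q / X), where g is the given
    product of degree n. *)
Lemma inverse_roots_poly M (w : seq F) q : uniq w -> 0 \notin w ->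
  \prod_(z <- w) ('X - z%:P) \is a polyOver M -> q \in M -> q != 0 ->
  \prod_(z <- w) ('X - (q / z)%:P) \is a polyOver M.
Proof.
move=> uw w0 gM qM q0; set g := \prod_(_ <- _) _ in gM.
have sg : size g = (size w).+1 by rewrite size_prod_XsubC.
have g00 : g`_0 != 0.
  by rewrite -horner_coef0 -/(root g 0) root_prod_XsubC.
pose n := size w.
pose P := \poly_(k < n.+1) (g`_(n - k) * q ^+ (n - k) / g`_0).
have PM : P \is a polyOver M.
  apply/polyOverP => k; rewrite coef_poly; case: ifP => _; last exact: rpred0.
  by rewrite rpred_div ?rpredM ?rpredX ?(polyOverP gM).
have Pn : P`_n = 1 by rewrite coef_poly ltnSn subnn expr0 mulr1 divff.
have sP : size P = n.+1.
  apply/eqP; rewrite eqn_leq size_poly /= ltnNge; apply/negP => sn.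
  by have := Pn; rewrite nth_default // => /esym/eqP; rewrite oner_eq0.
have Pr z : z \in w -> root P (q / z).
  move=> zw; have z0 : z != 0 by apply: contraNneq w0 => <-.
  have gz : g.[z] = 0 by apply/eqP; rewrite -/(root g z) root_prod_XsubC.
  apply/eqP; rewrite horner_poly (reindex_inj rev_ord_inj) /=.
  transitivity (\sum_(j < n.+1) (q / z) ^+ n / g`_0 * (g`_j * z ^+ j)).
    apply: eq_bigr => j _; rewrite subSS subKn ?leq_ord //.
    have qz : (q / z) ^+ n = (q / z) ^+ (n - j) * (q / z) ^+ j.
      by rewrite -exprD subnK // leq_ord.
    have qj : q ^+ j = (q / z) ^+ j * z ^+ j by rewrite -exprMn divfK.
    by rewrite qz qj; ring.
  by rewrite -mulr_sumr -sg -horner_coef gz mulr0.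
have uq : uniq [seq q / z | z <- w].
  rewrite map_inj_in_uniq // => a b _ _ /(mulfI q0)/invr_inj //.
have := @all_roots_prod_XsubC _ P [seq q / z | z <- w].
rewrite sP size_map uniq_rootsE uq big_map lead_coefE sP Pn scale1r => <- //.
by apply/allP => _ /mapP[z zw ->]; apply: Pr.
Qed.

End Krasner.

(** * Henselian fields *)

Section KrasnerHensel.
Variables (F : closedFieldType) (G : orderedGroupType) (v : valuation F G).
Variables (K : divringClosed F) (x : F).
Hypothesis K_tame : tame_field v K.
Hypothesis x_trans : ~ algebraic_over K x.
Hypothesis F_alg : forall y : F, algebraic_over (adjoin K [set x]) y.

(** Let f be the minimal polynomial of a. Since a is the only root of f in the
    ball around y, the Newton correction q = f(y) / f'(y) has the leading term
    of y - a. Hence the polynomial with the roots q / (y - z), for z a root of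
    f, reduces to X^(n-1) (X - 1), and Hensel's lemma in M yields its root q /
    (y - a). *)
Lemma krasner_hensel (M : divringClosed F) y a : {subset K <= M} -> henselian v M ->
  y \in M -> min_degree_near v K y a -> a \in M.
Proof.
move=> KM hM yM Hya; have [aK _] := Hya.
have [<-//|ya] := eqVneq y a.
have [r ur mr] := minp_split K_tame x_trans F_alg aK.
pose B := rem a r.
have ar : a \in r by rewrite -root_prod_XsubC -mr minp_root.
have rB : perm_eq r (a :: B) by apply: perm_to_rem.
have Bd z : z \in B -> v (y - z) < v (y - a).
  rewrite mem_rem_uniq // inE => /andP[za zr].
  have az := min_degree_isolated K_tame x_trans F_alg Hya _ za.
  have {}az : v (a - z) < v (a - y) by rewrite [ltRHS]valBC az // mr root_prod_XsubC.
  by rewrite (dist_eq az) [ltRHS]valBC.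
have rd z : z \in r -> y - z != 0.
  rewrite (perm_mem rB) in_cons => /predU1P[->|/Bd/lt_neq0 //].
  by rewrite subr_eq0.
pose d := y - a; have d0 : d != 0 by rewrite subr_eq0.
pose f := minp K a; pose g := \prod_(z <- B) ('X - z%:P).
have fE : f = ('X - a%:P) * g by rewrite /f mr (perm_big _ rB) big_cons.
have gs : v g.[y] < v (d * g^`().[y]) by apply: deriv_prod_small.
have f'E : f^`().[y] = g.[y] + d * g^`().[y].
  by rewrite fE derivM derivXsubC mul1r hornerD hornerM hornerXsubC.
have gf' : close v g.[y] f^`().[y].
  by rewrite /close f'E opprD addrA subrr add0r valN.
pose q := f.[y] / f^`().[y].
have fM : f \is a polyOver M := polyOver_sub KM (minp_over aK).
have qM : q \in M by rewrite rpred_div // rpred_horner // polyOver_deriv.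
have qd : close v q d.
  have fy : f.[y] = d * g.[y] by rewrite fE hornerM hornerXsubC.
  rewrite /q fy -mulrA -[d in close _ _ d]mulr1.
  apply: close_mul (close_refl v d0) _; rewrite -(divff (close_neq0r gf')).
  by apply: close_div gf' (close_refl v (close_neq0r gf')).
have q0 := close_neq0 qd.
(* Hensel's lemma is applied at 1 to the polynomial P with the roots q / (y - z). *)
pose w := [seq y - z | z <- r].
have uw : uniq w by rewrite map_inj_uniq // => s t /addrI/oppr_inj.
have w0 : 0 \notin w.
  by apply/negP => /mapP[z /rd + zE]; rewrite -zE eqxx.
have wM : \prod_(z <- w) ('X - z%:P) \is a polyOver M.
  have -> : \prod_(z <- w) ('X - z%:P) = (-1) ^+ size r *: (f \Po (y%:P - 'X)).
    rewrite /f mr rmorph_prod /= big_map.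
    elim: (r) => [|z l IH]; first by rewrite !big_nil scale1r.
    rewrite !big_cons IH -scalerAr exprS mulN1r scaleNr -scalerN -mulNr.
    congr (_ *: (_ * _)); rewrite comp_polyB comp_polyX comp_polyC polyCB.
    by ring.
  by rewrite polyOverZ ?rpredX ?rpredN1 // polyOver_comp ?rpredB ?polyOverC ?polyOverX.
have PM := inverse_roots_poly uw w0 wM qM q0; rewrite big_map in PM.
pose Z z := q / (y - z).
set P := \prod_(z <- r) _ in PM.
have PE : P = ('X - (Z a)%:P) * \prod_(z <- B) ('X - (Z z)%:P).
  by rewrite /P (perm_big _ rB) big_cons.
have Za : close v (Z a) 1.
  by rewrite /Z -/d -(divff d0); apply: close_div qd (close_refl v d0).
have ZB z : z \in B -> Fin 0 < v (Z z).
  move=> zB; have yz0 : y - z != 0 by apply: rd; rewrite (perm_mem rB) in_cons zB orbT.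
  rewrite -(Defs.val1 v) -(divff yz0) /Z valM_lt ?invr_eq0 //.
  by rewrite (close_val qd); apply: Bd.
have vZa : v (Z a) = Fin 0 by rewrite (close_val Za) Defs.val1.
have Za1 : Fin 0 < v (1 - Z a) by have := close_sym Za; rewrite /close Defs.val1.
set R := \prod_(z <- B) _ in PE.
have RO : R \is a polyOver (valring v).
  rewrite /R big_seq rpred_prod // => z zB; rewrite polyOverXsubC inE.
  exact/ltW/ZB.
have PO : P \is a polyOver (valring v).
  by rewrite PE rpredM // polyOverXsubC inE vZa.
have R1 : close v R.[1] 1.
  rewrite /R horner_prod; have := @close_prod _ _ v _ B (fun z => ('X - (Z z)%:P).[1]) (fun=> 1).
  rewrite big1_eq; apply => z zB; apply: close_sym.
  by rewrite /close hornerXsubC opprB addrCA subrr addr0 Defs.val1 ZB.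
have vR1 : v R.[1] = Fin 0 by rewrite (close_val R1) Defs.val1.
have R'1 : Fin 0 <= v R^`().[1].
  suff : R^`().[1] \in valring v by [].
  by apply: rpred_horner; rewrite ?polyOver_deriv // inE Defs.val1.
have [||||||c [cM cP c1]] := hM P 1.
- by apply/allP => e eP; apply/andP; split; [apply: (allP PM) | apply: (allP PO)].
- exact: monic_prod_XsubC.
- exact: rpred1.
- by rewrite inE Defs.val1.
- by rewrite PE hornerM hornerXsubC val_gt0M // vR1.
- rewrite PE derivM derivXsubC mul1r hornerD hornerM hornerXsubC.
  by rewrite valDl vR1 // val_gt0M.
have : c \in [seq Z z | z <- r] by rewrite -root_prod_XsubC big_map.
case/mapP => z; rewrite (perm_mem rB) in_cons => /predU1P[->|zB] cE.
  have -> : a = y - q / c.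
    by rewrite cE /Z invf_div mulrCA divff // mulr1 opprB addrC subrK.
  by rewrite rpredB // rpred_div.
have := val_ltB (ZB z zB) c1; rewrite -cE opprB addrCA subrr addr0 Defs.val1 ltxx //.
Qed.

End KrasnerHensel.

Section MaximalImmediate.
Variables (F : closedFieldType) (G : orderedGroupType) (v : valuation F G).
Implicit Types (M L : divringClosed F).

(** The remainder of order two is divisible by h^2 in the ring itself, so over
    the valuation ring the cofactor e is integral. *)
Lemma taylor2 (R : comNzRingType) (p : {poly R}) a h :
  exists e, p.[a + h] = p.[a] + h * p^`().[a] + h ^+ 2 * e.
Proof.
elim/poly_ind: p => [|p c [e pe]].
  by exists 0; rewrite deriv0 !horner0 !mulr0 !addr0.
exists (p^`().[a] + e * (a + h)).
rewrite derivMXaddC !hornerMXaddC pe hornerD hornerMX.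
by ring.
Qed.

(** Newton iteration: by Taylor's formula the new error is the old one
    squared, times an integral element. *)
Lemma newton_step M (p : {poly F}) b z c :
  p \is a polyOver [predI M & valring v] -> b \in valring v -> c \in M ->
  v p^`().[b] = Fin 0 -> Fin 0 < v (z - b) -> root p z -> z \notin M ->
  Fin 0 < v (z - c) -> v (z - c) < v (z - (c - p.[c] / p^`().[c])).
Proof.
move=> pMO bO cM p'b zb pz znM zc.
have bz : Fin 0 < v (b - z) by rewrite valBC.
have pO : p \is a polyOver (valring v) by apply: polyOver_sub pMO => e /andP[].
pose vr : {rmorphism valring_type v -> F} := val.
have [P PE] : exists P : {poly valring_type v}, p = map_poly vr P.
  exists (\poly_(i < size p) insubd 0 p`_i).
  apply/polyP => i; rewrite coef_map coef_poly.
  case: ltnP => ip; last by rewrite nth_default.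
  by symmetry; apply: insubdK; apply: (polyOverP pO).
have zO : z \in valring v.
  by rewrite inE -(subrK b z) val_leD // ltW.
have cO : c \in valring v.
  by rewrite inE -(subKr z c) val_leB // ltW.
pose b' := ValringElt bO; pose z' := ValringElt zO; pose c' := ValringElt cO.
have hE (Q : {poly valring_type v}) (t : valring_type v) : vr Q.[t] = (map_poly vr Q).[vr t].
  by rewrite horner_map.
have [e] := taylor2 P c' (z' - c'); rewrite addrC subrK => /(congr1 vr).
have [e2] := taylor2 P^`() b' (c' - b'); rewrite addrC subrK => /(congr1 vr).
rewrite !rmorphD !rmorphM !rmorphB !hE -!deriv_map -PE => p'c.
rewrite (eqP pz) => pc.
set h := z - c in zc pc *.
have h0 : h != 0 by rewrite subr_eq0; apply: contraNneq znM => ->.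
have eO : Fin 0 <= v (val e) by exact: (valP e).
have vp'c : v p^`().[c] = Fin 0.
  have cb : Fin 0 < v (c - b).
    have -> : c - b = (z - b) - (z - c) by ring.
    exact: val_ltB.
  have p''O : Fin 0 <= v p^`()^`().[b].
    suff : p^`()^`().[b] \in valring v by [].
    by apply: rpred_horner; rewrite ?polyOver_deriv.
  have e2O : Fin 0 <= v (val e2) by exact: (valP e2).
  rewrite p'c -addrA valDl [v p^`().[_]]p'b //; apply: val_ltD.
    exact: val_gt0M.
  by rewrite -mulrA; apply: val_gt0M => //; apply: val_ge0M => //; apply: ltW.
have p'c0 : p^`().[c] != 0 by rewrite -(val_ltPInf v) vp'c.
have -> : z - (c - p.[c] / p^`().[c]) = - (h * val e / p^`().[c] * h).
  have -> : p.[c] = - (h * p^`().[c] + h * h * val e).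
    by apply/eqP; rewrite -addr_eq0 addrA; apply/eqP.
  by rewrite opprB addrCA -/h mulNr mulrDl mulfK //; ring.
rewrite valN -[ltLHS]/(v h) -[X in v X < _]mul1r valM_lt // Defs.val1.
have fV : Fin 0 <= v p^`().[c]^-1 by rewrite (val_finV vp'c) oppr0.
by rewrite -mulrA val_gt0M // val_ge0M.
Qed.

(** A root z lifting a simple residue root which is not in M is approximated
    by Newton iteration without a best approximation in M; then
    [immediate_adjoin] yields a proper immediate extension of M. *)
Lemma maximal_henselian M :
  (forall y, y \in algclosure M -> y \notin M ->
     ~ dense_in v M (adjoin M [set y])) -> henselian v M.
Proof.
move=> Mmax p b pMO pm bM bO pb p'b.
have pM : p \is a polyOver M by apply: polyOver_sub pMO => e /andP[].
have p0 := monic_neq0 pm.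
have [r pr] := poly_splits p.
have : Fin 0 < v (\prod_(z <- r) (b - z)).
  by have := horner_split b pr; rewrite (monicP pm) mul1r => <-.
move=> /prod_gt0[z zr bz].
have pz : root p z by rewrite -[root _ _]/(z \in root p) (root_split p0 pr).
have zb : Fin 0 < v (z - b) by rewrite valBC.
have [zM|znM] := boolP (z \in M); first by exists z.
have zA : z \in algclosure M by apply: (root_algebraic pM p0 pz).
have [c cM|y [yA ynM yD]] := @immediate_adjoin _ _ v M z zA; last first.
  by have := Mmax y yA ynM yD.
(* If c is not in the open unit ball around z, b is better; otherwise Newton
   iteration improves c. *)
have [zc|zc] := leP (v (z - c)) (Fin 0).
  by exists b => //; apply: le_lt_trans zb.
exists (c - p.[c] / p^`().[c]); last exact: (newton_step pMO bO).
by rewrite rpredB // rpred_div // rpred_horner // polyOver_deriv.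
Qed.

(** A maximal immediate extension of L inside F. It contains the henselization
    of L, and it has the same leading terms as L. *)
Lemma immediate_henselization L :
  exists M, [/\ {subset L <= M}, dense_in v L M & henselian v M].
Proof.
pose P (X : set F) := exists M, [/\ X = [set a | a \in M], {subset L <= M} & dense_in v L M].
have [||X [[M [XM LM MD]] _ Xmax]] := @Zorn_above F P [set a | a \in L].
- exists L; split => // h hL h0; exists h => //; exact: close_refl.
- move=> C [X0 CX0] CP Ctot.
  have C2 a b : (\bigcup_(X in C) X) a -> (\bigcup_(X in C) X) b ->
      exists X, [/\ C X, X a & X b].
    move=> [X CX Xa] [Y CY Yb]; have [XY|YX] := Ctot _ _ CX CY.
      by exists Y; split => //; apply: XY.
    by exists X; split => //; apply: YX.
  have [|||M MP] := @divring_of_Prop F (\bigcup_(X in C) X).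
  + exists X0 => //; have [M [-> _ _]] := CP _ CX0; exact: rpred1.
  + move=> a b Ca Cb; have [X [CX Xa Xb]] := C2 _ _ Ca Cb.
    exists X => //; have [M [XM _ _]] := CP _ CX; rewrite XM in Xa Xb *.
    exact: rpredB.
  + move=> a b Ca Cb; have [X [CX Xa Xb]] := C2 _ _ Ca Cb.
    exists X => //; have [M [XM _ _]] := CP _ CX; rewrite XM in Xa Xb *.
    exact: rpred_div.
  exists M; split.
  + by apply/seteqP; split => a /MP.
  + move=> a aL; apply/MP; exists X0 => //; have [M' [-> LM' _]] := CP _ CX0.
    exact: LM'.
  + move=> h /MP[X CX Xh] h0; have [M' [XM' _ D]] := CP _ CX.
    by apply: D => //; rewrite XM' in Xh.
exists M; split => //; apply: maximal_henselian => y yA ynM yD.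
pose My : divringClosed F := adjoin M [set y].
have MMy : {subset M <= My} by apply: adjoin_subset.
have : [set a | a \in My] `<=` X.
  apply: Xmax; first by rewrite XM => a /MMy.
  exists My; split => //; first by move=> a /LM/MMy.
  exact: dense_in_trans MD yD.
move=> /(_ y (adjoin1_gen _ _)); rewrite XM /= => yM.
by rewrite yM in ynM.
Qed.

End MaximalImmediate.

(** * The algebraic part of a henselization *)

Section Trace.
Variables (F : closedFieldType) (G : orderedGroupType) (v : valuation F G).
Variables (K : divringClosed F) (x : F).
Hypothesis K_tame : tame_field v K.
Hypothesis x_trans : ~ algebraic_over K x.
Hypothesis F_alg : forall y : F, algebraic_over (adjoin K [set x]) y.
Let K_unib : unibranched v (algclosure K) K. Proof. by case: K_tame => _ []. Qed.

Lemma farthest_elt (b : F) (r : seq F) z : z \in r ->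
  exists2 z0, z0 \in r & {in r, forall t, v (b - z0) <= v (b - t)}.
Proof.
elim: r z => // t [|u r] IH z _.
  by exists t; rewrite ?mem_head // => s; rewrite inE => /eqP ->.
have [z0 z0r H] := IH u (mem_head _ _).
have [le|lt] := leP (v (b - z0)) (v (b - t)).
  exists z0; first by rewrite in_cons z0r orbT.
  by move=> s; rewrite in_cons => /predU1P[->|/H].
exists t; first exact: mem_head.
move=> s; rewrite in_cons => /predU1P[->//|/H].
exact: le_trans (ltW lt).
Qed.

Section Invariant.
Variable s : {rmorphism F -> F}.
Hypotheses (sK : {in K, forall e, s e = e}) (sx : s x = x).
Hypothesis s_dist : forall z, z \in algclosure K -> v (x - s z) = v (x - z).

(** Conjugation moves the roots of g without changing their distances to x. *)
Lemma conj_horner_val g : g \is a polyOver (algclosure K) -> v (s g.[x]) = v g.[x].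
Proof.
move=> gK; have [->|g0] := eqVneq g 0; first by rewrite horner0 rmorph0.
have [r gr] := poly_splits g.
have rK z : z \in r -> z \in algclosure K.
  rewrite -(root_split g0 gr) => gz; exact: (algclosure_trans gK g0 gz).
rewrite (horner_split _ gr) rmorphM; apply: valM_eq.
  by rewrite (conj_val K_unib) // lead_coefE (polyOverP gK).
rewrite rmorph_prod; elim: {gr}r rK => [|z r IH] rK; first by rewrite !big_nil.
rewrite !big_cons; apply: valM_eq.
  by rewrite rmorphB /= sx; apply: s_dist; apply: rK; apply: mem_head.
by apply: IH => t tr; apply: rK; rewrite in_cons tr orbT.
Qed.

Lemma conj_frac_val y : y \in adjoin (algclosure K) [set x] -> v (s y) = v y.
Proof.
move=> /adjoin1_frac[g [k [gK kK k0 ->]]]; rewrite fmorph_div.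
by apply: valM_eq; [|apply: valV_eq]; apply: conj_horner_val.
Qed.
End Invariant.

(** Let M be an immediate henselian extension of L(x), and let b in M be
    algebraic over K. By [averaging], some c in L is at least as close to b as
    the farthest conjugate z0 of b over L is. If b - c is nonzero, it has the
    leading term of some m in L(x). A conjugation s over L(x) which sends b to
    z0 fixes m and preserves the distance of m to b - c, so b - c is close to
    its image, and z0 is closer to b than c is. This is a contradiction. *)
Lemma henselization_trace (L : divringClosed F) : {subset K <= L} -> {subset L <= algclosure K} ->
  (forall s : {rmorphism F -> F}, {in L, forall e, s e = e} ->
    forall z, z \in algclosure K -> v (x - s z) = v (x - z)) ->
  forall b, b \in henselization v (adjoin L [set x]) -> b \in algclosure K -> b \in L.
Proof.
move=> KL LK Ls b /asboolP bH bK.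
pose Lx : divringClosed F := adjoin L [set x].
have [M [LxM D hM]] := immediate_henselization v Lx.
have bM := bH M LxM hM.
have bL : b \in algclosure L by apply: algclosure_sub bK.
have [r mr] := poly_splits (minp L b).
have rE z : (z \in r) = root (minp L b) z.
  by rewrite -(root_split (minp_neq0 bL) mr).
have [noc|] := pselect (forall z, root (minp L b) z -> z = b).
  exact: (mem_of_no_conj K_tame x_trans F_alg).
move=> /existsNP[z1 /not_implyP[rz1 /eqP z1b]].
have [|z0 ] := @farthest_elt b [seq z <- r | z != b] z1.
  by rewrite mem_filter z1b rE.
rewrite mem_filter rE => /andP[z0b rz0] z0min.
have [z rz|c cL bc] := @averaging _ _ v K x K_tame x_trans F_alg L b (v (b - z0)) KL LK bK.
  have [->|zb] := eqVneq z b; first by rewrite subrr val0 val_lePInf.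
  by apply: z0min; rewrite mem_filter zb rE.
have [bE|h0] := eqVneq b c; first by rewrite bE.
rewrite -subr_eq0 in h0.
have [s [sL sx sb]] := conj_exists x_trans F_alg KL LK bK rz0.
have cM : c \in M by apply: LxM; apply: adjoin_subset.
have [m mLx hm] := D (b - c) (rpredB bM cM) h0.
have : v (b - c) < v (b - z0).
  have -> : b - z0 = (b - c) - s (b - c).
    by rewrite rmorphB /= sb (sL c cL) opprB addrA subrK.
  apply: (@lt_dist _ _ v m) => //.
  (* The fixed field of s contains L and x, hence m. *)
  have sm : s m = m.
    have [N NP] := fixed_field s; apply/NP; apply: (adjoin1_min _ _ mLx).
      by move=> e eL; apply/NP/sL.
    exact/NP.
  rewrite -{1}sm -rmorphB conj_frac_val //; first by rewrite [ltRHS]valBC.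
  - by move=> e eK; apply/sL/KL.
  - exact: Ls.
  apply: rpredB.
    apply: (adjoin1_min _ _ mLx); last exact: adjoin1_gen.
    by move=> e /LK; apply: adjoin_subset.
  by apply: adjoin_subset; rewrite rpredB // LK.
by rewrite ltNge bc.
Qed.

(** For a in L with v(x - z) <= v(x - a), both z and its conjugate have the
    same distance to a, hence the conjugate is at least as close to x as z is.
    The roles of z and its conjugate can be exchanged. *)
Lemma approx_invariant (L : divringClosed F) :
  {subset K <= L} -> {subset L <= algclosure K} ->
  (forall z, z \in algclosure K -> exists2 a, a \in L & v (x - z) <= v (x - a)) ->
  forall s : {rmorphism F -> F}, {in L, forall e, s e = e} ->
    forall z, z \in algclosure K -> v (x - s z) = v (x - z).
Proof.
move=> KL LK app s sL z zK.
have sK : {in K, forall e, s e = e} by move=> e /KL/sL.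
have szK : s z \in algclosure K.
  exact: minp_algroot (conj_root sK (minp_over zK) (minp_root zK)).
have zE a : a \in L -> v (a - s z) = v (a - z).
  by move=> aL; rewrite -{1}(sL a aL) -rmorphB (conj_val K_unib) // rpredB // LK.
apply/eqP; rewrite eq_le; apply/andP; split.
  have [a aL xa] := app _ szK; apply: (le_dist xa).
  by rewrite -zE //; apply: (@le_dist _ _ v x); first by rewrite [leRHS]valBC.
have [a aL xa] := app _ zK; apply: (le_dist xa).
by rewrite zE //; apply: (@le_dist _ _ v x); first by rewrite [leRHS]valBC.
Qed.

End Trace.

(** * Torsion and algebraicity of residues *)

Section ValuationAlgebraic.
Variables (F : closedFieldType) (G : orderedGroupType) (v : valuation F G).
Implicit Types (M E : divringClosed F).

Lemma least_value (f : nat -> F) n :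
  exists2 i, (i <= n)%N & forall j, (j <= n)%N -> v (f i) <= v (f j).
Proof.
elim: n => [|n [i i_n H]]; first by exists 0%N => // j; rewrite leqn0 => /eqP ->.
have [le|lt] := leP (v (f i)) (v (f n.+1)).
  exists i; first exact: leqW.
  by move=> j; rewrite leq_eqVlt => /predU1P[->|/H].
exists n.+1 => // j; rewrite leq_eqVlt => /predU1P[->//|/H].
exact: le_trans (ltW lt).
Qed.

(** In the relation given by the minimal polynomial at least two terms have
    the same least value. *)
Lemma algebraic_torsion M y : y != 0 -> y \in algclosure M ->
  exists n c, [/\ (0 < n)%N, c \in M, c != 0 & v (y ^+ n) = v c].
Proof.
move=> y0 yM; pose p := minp M y; pose n := adeg M y.
have sp : size p = n.+1 := size_minp yM.
have pM := minp_over yM.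
have [i i_n imin] := least_value (fun i => p`_i * y ^+ i) n.
have fin0 : v (p`_i * y ^+ i) < PInf.
  apply: le_lt_trans (imin n (leqnn _)) _; rewrite val_ltPInf mulf_neq0 ?expf_neq0 //.
  by have := minp_monic yM; rewrite monicE lead_coefE -/p sp => /eqP ->; rewrite oner_eq0.
have [[j [j_n ji vij]]|no] := pselect (exists j, [/\ (j <= n)%N, j != i &
    v (p`_j * y ^+ j) = v (p`_i * y ^+ i)]); last first.
  have : v (p`_i * y ^+ i) < v (- \sum_(j < n.+1 | j != i :> nat) p`_j * y ^+ j).
    rewrite valN; elim/big_ind: _ => [|a b|j ji]; first by rewrite val0.
      exact: val_ltD.
    rewrite lt_neqAle imin ?leq_ord // andbT; apply/eqP => vij.
    by apply: no; exists j; rewrite leq_ord.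
  have : p.[y] = 0 by apply/eqP; exact: (minp_root yM).
  rewrite horner_coef sp (bigD1 (Ordinal (i_n : i < n.+1)%N)) //=.
  by move/eqP; rewrite addr_eq0 => /eqP {1}->; rewrite ltxx.
wlog {imin} ij : i j i_n j_n ji vij fin0 / (i < j)%N.
  move=> H; have [ij|] := ltnP i j; first exact: (H i j).
  rewrite leq_eqVlt (negPf ji) /= => lt.
  by apply: (H j i) => //; rewrite 1?eq_sym // vij.
have finj : v (p`_j * y ^+ j) < PInf by rewrite vij.
have pi0 : p`_i != 0.
  by move: fin0; rewrite val_ltPInf; apply: contraNneq => ->; rewrite mul0r.
have pj0 : p`_j != 0.
  by move: finj; rewrite val_ltPInf; apply: contraNneq => ->; rewrite mul0r.
exists (j - i)%N, (p`_i / p`_j); split; rewrite ?subn_gt0 //.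
- by rewrite rpred_div ?(polyOverP pM).
- by rewrite mulf_neq0 ?invr_eq0.
have := valM_eq vij (erefl (v ((p`_j)^-1 * y ^- i))).
have -> : y ^+ j = y ^+ (j - i)%N * y ^+ i by rewrite -exprD subnK // ltnW.
have yi0 : y ^+ i != 0 by rewrite expf_neq0.
have -> : p`_j * (y ^+ (j - i)%N * y ^+ i) * ((p`_j)^-1 * y ^- i) =
          y ^+ (j - i)%N * (p`_j / p`_j) * (y ^+ i / y ^+ i) by ring.
rewrite !divff // !mulr1 => ->; congr (v _).
by rewrite mulrACA divff // mulr1.
Qed.

Lemma valX_inj a b n : (0 < n)%N -> b != 0 -> v (a ^+ n) = v (b ^+ n) -> v a = v b.
Proof.
move=> n0 b0 ab; pose c := a / b.
have cn : v (c ^+ n) = Fin 0.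
  rewrite /c expr_div_n (valM_eq ab (erefl _)) divff ?expf_neq0 //.
  exact: Defs.val1.
have c0 : c != 0.
  apply: contra_eq_neq cn => ->; rewrite expr0n gtn_eqF //=.
  by rewrite val0.
have gt (d : F) : v (d ^+ n) = Fin 0 -> ~~ (Fin 0 < v d).
  move=> dn; apply/negP => d0; have : Fin 0 < v (d ^+ n).
    rewrite -(prednK n0) exprS val_gt0M // val_ge0_X // ltW //.
  by rewrite dn ltxx.
have vc : v c = Fin 0.
  apply/eqP; rewrite eq_le leNgt gt //= leNgt; apply/negP => lt.
  have /negP : ~~ (Fin 0 < v c^-1) by apply: gt; rewrite exprVn (val_finV cn) oppr0.
  apply.
  have := @valM_lt _ _ v c^-1 c 1; rewrite invr_eq0 divff // mul1r Defs.val1.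
  exact.
rewrite -(divfK b0 a) -/c -[in RHS](mul1r b); apply: valM_eq => //.
by rewrite Defs.val1.
Qed.

(** Lift the minimal polynomial of the residue of y to a monic polynomial over
    K. Its value at y has positive value and is the product of the distances
    of y to the roots. *)
Lemma residue_lift (K : divringClosed F) (y : valring_type v) :
  res y \in algclosure (residues v K) ->
  exists2 u, u \in algclosure K & Fin 0 < v (val y - u).
Proof.
move=> yA; pose m := minp (residues v K) (res y).
have mK : m \is a polyOver (residues v K) := minp_over yA.
pose n := adeg (residues v K) (res y).
have sm : size m = n.+1 := size_minp yA.
have /choice[e eP] i : exists a : valring_type v, val a \in K /\ m`_i = res a.
  by have /asboolP[a aK ma] := polyOverP mK i; exists a.
pose vr : {rmorphism valring_type v -> F} := val.
(* The leading coefficient is lifted to 1, so that Q is monic. *)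
pose Q : {poly valring_type v} := \poly_(i < n.+1) (if i == n then 1 else e i).
have Qm : map_poly (@res _ _ v) Q = m.
  apply/polyP => i; rewrite coef_map coef_poly /=.
  case: ltnP => i_n; last by rewrite rmorph0 nth_default ?sm.
  have [->|_] := eqVneq i n; last by have [_ ->] := eP i.
  rewrite rmorph1; have := minp_monic yA; rewrite monicE lead_coefE -/m sm.
  by move/eqP.
pose q := map_poly vr Q.
have qn : q`_n = 1 by rewrite coef_map coef_poly ltnSn eqxx; exact: (rmorph1 vr).
have sq : size q = n.+1.
  apply/eqP; rewrite eqn_leq ltnNge; apply/andP; split.
    by apply: leq_trans (size_poly _ _) _; apply: size_poly.
  apply/negP => sn; have := qn; rewrite nth_default // => /esym/eqP.
  by rewrite oner_eq0.
have qm : q \is monic by rewrite monicE lead_coefE sq qn.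
have qK : q \is a polyOver K.
  apply/polyOverP => i; rewrite coef_map coef_poly; case: ifP => _; last first.
    exact: rpred0.
  by case: eqP => _; [exact: rpred1 | have [] := eP i].
have [r qr] := poly_splits q.
have : Fin 0 < v (\prod_(u <- r) (val y - u)).
  have := horner_split (val y) qr; rewrite (monicP qm) mul1r => <-.
  have -> : q.[val y] = val Q.[y] by rewrite (horner_map vr).
  rewrite -res_eq0 -horner_map /= Qm.
  exact: (minp_root yA).
move=> /prod_gt0[u ur yu]; exists u => //.
apply: (root_algebraic qK (monic_neq0 qm)).
by rewrite -[root _ _]/(u \in root q) (root_split (monic_neq0 qm) qr).
Qed.

(** Divide a polynomial relation by a coefficient of least value; its
    reduction is then nonzero. *)
Lemma algebraic_residue M (y : valring_type v) : val y \in algclosure M ->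
  res y \in algclosure (residues v M).
Proof.
move=> yM; pose p := minp M (val y); pose n := adeg M (val y).
have sp : size p = n.+1 := size_minp yM.
have pM := minp_over yM.
have [i i_n imin] := least_value (fun i => p`_i) n.
have pi0 : p`_i != 0.
  rewrite -(val_ltPInf v); apply: le_lt_trans (imin n (leqnn _)) _.
  have := minp_monic yM; rewrite monicE lead_coefE -/p sp => /eqP ->.
  by rewrite Defs.val1.
have cO j : p`_j / p`_i \in valring v.
  rewrite inE -(Defs.val1 v) -(divff pi0) valM_le //.
  have [j_n|j_n] := leqP j n; first exact: imin.
  by rewrite [p`_j]nth_default ?sp // val0 val_lePInf.
pose Q := \poly_(j < n.+1) (ValringElt (cO j)).
have Qy : Q.[y] = 0.
  apply: val_inj; pose vr : {rmorphism valring_type v -> F} := val.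
  rewrite [RHS](rmorph0 vr) [LHS](_ : _ = vr Q.[y]) // horner_poly rmorph_sum.
  have : p.[val y] / p`_i = 0.
    by rewrite (eqP (minp_root yM)) mul0r.
  rewrite horner_coef sp mulr_suml => pE; rewrite -[RHS]pE.
  by apply: eq_bigr => j _; rewrite rmorphM rmorphXn /= mulrAC.
apply/asboolP; exists (map_poly (@res _ _ v) Q); split.
- apply/polyOverP => j; rewrite coef_map coef_poly /=; case: ifP => _; last by rewrite rmorph0 rpred0.
  apply/asboolP; exists (ValringElt (cO j)) => //=.
  by rewrite rpred_div ?(polyOverP pM).
- apply/eqP => /polyP/(_ i); rewrite coef_map coef_poly ltnS i_n coef0 /=.
  move/eqP; rewrite res_eq0 /= divff // Defs.val1 ltxx //.
- by rewrite /root horner_map Qy rmorph0.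
Qed.

(** If the value of x - a is torsion modulo the value group of K, it is the
    value of an algebraic element t. If moreover the residue of (x - a) / t is
    algebraic, it is the residue of an algebraic element u, and then a + t u
    is a better approximation of x than a. *)
Lemma best_not_valuation_algebraic (K : divringClosed F) x a :
  ~ algebraic_over K x -> (forall y : F, algebraic_over (adjoin K [set x]) y) ->
  a \in algclosure K ->
  (forall c, c \in algclosure K -> v (x - c) <= v (x - a)) ->
  ~ valuation_algebraic v (adjoin K [set x]) K.
Proof.
move=> x_trans F_alg aK amax [tors resalg].
pose Kx : divringClosed F := adjoin K [set x].
have xa0 : x - a != 0.
  by rewrite subr_eq0; apply: contra_notN x_trans => /eqP ->; apply/asboolP.
have algKx y : y \in algclosure Kx by apply/asboolP.
have [n [c [n0 cKx c0 xac]]] := algebraic_torsion xa0 (algKx _).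
have [h ch] := val_fin v c0.
have [m m0 [d dK dh]] := tors h (ex_intro2 _ _ c cKx ch).
have nm0 : (0 < n * m)%N by rewrite muln_gt0 n0.
have vd : v ((x - a) ^+ (n * m)) = v d.
  by rewrite exprM (valX_eq _ xac) (val_finX _ ch) dh.
have [t /eqP] : exists t, root ('X^(n * m) - d%:P) t.
  by apply/closed_rootP; rewrite size_XnsubC // eqSS -lt0n.
rewrite !hornerE => /eqP; rewrite subr_eq0 => /eqP td.
have t0 : t != 0.
  apply: contraTneq xa0 => t0; have := vd.
  rewrite -td t0 expr0n gtn_eqF //= val0 => /eqP.
  by rewrite val_eqPInf expf_eq0 => /andP[_ ->].
have tK : t \in algclosure K.
  apply: (@root_algebraic _ _ ('X^(n * m) - d%:P)).
  - by rewrite rpredB ?polyOverXn ?polyOverC.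
  - by rewrite monic_neq0 ?monicXnsubC.
  - by rewrite /root !hornerE td subrr.
have vt : v (x - a) = v t by apply: (valX_inj nm0 t0); rewrite vd td.
have yO : (x - a) / t \in valring v.
  by rewrite inE (valM_eq vt (erefl (v t^-1))) divff // Defs.val1.
pose y := ValringElt yO.
have yA : res y \in algclosure (residues v Kx) by apply: algebraic_residue.
have [|u uK yu] := @residue_lift K y.
  apply: (algclosure_trans _ (minp_neq0 yA) (minp_root yA)).
  by apply: polyOver_sub (minp_over yA) => r /resalg ?; apply/asboolP.
have := amax (a + t * u); rewrite rpredD ?rpredM // => /(_ isT).
rewrite leNgt => /negP; apply; rewrite vt.
have -> : x - (a + t * u) = (val y - u) * t.
  by rewrite mulrBl divfK // opprD addrA [u * t]mulrC.
by rewrite -[t in ltLHS]mul1r valM_lt // Defs.val1.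
Qed.

End ValuationAlgebraic.

(** * Key polynomials *)

Section Delta.
Variables (F : closedFieldType) (G : orderedGroupType) (v : valuation F G).
Implicit Types (f : {poly F}) (y z : F).

Lemma mem_root_seq f z : f != 0 -> (z \in root_seq f) = root f z.
Proof.
move=> f0; rewrite /root_seq (negPf f0).
by case: closed_field_poly_normal => r /= fr; rewrite -(root_split f0 fr).
Qed.

Lemma delta_ge y f z : f != 0 -> root f z -> v (y - z) <= delta v y f.
Proof.
move=> f0; rewrite -mem_root_seq // /delta.
elim: (root_seq f) => // t r IH; rewrite big_cons in_cons le_max.
by case/predU1P => [->|/IH ->]; rewrite ?lexx ?orbT.
Qed.

Lemma delta_lt y f (g : vext G) : NInf < g ->
  (forall z, f != 0 -> root f z -> v (y - z) < g) -> delta v y f < g.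
Proof.
move=> g0 H; have [f0|f0] := eqVneq f 0.
  by rewrite /delta /root_seq f0 eqxx big_nil.
have {}H : {in root_seq f, forall z, v (y - z) < g}.
  by move=> z; rewrite mem_root_seq // => /(H z f0).
rewrite /delta; elim: (root_seq f) H => [|t r IH] H; first by rewrite big_nil.
rewrite big_cons gt_max H ?mem_head //= IH // => s sr.
by apply: H; rewrite in_cons sr orbT.
Qed.

Lemma delta_attained y f : (1 < size f)%N ->
  exists2 z, root f z & delta v y f = v (y - z).
Proof.
move=> f1; have f0 : f != 0 by rewrite -size_poly_gt0 ltnW.
have [z0 z0f] : exists z, root f z by apply/closed_rootP; rewrite gtn_eqF.
have [z zf zmax] : exists2 z, z \in root_seq f & {in root_seq f, forall t, v (y - t) <= v (y - z)}.
  move: z0f; rewrite -mem_root_seq //; elim: (root_seq f) (z0) => // t [|u r] IH z1 _.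
    by exists t; rewrite ?mem_head // => s; rewrite inE => /eqP ->.
  have [z zr H] := IH u (mem_head _ _).
  have [le|lt] := leP (v (y - t)) (v (y - z)).
    exists z; first by rewrite in_cons zr orbT.
    by move=> s; rewrite in_cons => /predU1P[->|/H].
  exists t; first exact: mem_head.
  move=> s; rewrite in_cons => /predU1P[->//|/H] sz.
  exact: le_trans sz (ltW lt).
exists z; first by rewrite -mem_root_seq.
apply/eqP; rewrite eq_le delta_ge -?mem_root_seq // andbT.
rewrite /delta; elim: (root_seq f) {zf} zmax => [|t r IH] H.
  by rewrite big_nil.
rewrite big_cons ge_max H ?mem_head //= IH // => s sr.
by apply: H; rewrite in_cons sr orbT.
Qed.

Variables (K : divringClosed F) (x : F).
Hypothesis K_tame : tame_field v K.
Hypothesis x_trans : ~ algebraic_over K x.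
Hypothesis F_alg : forall y : F, algebraic_over (adjoin K [set x]) y.

(** The other roots are at distance less than v(y - a) from a by
    [min_degree_isolated]. *)
Lemma max_root_minp y a : min_degree_near v K y a ->
  unique (maximal_root v y (minp K a)) a.
Proof.
move=> Hya; have [aK _] := Hya.
have small z : root (minp K a) z -> z != a -> v (y - z) < v (y - a).
  move=> za zna; have az := min_degree_isolated K_tame x_trans F_alg Hya za zna.
  have {}az : v (a - z) < v (a - y) by rewrite [ltRHS]valBC.
  by rewrite (dist_eq az) [ltRHS]valBC.
have dE : delta v y (minp K a) = v (y - a).
  have [z za dz] := delta_attained y (minp_size_gt1 aK).
  have := delta_ge y (minp_neq0 aK) (minp_root aK); rewrite dz.
  by have [->//|/(small z za)] := eqVneq z a; rewrite ltNge => /negPf ->.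
split; first by split => //; apply: minp_root.
move=> z [za dz]; apply/eqP; apply: contraT; rewrite eq_sym => /(small z za).
by rewrite -dz dE ltxx.
Qed.

(** The roots of a polynomial of smaller degree have smaller degree than a, so
    they are farther from y. *)
Lemma key_minp y a : min_degree_near v K y a -> key_polynomial v K y (minp K a).
Proof.
move=> Hya; have [aK amin] := Hya; have [[_ dE] _] := max_root_minp Hya.
split; [exact: minp_over | exact: minp_monic | move=> f fK sf].
rewrite dE; apply: delta_lt; first exact: val_gtNInf.
move=> z f0 fz; have zK := root_algebraic fK f0 fz; apply: amin => //.
by apply: leq_trans (adeg_le_root zK fK f0 fz) _; rewrite -ltnS -size_minp.
Qed.

(** It is enough to look at maximal roots: a root c of f has at most the
    degree of f. *)
Lemma complete_minp y (P : set {poly F}) :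
  (forall Q, P Q -> exists2 a, min_degree_near v K y a & Q = minp K a) ->
  (forall c, c \in algclosure K -> exists a, [/\ a \in algclosure K, P (minp K a),
     (adeg K a <= adeg K c)%N & v (y - c) <= v (y - a)]) ->
  complete_key_polynomials v K y P.
Proof.
move=> PK Pc; split; first by move=> Q /PK[a Hya ->]; apply: key_minp.
move=> f fK f1; have f0 : f != 0 by rewrite -size_poly_gt0 ltnW.
have [c fc ->] := delta_attained y f1.
have cK := root_algebraic fK f0 fc.
have [a [aK Pa ac vac]] := Pc c cK.
exists (minp K a); split => //.
  apply: leq_trans (minp_size_le cK fK f0 fc).
  by rewrite (size_minp aK) (size_minp cK) ltnS.
by apply: le_trans vac _; apply: delta_ge; [apply: minp_neq0 | apply: minp_root].
Qed.

(** Values and residues of K(x) are then those of algebraic elements, hence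
    torsion and algebraic over those of K. *)
Lemma immediate_valuation_algebraic (L : divringClosed F) :
  {subset K <= L} -> {subset L <= algclosure K} ->
  immediate v (adjoin L [set x]) L -> valuation_algebraic v (adjoin K [set x]) K.
Proof.
move=> KL LK [vLx rLx].
have KxLx : {subset adjoin K [set x] <= adjoin L [set x]}.
  apply: adjoin1_min; last exact: adjoin1_gen.
  by move=> a /KL; apply: adjoin_subset.
split=> [g [a aKx ag]|r /asboolP[a aKx ->]].
  have : value_group v L g by rewrite -vLx; exists a => //; apply: KxLx.
  move=> [b bL bg]; have b0 : b != 0 by rewrite -(val_ltPInf v) bg.
  have [n [n0 _ [d [dK _ vd]]]] := tame_torsion K_tame (LK _ bL) b0.
  by exists n => //; exists d; rewrite // -vd (val_finX _ bg).
have : res a \in residues v L by rewrite -rLx; apply/asboolP; exists a => //; apply: KxLx.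
move=> /asboolP[b bL ->].
have bK := LK _ bL.
pose Kb : divringClosed F := adjoin K [set val b].
have KKb : {subset K <= Kb} by apply: adjoin_subset.
have KbK : {subset Kb <= algclosure K}.
  by apply: adjoin1_min => // e; apply: mem_algclosure.
have [_ [_ _ _ T]] := K_tame.
have [e [f [_ _ _ sep _]]] := T Kb _ KKb KbK (has_degree_adjoin bK).
have [|p [[pK p1 _] _ pb]] := sep (res b).
  by apply/asboolP; exists b => //; apply: adjoin1_gen.
by exists p; split => //; rewrite -size_poly_gt0 ltnW.
Qed.

End Delta.

(** * Well-ordered cofinal sets *)

Section SubOrder.
Variables (d : Order.disp_t) (T : orderType d) (W : pred T).
(** The order induced on a subset, which is used to turn a subset of the
    values into an index set. *)
Record sub_order := SubOrder { sub_order_val : T; _ : W sub_order_val }.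
HB.instance Definition _ := [isSub for sub_order_val].
HB.instance Definition _ := [Choice of sub_order by <:].
HB.instance Definition _ := [SubChoice_isSubOrder of sub_order by <: with d].
End SubOrder.

Section Cofinal.
Variables (d : Order.disp_t) (T : orderType d).
Local Open Scope order_scope.

(** Well-order T by a relation R and keep the elements of A that are larger
    than all their R-predecessors in A. On these the two orders agree, and the
    R-least element of A above a given one is among them. *)
Lemma well_ordered_cofinal (A : T -> Prop) : (exists g, A g) ->
  (forall g, A g -> exists2 h, A h & g < h) ->
  exists (Omega : orderType d) (u : Omega -> T),
    [/\ limit_order Omega, inhabited Omega, forall i, A (u i),
        forall i j, (u i < u j) = (i < j) &
        forall g, A g -> exists i, g < u i].
Proof.
move=> [g0 Ag0] nomax.
have [R Rwo] := well_ordering_principle T.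
have Rmin (P : T -> Prop) : (exists g, P g) -> exists2 g, P g & forall h, P h -> R g h.
  move=> [g Pg]; have [|m [[mP mmin] _]] := Rwo [pred h | `[< P h >]].
    by exists g; apply/asboolP.
  exists m; first by move: mP => /asboolP.
  by move=> h Ph; apply: mmin; apply/asboolP.
have Rch : wo_chain R predT by apply: withinW.
have Rtot g h : R g h || R h g by apply: (wo_chainW Rch).
have Ranti g h : R g h -> R h g -> g = h.
  by move=> gh hg; apply: (wo_chain_antisymmetric Rch) => //; rewrite gh.
pose W : pred T := fun g => `[< A g /\ forall h, A h -> R h g -> h <= g >].
have WA g : W g -> A g by move=> /asboolP[].
have Wcof g : A g -> exists2 h, W h & g < h.
  move=> Ag; have [|h [Ah gh] hmin] := Rmin (fun h => A h /\ g < h).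
    by have [h Ah gh] := nomax g Ag; exists h.
  exists h => //; apply/asboolP; split=> // k Ak kh; rewrite leNgt; apply/negP => hk.
  have hkR : R h k by apply: hmin; split => //; apply: lt_trans hk.
  by rewrite (Ranti _ _ kh hkR) ltxx in hk.
pose Omega : orderType d := sub_order W.
pose u (i : Omega) : T := val i.
have uW i : W (u i) by apply: (valP i).
have Omega_lt (i j : Omega) : (u i < u j) = (i < j) by [].
have ROmega (i j : Omega) : R (u i) (u j) -> i <= j.
  by move=> Rij; have /asboolP[_ H] := uW j; apply: H => //; apply: WA.
exists Omega, u; split => //.
- split; last first.
    move=> i; have [h Wh ih] := Wcof _ (WA _ (uW i)).
    by exists (SubOrder Wh).
  apply: antisymmetric_well_order; first exact: le_anti.
  move=> P [i0 Pi0].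
  have [|g [i ig Pi] gmin] := Rmin (fun g => exists2 i, u i = g & i \in P).
    by exists (u i0), i0.
  exists i; split => // j Pj; apply: ROmega; rewrite ig; apply: gmin.
  by exists j.
- by have [h Wh _] := Wcof _ Ag0; exists; exact: (SubOrder Wh).
- by move=> i; apply: WA.
by move=> g /Wcof[h Wh gh]; exists (SubOrder Wh).
Qed.

Lemma empty_limit_order : limit_order 'I_0.
Proof. by split=> [P [] []|[]]. Qed.

End Cofinal.

(** * The approximating sequence *)

Section PseudoCauchySequences.
Variables (F : closedFieldType) (G : orderedGroupType) (v : valuation F G) (x : F).
Context {d : Order.disp_t} {I : orderType d}.
Variable z : I -> F.
Hypothesis z_incr : forall i j, (i < j)%O -> v (x - z i) < v (x - z j).

Lemma approaching_dist i j : (i < j)%O -> v (z j - z i) = v (x - z i).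
Proof. by move=> /z_incr; apply: dist_eq. Qed.

Lemma approaching_pseudo_cauchy (E : {pred F}) : (forall i, z i \in E) ->
  pseudo_cauchy v E z.
Proof.
by move=> zE; split=> // r s t rs st; rewrite !approaching_dist // z_incr.
Qed.

Lemma approaching_pseudo_limit : pseudo_limit v z x.
Proof. by move=> i j [ij _]; rewrite approaching_dist. Qed.

(** Beyond some index, z approximates x better than every root of f does, and
    then the distances of the terms to the roots are those of x. *)
Lemma approaching_transcendental (K E : divringClosed F) :
  {subset E <= algclosure K} ->
  (forall c, c \in algclosure K -> exists i, v (x - c) < v (x - z i)) ->
  transcendental_type v E z.
Proof.
move=> EK zcof f fE; have [i0 _] := zcof 0 (rpred0 _).
have [->|f0] := eqVneq f 0; first by exists i0 => j _; rewrite !horner0.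
have [r fr] := poly_splits f.
have [|t tr|_ [i ->] H] := @common_improvement _ _ v (fun c => exists i, c = z i) x (z i0) r.
- by exists i0.
- have tf : root f t by rewrite -[root _ _]/(t \in root f) (root_split f0 fr).
  have [|i xi] := zcof t; last by exists (z i) => //; exists i.
  by apply: (algclosure_trans _ f0 tf); apply: polyOver_sub fE.
exists i => j ij; apply: val_horner_eq => // t tf.
have xt : v (x - t) < v (x - z i) by apply: H; rewrite -(root_split f0 fr).
have xt' : v (x - t) < v (x - z j).
  by move: ij; rewrite le_eqVlt => /predU1P[<-//|/z_incr]; apply: lt_trans.
by rewrite (dist_eq xt) (dist_eq xt').
Qed.
End PseudoCauchySequences.

Section Sequence.
Variables (F : closedFieldType) (G : orderedGroupType) (v : valuation F G).
Variables (K : divringClosed F) (x : F).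
Hypothesis K_tame : tame_field v K.
Hypothesis x_trans : ~ algebraic_over K x.
Hypothesis F_alg : forall y : F, algebraic_over (adjoin K [set x]) y.

Local Notation Kt := (algclosure K).
Local Notation deg := (adeg K).
Local Notation near := (min_degree_near v K).

(** The elements a and those farther from x than a have the same distances to
    b as to x. *)
Lemma near_transfer a b : near x a -> v (x - a) < v (x - b) -> near b a.
Proof.
move=> [aK amin] ab; split=> // c cK ca; have xc := amin c cK ca.
by rewrite (dist_eq ab) (dist_eq (lt_trans xc ab)).
Qed.

Lemma near_self a : a \in Kt -> near a a.
Proof.
move=> aK; split=> // c cK ca; rewrite subrr val0 val_ltPInf subr_eq0.
by apply: contraTneq ca => ->; rewrite ltnn.
Qed.

Lemma adjoin_algebraic a : a \in Kt -> {subset adjoin K [set a] <= Kt}.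
Proof. by move=> aK; apply: adjoin1_min => // b; apply: mem_algclosure. Qed.

(** For c of degree at most deg a, improvements of degree at most deg a which
    are better than a belong to K(a) by [krasner]. If a general c were as
    close to x as all elements of K(a), then the distances from c to K(a)
    would be those from x, which have no maximum; this contradicts [tame_max].
    *)
Lemma adjoin_cofinal a : near x a ->
  (forall c, c \in Kt -> (deg c <= deg a)%N ->
     exists c', [/\ c' \in Kt, (deg c' <= deg a)%N & v (x - c) < v (x - c')]) ->
  forall c, c \in Kt -> exists2 e, e \in adjoin K [set a] & v (x - c) < v (x - e).
Proof.
move=> Hxa nomax; have [aK _] := Hxa.
have small c : c \in Kt -> (deg c <= deg a)%N ->
    exists2 e, e \in adjoin K [set a] & v (x - c) < v (x - e).
  move=> cK ca.
  have [m [mK ma am cm]] : exists m, [/\ m \in Kt, (deg m <= deg a)%N,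
      v (x - a) <= v (x - m) & v (x - c) <= v (x - m)].
    have [le|lt] := leP (v (x - a)) (v (x - c)); first by exists c.
    by exists a; split => //; apply: ltW.
  have [e [eK ea me]] := nomax m mK ma.
  exists e; last exact: le_lt_trans me.
  apply: adeg_eq => //; apply: (krasner K_tame x_trans F_alg eK).
  by apply: near_transfer => //; apply: le_lt_trans me.
pose Ka : divringClosed F := adjoin K [set a].
have KKa : {subset K <= Ka} by apply: adjoin_subset.
have KaK := adjoin_algebraic aK.
move=> c cK; apply: contrapT => noe.
have le e : e \in Ka -> v (x - e) <= v (x - c).
  by move=> eKa; rewrite leNgt; apply/negP => lt; apply: noe; exists e.
have smallKa e : e \in Ka -> exists2 e', e' \in Ka & v (x - e) < v (x - e').
  by move=> eKa; apply: small; [apply: KaK | apply: adeg_le].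
have dist e : e \in Ka -> v (c - e) = v (x - e).
  move=> eKa; have [e' e'Ka ee'] := smallKa e eKa.
  by apply: dist_eq; apply: lt_le_trans ee' (le e' e'Ka).
have [e eKa emax] := tame_max K_tame KKa KaK (has_degree_adjoin aK) cK.
have [e' e'Ka ee'] := smallKa e eKa.
by have := emax e' e'Ka; rewrite !dist // leNgt ee'.
Qed.

Definition best a := a \in Kt /\
  forall c, c \in Kt -> (deg c <= deg a)%N -> v (x - c) <= v (x - a).
Definition improvable a := exists2 b, b \in Kt & v (x - a) < v (x - b).
(** An element of this kind need not be the best of its degree, since there
    may be no best one. *)
Definition next a b := [/\ b \in Kt, v (x - a) < v (x - b) &
  forall c, c \in Kt -> v (x - a) < v (x - c) -> (deg b <= deg c)%N].

Lemma next_exists a : improvable a -> exists b, next a b.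
Proof.
move=> [b0 b0K ab0].
pose P n := `[< exists b, [/\ b \in Kt, v (x - a) < v (x - b) & deg b = n] >].
have exP : exists n, P n by exists (deg b0); apply/asboolP; exists b0.
case: (ex_minnP exP) => n /asboolP[b [bK ab <-]] nmin.
by exists b; split => // c cK ac; apply: nmin; apply/asboolP; exists c.
Qed.

Lemma step_exists a : exists b, improvable a ->
  next a b /\ ((exists2 b', next a b' & best b') -> best b).
Proof.
have [ia|nia] := pselect (improvable a); last by exists a.
have [[b nb bb]|no] := pselect (exists2 b', next a b' & best b').
  by exists b.
by have [b nb] := next_exists ia; exists b.
Qed.

Lemma start_exists : exists a, a \in K /\ ((exists2 b, b \in K & best b) -> best a).
Proof.
have [[b bK bb]|no] := pselect (exists2 b, b \in K & best b); first by exists b.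
by exists 0; split; first exact: rpred0.
Qed.

Definition step a := sval (cid (step_exists a)).
(** The sequence starts at index 1; the value at 0, which is that at 1, is a
    junk value. A best element is chosen at each step if there is one. *)
Definition approx i := iter i.-1 step (sval (cid start_exists)).
Local Notation a := approx.

Lemma step_next b : improvable b -> next b (step b).
Proof. by rewrite /step; case: cid => c /= H /H[]. Qed.

Lemma step_best b c : improvable b -> next b c -> best c -> best (step b).
Proof. by rewrite /step; case: cid => e /= H /H[_ H'] nc bc; apply: H'; exists c. Qed.

Lemma approx1_mem : a 1 \in K.
Proof. by rewrite /a /=; case: cid => b /= []. Qed.

Lemma approx1_best b : b \in K -> best b -> best (a 1).
Proof. by rewrite /a /=; case: cid => c /= [_ H] bK bb; apply: H; exists b. Qed.

Definition continues i := best (a i) /\ improvable (a i).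
(** The approximation stops at a term that cannot be improved, and also where
    a degree has no best approximation, because a transfinite sequence in this
    degree has to take over there. *)
Definition indices : set nat := [set i | (0 < i)%N /\ forall j, (0 < j < i)%N -> continues j].
Local Notation S := indices.

Lemma indices_gt0 i : S i -> (0 < i)%N. Proof. by case. Qed.

Lemma indices_le i j : S i -> (0 < j)%N -> (j <= i)%N -> S j.
Proof.
move=> [_ Si] j0 ji; split=> // k /andP[k0 kj]; apply: Si.
by rewrite k0 (leq_trans kj).
Qed.

Lemma indices_continues i j : S i -> (0 < j)%N -> (j < i)%N -> continues j.
Proof. by move=> [_ Si] j0 ji; apply: Si; rewrite j0. Qed.

Lemma indices_cases : S = posnat \/ exists n, [/\ (0 < n)%N, S = upto n, S n & ~ continues n].
Proof.
have [all|] := pselect (forall i, (0 < i)%N -> continues i).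
  left; apply/seteqP; split=> i [] // i0; split=> // j /andP[j0 _]; exact: all.
move=> /existsNP[i0 /not_implyP[i00 ni0]]; right.
pose P n := (0 < n)%N && ~~ `[< continues n >].
have exP : exists n, P n by exists i0; rewrite /P i00; apply/asboolP.
case: (ex_minnP exP) => n /andP[n0 /asboolP nn] nmin.
have Sn : S n.
  split=> // j /andP[j0 jn]; apply: contrapT => nj.
  by have := nmin j; rewrite /P j0 leqNgt jn => H; have := H (introN (asboolP _) nj).
exists n; split => //; apply/seteqP; split=> i.
  move=> Si; rewrite /upto /= (indices_gt0 Si) leqNgt; apply/negP => ni.
  by apply: nn; apply: indices_continues ni.
by move=> /andP[i_gt0 i_n]; apply: indices_le i_gt0 i_n.
Qed.

Lemma approx_next i : (0 < i)%N -> S i.+1 -> next (a i) (a i.+1).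
Proof.
case: i => // i _ Si; have [_ imp] := indices_continues Si (ltn0Sn _) (ltnSn _).
exact: step_next.
Qed.

(** An element of smaller degree than c does not improve on b. *)
Lemma near_next b c : best b -> next b c -> near x c.
Proof.
move=> [bK bbest] [cK bc cmin]; split=> // e eK ec.
apply: le_lt_trans bc; rewrite leNgt; apply/negP => be.
by have := cmin e eK be; rewrite leqNgt ec.
Qed.

Lemma approx_near i : S i -> near x (a i).
Proof.
case: i => [[]//|[_|i Si]].
  have aK : a 1 \in Kt by apply: mem_algclosure; apply: approx1_mem.
  split=> // c cK; rewrite (adeg_mem approx1_mem) ltnS leqn0 => /eqP c0.
  by have := adeg_gt0 cK; rewrite c0.
have [b imp] := indices_continues Si (ltn0Sn i) (ltnSn _).
by apply: near_next b _; apply: approx_next.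
Qed.

Lemma approx_alg i : S i -> a i \in Kt. Proof. by case/approx_near. Qed.

Lemma approx_step i : (0 < i)%N -> S i.+1 ->
  v (x - a i) < v (x - a i.+1) /\ (deg (a i) < deg (a i.+1))%N.
Proof.
move=> i0 Si; have [aK lt _] := approx_next i0 Si; split=> //.
have [[_ b] _] := indices_continues Si i0 (ltnSn _).
by rewrite ltnNge; apply/negP => /(b _ aK); rewrite leNgt lt.
Qed.

Lemma approx_mono i j : S j -> (0 < i)%N -> (i < j)%N ->
  v (x - a i) < v (x - a j) /\ (deg (a i) < deg (a j))%N.
Proof.
move=> Sj i0; elim: j Sj => // j IH Sj; rewrite ltnS leq_eqVlt.
case/predU1P => [ij|ij]; first by rewrite -ij in Sj *; apply: approx_step.
have j0 : (0 < j)%N by apply: leq_ltn_trans ij.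
have [vj dj] := approx_step j0 Sj; have [vi di] := IH (indices_le Sj j0 (leqnSn _)) ij.
by split; [apply: lt_trans vj | apply: ltn_trans dj].
Qed.

(** The earlier term is of minimal degree near x, hence also near the later
    one, and [krasner] applies. *)
Lemma approx_adjoin i j : S j -> (0 < i)%N -> (i <= j)%N -> a i \in adjoin K [set a j].
Proof.
move=> Sj i0; rewrite leq_eqVlt => /predU1P[->|ij]; first exact: adjoin1_gen.
apply: (krasner K_tame x_trans F_alg (approx_alg Sj)); apply: near_transfer.
  by apply/approx_near/(indices_le Sj) => //; apply: ltnW.
by have [] := approx_mono Sj i0 ij.
Qed.

(** The degree of c is between those of two consecutive terms; as the second
    of them has the least degree of an improvement of the first, c is not an
    improvement. *)
Lemma approx_locate k c : S k -> c \in Kt -> (deg c < deg (a k))%N ->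
  exists i, [/\ (0 < i)%N, (i < k)%N, (deg (a i) <= deg c)%N & v (x - c) <= v (x - a i)].
Proof.
elim: k => [[]//|k IH] Sk cK ck.
have k0 : (0 < k)%N.
  case: k Sk ck {IH} => // _; rewrite (adeg_mem approx1_mem) ltnS leqn0 => /eqP c0.
  by have := adeg_gt0 cK; rewrite c0.
have [lt|le] := ltnP (deg c) (deg (a k)).
  have [i [i0 ik di vi]] := IH (indices_le Sk k0 (leqnSn _)) cK lt.
  by exists i; split => //; apply: ltnW.
exists k; split => //; rewrite leNgt; apply/negP => lt.
have [_ _ m] := approx_next k0 Sk.
by have := m c cK lt; rewrite leqNgt ck.
Qed.

(** A best approximation of degree at most deg (a n) would be a candidate at
    step n, and the choice made there prefers best approximations. *)
Lemma last_not_best n c : S n -> ~ best (a n) -> c \in Kt -> (deg c <= deg (a n))%N ->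
  exists c', [/\ c' \in Kt, (deg c' <= deg (a n))%N & v (x - c) < v (x - c')].
Proof.
move=> Sn nb cK cn; apply: contrapT => noc.
have cmax c' : c' \in Kt -> (deg c' <= deg (a n))%N -> v (x - c') <= v (x - c).
  by move=> c'K c'n; rewrite leNgt; apply/negP => lt; apply: noc; exists c'.
have bc : best c by split=> // e eK ec; apply: cmax => //; apply: leq_trans cn.
apply: nb; case: n Sn cn cmax {noc} => [[]//|[_|n Sn]] cn cmax.
  apply: (approx1_best _ bc); apply: adeg1 => //; apply/eqP.
  by rewrite eqn_leq adeg_gt0 // andbT; move: cn; rewrite (adeg_mem approx1_mem).
have [_ imp] := indices_continues Sn (ltn0Sn n) (ltnSn _).
have [aK lt amin] := approx_next (ltn0Sn n) Sn.
apply: (step_best imp _ bc); split=> //.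
  by apply: lt_le_trans lt _; apply: cmax.
by move=> e eK /(amin e eK); apply: leq_trans.
Qed.

End Sequence.

(** * The field of implicit constants *)

Section Assembly.
Variables (F : closedFieldType) (G : orderedGroupType) (v : valuation F G).
Variables (K : divringClosed F) (x : F).
Hypothesis K_tame : tame_field v K.
Hypothesis x_trans : ~ algebraic_over K x.
Hypothesis F_alg : forall y : F, algebraic_over (adjoin K [set x]) y.

Local Notation Kt := (algclosure K).
Local Notation deg := (adeg K).
Local Notation near := (min_degree_near v K).
Local Notation a := (approx v K x).
Local Notation S := (indices v K x).

(** What has to be added after a last term: nothing if it is the best
    approximation of x among all algebraic elements, and otherwise a sequence
    in K(a n) which approaches x arbitrarily well. *)
Definition completing_tail d (Omega : orderType d) (z : Omega -> F) :=
  [/\ limit_order Omega,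
      forall nu, near x (z nu),
      forall i j, (i < j)%O -> v (x - z i) < v (x - z j),
      inhabited Omega -> exists n, [/\ (0 < n)%N, S = upto n,
        forall nu, z nu \in adjoin K [set a n] /\ deg (z nu) = deg (a n) &
        forall c, c \in Kt -> exists nu, v (x - c) < v (x - z nu)] &
      forall n, (0 < n)%N -> S = upto n -> ~ inhabited Omega ->
        best v K x (a n) /\ ~ improvable v K x (a n)].

Lemma upto_inj n m : (0 < n)%N -> (0 < m)%N -> upto n = upto m -> n = m.
Proof.
move=> n0 m0 nm; have nn : upto n n by rewrite /upto /= n0 leqnn.
have mm : upto m m by rewrite /upto /= m0 leqnn.
rewrite nm in nn; rewrite -nm in mm.
move: nn mm => /andP[_ n_m] /andP[_ m_n].
by apply/eqP; rewrite eqn_leq n_m.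
Qed.

Lemma posnat_neq_upto n : posnat <> upto n.
Proof.
move=> E; have : posnat n.+1 by [].
by rewrite E /upto /= ltnn.
Qed.

(** If the last term is not a best approximation for its degree, then there is
    none in this degree, and [adjoin_cofinal] applies. The index set is a
    well-ordered cofinal set of distances from x to K(a n). *)
Lemma completing_tail_exists : exists d (Omega : orderType d) (z : Omega -> F),
  completing_tail z.
Proof.
have no0 : ~ inhabited 'I_0 by case=> -[].
have [Sp|[n [n0 Sn Snn nc]]] := indices_cases v K x.
  exists _, 'I_0, (fun=> 0); split; [exact: empty_limit_order|by case|by case|by []|].
  by move=> m _ Sm; have := @posnat_neq_upto m; rewrite -Sp -Sm.
have [bn|nbn] := pselect (best v K x (a n)).
  exists _, 'I_0, (fun=> 0); split; [exact: empty_limit_order|by case|by case|by []|].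
  move=> m m0 Sm _; rewrite (upto_inj m0 n0 (etrans (esym Sm) Sn)).
  by split=> // imp; apply: nc.
have near_n := @approx_near _ _ v K x n Snn.
have aK : a n \in algclosure K by case: near_n.
have nomax := last_not_best Snn nbn.
have cof := adjoin_cofinal K_tame x_trans F_alg near_n (@nomax).
pose A g := exists c, [/\ c \in adjoin K [set a n], v (x - a n) < v (x - c) & g = v (x - c)].
have better c : c \in algclosure K -> exists2 g, A g & v (x - c) < g.
  move=> cK; have [m [mK am cm]] : exists m, [/\ m \in algclosure K,
      v (x - a n) <= v (x - m) & v (x - c) <= v (x - m)].
    have [le|lt] := leP (v (x - a n)) (v (x - c)); first by exists c.
    by exists (a n); split => //; apply: ltW.
  have [e eK me] := cof m mK; exists (v (x - e)); last exact: le_lt_trans me.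
  by exists e; split => //; apply: le_lt_trans me.
have [|g [c [cK ac ->]]|Omega [u [Ol Oi uA uinc ucof]]] := @well_ordered_cofinal _ (vext G) A.
- by have [g Ag _] := better _ aK; exists g.
- exact/better/(adjoin_algebraic aK).
have /choice[z zP] (nu : Omega) := uA nu.
have zuE nu : v (x - z nu) = u nu by have [_ _ ->] := zP nu.
have dz nu : adeg K (z nu) = adeg K (a n) /\ min_degree_near v K x (z nu).
  have [zK az _] := zP nu; have zA := adjoin_algebraic aK zK.
  have [_ amin] := near_n.
  have le := adeg_le aK zK.
  have ge : (adeg K (a n) <= adeg K (z nu))%N.
    by rewrite leqNgt; apply/negP => /(amin _ zA); rewrite ltNge (ltW az).
  have dE : adeg K (z nu) = adeg K (a n) by apply/eqP; rewrite eqn_leq le.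
  split=> //; split=> // c cK; rewrite dE => /(amin c cK) xc.
  exact: lt_trans az.
exists _, Omega, z; split=> //.
- by move=> nu; have [] := dz nu.
- by move=> i j ij; rewrite !zuE uinc.
- move=> _; exists n; split=> //.
    by move=> nu; split; [have [] := zP nu | have [] := dz nu].
  move=> c cK; have [g Ag cg] := better c cK; have [nu gnu] := ucof g Ag.
  by exists nu; rewrite zuE; apply: lt_trans gnu.
Qed.

Section Tail.
Variables (d : Order.disp_t) (Omega : orderType d) (z : Omega -> F).
Hypothesis z_tail : completing_tail z.
Let z_near : forall nu, near x (z nu). Proof. by case: z_tail. Qed.
Let z_incr : forall i j, (i < j)%O -> v (x - z i) < v (x - z j).
Proof. by case: z_tail. Qed.
Let tail_last : inhabited Omega -> exists n, [/\ (0 < n)%N, S = upto n,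
  forall nu, z nu \in adjoin K [set a n] /\ deg (z nu) = deg (a n) &
  forall c, c \in Kt -> exists nu, v (x - c) < v (x - z nu)].
Proof. by case: z_tail. Qed.
Let tail_final : forall n, (0 < n)%N -> S = upto n -> ~ inhabited Omega ->
  best v K x (a n) /\ ~ improvable v K x (a n).
Proof. by case: z_tail. Qed.

Lemma approx_infinite c : S = posnat -> c \in Kt -> exists i, [/\ (0 < i)%N,
  (deg (a i) <= deg c)%N, v (x - c) <= v (x - a i) & v (x - c) < v (x - a i.+1)].
Proof.
move=> Sp cK.
have dk k : (k < deg (a k.+1))%N.
  elim: k => [|k IH]; first by rewrite adeg_gt0 // approx_alg // Sp.
  by apply: leq_ltn_trans IH _; have [] := @approx_step _ _ v K x k.+1; rewrite ?Sp.
have [|i [i0 ik di vi]] := @approx_locate _ _ v K x (deg c).+1 c _ cK (dk _).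
  by rewrite Sp.
exists i; split => //; apply: le_lt_trans vi _.
by have [] := @approx_step _ _ v K x i i0; rewrite ?Sp.
Qed.

(** The terms of both families together approximate x at least as well as any
    algebraic element, without exceeding its degree. This is the completeness
    of the associated key polynomials. *)
Lemma approx_cover c : c \in Kt ->
  (exists2 i, S i & (deg (a i) <= deg c)%N /\ v (x - c) <= v (x - a i)) \/
  (exists nu, (deg (z nu) <= deg c)%N /\ v (x - c) < v (x - z nu)).
Proof.
move=> cK; have [Sp|[n [n0 Sn Snn _]]] := indices_cases v K x.
  by have [i [i0 di vi _]] := approx_infinite Sp cK; left; exists i; rewrite ?Sp.
have [lt|le] := ltnP (deg c) (deg (a n)).
  have [i [i0 ik di vi]] := approx_locate Snn cK lt.
  by left; exists i => //; apply: indices_le Snn i0 (ltnW ik).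
have [Oi|nOi] := pselect (inhabited Omega).
  have [m [m0 Sm zm zcof]] := tail_last Oi.
  have mn : m = n.
    have : S m by rewrite Sm /upto /= m0 leqnn.
    have : S n by [].
    by rewrite {1}Sm Sn => /andP[_ nm] /andP[_ mn]; apply/eqP; rewrite eqn_leq mn.
  have [nu lt] := zcof c cK; right; exists nu; split => //.
  by have [_ ->] := zm nu; rewrite mn.
have [_ nimp] := tail_final n0 Sn nOi.
left; exists n => //; split => //; rewrite leNgt; apply/negP => lt.
by apply: nimp; exists c.
Qed.

Definition constants : divringClosed F := adjoin K [set a i | i in S].
Local Notation L' := constants.

Lemma constants_sub : {subset K <= L'}. Proof. exact: adjoin_subset. Qed.

Lemma approx_constants i : S i -> a i \in L'.
Proof. by move=> Si; apply: adjoin_gen; exists i. Qed.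

Lemma constants_algebraic : {subset L' <= Kt}.
Proof.
apply: adjoin_min; first exact: mem_algclosure.
by move=> _ [i Si <-]; apply: approx_alg.
Qed.

(** The fields K(a i) form an increasing chain. *)
Lemma constants_upto n : (0 < n)%N -> S = upto n -> L' =i adjoin K [set a n].
Proof.
move=> n0 Sn b; have Snn : S n by rewrite Sn /upto /= n0 leqnn.
apply/idP/idP; move: b.
  apply: adjoin_min; first exact: adjoin_subset.
  move=> _ [i Si <-]; apply: (approx_adjoin K_tame x_trans F_alg Snn).
    exact: indices_gt0 Si.
  by move: Si; rewrite Sn => /andP[].
by apply: adjoin1_min; [apply: constants_sub | apply: approx_constants].
Qed.

Lemma tail_constants nu : z nu \in L'.
Proof.
have [n [n0 Sn zn _]] := tail_last (inhabits nu).
by rewrite (constants_upto n0 Sn); have [] := zn nu.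
Qed.

Lemma constants_cover c : c \in Kt -> exists2 e, e \in L' & v (x - c) <= v (x - e).
Proof.
move=> /approx_cover[[i Si [_ ci]]|[nu [_ cnu]]].
  by exists (a i) => //; apply: approx_constants.
by exists (z nu); [apply: tail_constants | apply: ltW].
Qed.

Lemma constants_dense c : S = posnat \/ inhabited Omega -> c \in Kt ->
  exists2 e, e \in L' & v (x - c) < v (x - e).
Proof.
move=> [Sp|Oi] cK.
  by have [i [i0 _ _ lt]] := approx_infinite Sp cK; exists (a i.+1) => //; apply: approx_constants; rewrite Sp.
have [n [_ _ _ zcof]] := tail_last Oi; have [nu lt] := zcof c cK.
by exists (z nu) => //; apply: tail_constants.
Qed.

(** Each a i lies in every henselian field that contains K(x), by
    [krasner_hensel]. Conversely, a henselian field that contains L'(x)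
    contains K(x), and the elements of L' approximate x well enough for
    [henselization_trace]. *)
Lemma implicit_constantsE :
  implicit_constants v (adjoin K [set x]) K =i L'.
Proof.
move=> b; apply/andP/idP => [[bH bK]|bL].
  have := henselization_trace K_tame x_trans F_alg constants_sub constants_algebraic _ _ bK; apply.
    by apply: (approx_invariant K_tame constants_sub constants_algebraic) => c; apply: constants_cover.
  move: bH => /asboolP bH; apply/asboolP => M LM hM; apply: bH hM.
  apply: adjoin1_min; first by move=> e /constants_sub eL; apply/LM/adjoin_subset.
  by apply: LM; apply: adjoin1_gen.
split; last exact: constants_algebraic.
apply/asboolP => M KxM hM.
have KM : {subset K <= M} by move=> e eK; apply/KxM/adjoin_subset.
move: b bL; apply: adjoin_min => // _ [i Si <-].
apply: (krasner_hensel K_tame x_trans F_alg KM hM _ (approx_near Si)).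
by apply: KxM; apply: adjoin1_gen.
Qed.

Lemma constants_closure : {subset algclosure L' <= Kt}.
Proof.
move=> b bL; apply: (algclosure_trans _ (minp_neq0 bL) (minp_root bL)).
by apply: polyOver_sub (minp_over bL); apply: constants_algebraic.
Qed.

(** If the approximation does not stop, L' approximates x better than any
    algebraic element. *)
Lemma constants_immediate : S = posnat \/ inhabited Omega ->
  immediate v (adjoin L' [set x]) L'.
Proof.
move=> H; apply: dense_in_immediate; first exact: adjoin_subset.
by apply: dense_trans => c /constants_closure cK; apply: constants_dense.
Qed.

Lemma approx_increasing : S = posnat ->
  forall i j : nat, (i < j)%O -> v (x - a i.+1) < v (x - a j.+1).
Proof.
move=> Sp i j ij; have [|//|//|] := @approx_mono _ _ v K x i.+1 j.+1 _ _ _ => //.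
by rewrite Sp.
Qed.

Lemma approx_cofinal : S = posnat ->
  forall c, c \in Kt -> exists i : nat, v (x - c) < v (x - a i.+1).
Proof. by move=> Sp c cK; have [i [_ _ _ lt]] := approx_infinite Sp cK; exists i. Qed.

(** The three cases are a sequence in K(a n), the sequence of the a i, and a
    best approximation a n. *)
Lemma constants_weakly_pure : limit_order Omega -> weakly_pure v L' x.
Proof.
move=> Ol; have [Oi|nOi] := pselect (inhabited Omega).
  right; exists d, Omega, z; have [n [_ _ _ zcof]] := tail_last Oi; split => //.
  - by apply: (approaching_pseudo_cauchy z_incr); apply: tail_constants.
  - exact: (approaching_transcendental z_incr constants_algebraic zcof).
  - exact: (approaching_pseudo_limit z_incr).
have [Sp|[n [n0 Sn Snn _]]] := indices_cases v K x.
  right; exists _, nat, (fun i : nat => a i.+1); split.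
  - split; last by move=> i; exists i.+1; rewrite ltEnat /=.
    apply: wochoice.antisymmetric_well_order; first exact: le_anti.
    move=> P [i0 Pi0]; have exP : exists n, n \in P by exists i0.
    by case: (ex_minnP exP) => m Pm mmin; exists m; split.
  - exact: (inhabits 0%N).
  - by apply: (approaching_pseudo_cauchy (approx_increasing Sp)) => i; apply: approx_constants; rewrite Sp.
  - exact: (approaching_transcendental (approx_increasing Sp) constants_algebraic (approx_cofinal Sp)).
  - exact: (approaching_pseudo_limit (approx_increasing Sp)).
left; exists (a n); first exact: approx_constants.
have [_ nimp] := tail_final n0 Sn nOi.
split; first by exists (a n) => //; apply: mem_algclosure; apply: approx_constants.
move=> _ [c /constants_closure cK ->]; rewrite leNgt; apply/negP => lt.
by apply: nimp; exists c.
Qed.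

End Tail.
End Assembly.

Theorem theorem1 (F : closedFieldType) (G : orderedGroupType)
    (v : valuation F G) (K : divringClosed F) (x : F)
    (K_tame : tame_field v K)
    (x_trans : ~ algebraic_over K x)
    (F_alg : forall y : F, algebraic_over (adjoin K [set x]) y) :
  let Kx := adjoin K [set x] in
  let L := implicit_constants v Kx K in
  let Lx := adjoin L [set x] in
  exists (S : set nat) (d : Order.disp_t) (Omega : orderType d)
    (Q : nat -> {poly F}) (Qo : Omega -> {poly F})
    (a : nat -> F) (z : Omega -> F),
    initial_segment S /\
    limit_order Omega /\
    (forall i, S i -> Q i \is monic /\ irreducible_over K (Q i)) /\
    (forall nu, Qo nu \is monic /\ irreducible_over K (Qo nu)) /\
    (* (i) *)
    complete_key_polynomials v K x ([set Q i | i in S] `|` range Qo) /\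
    (* (ii) *)
    size (Q 1%N) = 2%N /\
    (* (iii) *)
    (forall i, S i -> unique (maximal_root v x (Q i)) (a i)) /\
    (forall nu, unique (maximal_root v x (Qo nu)) (z nu)) /\
    (* (iv) *)
    (forall i, (1 < i)%N -> S i ->
       [/\ {subset adjoin K [set a i.-1] <= adjoin K [set a i]},
           ~ {subset adjoin K [set a i] <= adjoin K [set a i.-1]} &
           (size (Q i.-1) < size (Q i))%N]) /\
    (* (v) *)
    (forall i, (1 < i)%N -> S i -> v (x - a i.-1) < v (x - a i)) /\
    (* (vi) *)
    (forall i, S i -> S i.+1 \/ ~ inhabited Omega ->
       is_max (distances v x (adjoin K [set a i])) (v (x - a i))) /\
    (* (vii) *)
    (forall n, (0 < n)%N -> S = upto n -> ~ inhabited Omega ->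
       is_max (distances v x (algclosure K)) (v (x - a n))) /\
    (* (viii) *)
    (inhabited Omega -> exists n,
       [/\ (0 < n)%N, S = upto n,
           pseudo_cauchy v (adjoin K [set a n]) z,
           transcendental_type v (adjoin K [set a n]) z &
           forall nu, size (Q n) = size (Qo nu)]) /\
    (* (ix) *)
    L =i adjoin K [set a i | i in S] /\
    (forall n, (0 < n)%N -> S = upto n -> L =i adjoin K [set a n]) /\
    (* (x) *)
    (forall k, S k ->
       complete_key_polynomials v K (a k) [set Q i | i in upto k]) /\
    (* the extension L(x)|L *)
    weakly_pure v L x /\
    (valuation_algebraic v Kx K <-> S = posnat \/ inhabited Omega) /\
    (S = posnat \/ inhabited Omega -> immediate v Lx L) /\
    (S = posnat ->
       [/\ pseudo_cauchy v L (fun i : nat => a i.+1),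
           transcendental_type v L (fun i : nat => a i.+1) &
           pseudo_limit v (fun i : nat => a i.+1) x]).
Proof.
have [d [Omega [z z_tail]]] := completing_tail_exists K_tame x_trans F_alg.
have [Ol z_near z_incr z_last S_final] := z_tail.
pose a := approx v K x.
pose deg := adeg K.
move=> Kx L Lx.
pose L' : divringClosed F := constants v K x.
have LE : L = L' :> {pred F}.
  by apply/funext => b; apply: (implicit_constantsE K_tame x_trans F_alg z_tail).
have KL := @constants_sub _ _ v K x.
have LK := @constants_algebraic _ _ v K x.
have S_cont i : (indices v K x) i -> (indices v K x) i.+1 -> best v K x (a i).
  by move=> Si Si1; have [] := indices_continues Si1 (indices_gt0 Si) (ltnSn _).
rewrite /Lx LE.
have zK nu : z nu \in algclosure K by case: (z_near nu).
exists (indices v K x), d, Omega, (fun i => minp K (a i)), (fun nu => minp K (z nu)), a, z.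
have prev i : (1 < i)%N -> (indices v K x) i -> (indices v K x) i.-1 /\ [/\ (0 < i.-1)%N, (i.-1 < i)%N & i.-1.+1 = i].
  by case: i => [|[|i]] // _ Si; split => //; apply: indices_le Si _ _.
split; first by have [->|[n [n0 -> _ _]]] := indices_cases v K x; [left | right; exists n].
split=> //.
split; first by move=> i Si; split; [apply: minp_monic | apply: minp_irr]; apply: approx_alg.
split; first by move=> nu; split; [apply: minp_monic | apply: minp_irr].
split.
  apply: (complete_minp K_tame x_trans F_alg).
    move=> _ [[i Si <-]|[nu _ <-]]; first by exists (a i) => //; apply: approx_near.
    by exists (z nu).
  move=> c cK; have [[i Si [di vi]]|[nu [dnu vnu]]] := approx_cover z_tail cK.
    by exists (a i); split => //; [apply: approx_alg | left; exists i].
  by exists (z nu); split => //; [right; exists nu | apply: ltW].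
split; first by rewrite minp_mem ?approx1_mem // size_XsubC.
split; first by move=> i Si; apply: (max_root_minp K_tame x_trans F_alg); apply: approx_near.
split; first by move=> nu; apply: (max_root_minp K_tame x_trans F_alg).
split.
  move=> i i1 Si; have [Sp [i0 ip iE]] := prev i i1 Si.
  have [_ dlt] := approx_mono Si i0 ip.
  split.
  - apply: adjoin1_min; first exact: adjoin_subset.
    by apply: (approx_adjoin K_tame x_trans F_alg Si i0); apply: ltnW.
  - move=> sub; have := adeg_le (approx_alg Sp) (sub _ (adjoin1_gen _ _)).
    by rewrite leqNgt dlt.
  - by rewrite (size_minp (approx_alg Sp)) (size_minp (approx_alg Si)) ltnS.
split.
  move=> i i1 Si; have [Sp [i0 ip iE]] := prev i i1 Si.
  by have [] := approx_mono Si i0 ip.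
split.
  move=> i Si Hi; have ai := approx_alg Si.
  have [_ bi] : best v K x (a i).
    case: Hi => [|nOi]; first exact: S_cont.
    have [Sp|[n [n0 Sn Snn nc]]] := indices_cases v K x; first by apply: S_cont; rewrite // Sp.
    have [bn _] := S_final n n0 Sn nOi.
    have : (indices v K x) i by []. rewrite Sn /upto /= => /andP[i0].
    rewrite leq_eqVlt => /predU1P[->//|lt].
    by have [] := indices_continues Snn i0 lt.
  split; first by exists (a i) => //; apply: adjoin1_gen.
  move=> _ [c cK ->]; apply: bi; last exact: adeg_le.
  exact: (adjoin_algebraic ai).
have fin n : (0 < n)%N -> (indices v K x) = upto n -> ~ inhabited Omega ->
    forall c, c \in algclosure K -> v (x - c) <= v (x - a n).
  move=> n0 Sn nOi c cK; have [_ nimp] := S_final n n0 Sn nOi.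
  by rewrite leNgt; apply/negP => lt; apply: nimp; exists c.
have Sn_n n : (0 < n)%N -> (indices v K x) = upto n -> (indices v K x) n.
  by move=> n0 ->; rewrite /upto /= n0 leqnn.
split.
  move=> n n0 Sn nOi; split.
    by exists (a n) => //; apply: approx_alg; apply: Sn_n.
  by move=> _ [c cK ->]; apply: fin.
split.
  move=> Oi; have [n [n0 Sn zn zcof]] := z_last Oi; exists n; split => //.
  - by apply: (approaching_pseudo_cauchy z_incr) => nu; have [] := zn nu.
  - apply: (approaching_transcendental z_incr _ zcof).
    exact/adjoin_algebraic/approx_alg/Sn_n.
  - move=> nu; have [_ dz] := zn nu.
    by rewrite (size_minp (zK nu)) (size_minp (approx_alg (Sn_n n n0 Sn))) dz.
split=> //.
split; first exact: (constants_upto K_tame x_trans F_alg).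
split.
  move=> k Sk; apply: (complete_minp K_tame x_trans F_alg).
    move=> _ [i /andP[i0 ik] <-]; exists (a i) => //.
    move: ik; rewrite leq_eqVlt => /predU1P[->|ik]; first exact/near_self/approx_alg.
    apply: near_transfer; first by apply/approx_near/(indices_le Sk i0)/ltnW.
    by have [] := approx_mono Sk i0 ik.
  move=> c cK; have k0 := indices_gt0 Sk.
  have [lt|le] := ltnP (deg c) (deg (a k)); last first.
    exists (a k); split => //; first exact: approx_alg.
      by exists k => //; rewrite /upto /= k0 leqnn.
    by rewrite subrr val0 val_lePInf.
  have [i [i0 ik di vi]] := approx_locate Sk cK lt.
  have Si := indices_le Sk i0 (ltnW ik).
  exists (a i); split => //; first exact: approx_alg.
    by exists i => //; rewrite /upto /= i0 ltnW.
  have [ltk _] := approx_mono Sk i0 ik.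
  by rewrite (dist_eq ltk) (dist_eq (le_lt_trans vi ltk)).
split; first exact: (constants_weakly_pure K_tame x_trans F_alg z_tail Ol).
split.
  split; last first.
    by move=> H; apply: (immediate_valuation_algebraic K_tame KL LK); apply: (constants_immediate K_tame x_trans F_alg z_tail).
  move=> va; apply: contrapT => H.
  have [Sp|[n [n0 Sn Snn _]]] := indices_cases v K x; first by apply: H; left.
  have nOi : ~ inhabited Omega by move=> Oi; apply: H; right.
  exact: (best_not_valuation_algebraic x_trans F_alg (approx_alg Snn) (fin n n0 Sn nOi) va).
split; first exact: (constants_immediate K_tame x_trans F_alg z_tail).
move=> Sp; split.
- by apply: (approaching_pseudo_cauchy (approx_increasing Sp)) => i; apply: approx_constants; rewrite Sp.
- exact: (approaching_transcendental (approx_increasing Sp) LK (approx_cofinal Sp)).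
- exact: (approaching_pseudo_limit (approx_increasing Sp)).
Qed.
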